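(* Let $\Delta$ be the open unit disc in $\mathbb{C}$, let $p\in b\Delta$ and let $\tau<1/2$. Suppose that $f$ is a continuous complex-valued function on $\overline{\Delta}$ such that (i) $f$ extends holomorphically from each circle $\{\zeta\in\mathbb{C}\colon |\zeta|=R\}$, $0<R\le 1$; (ii) $f$ extends holomorphically from each circle of radius $R\ge\tau$ which is contained in $\overline{\Delta}$ and passes through $p$. Then $f$ is holomorphic on $\Delta$.
   Context: $b\Delta$ denotes the unit circle, the boundary of $\Delta$. A function $f$ that is continuous on a circle $\Gamma\subset\mathbb{C}$ is said to extend holomorphically from $\Gamma$ if there is a continuous function on the closed disc bounded by $\Gamma$ which is holomorphic on the interior of that disc and agrees with $f$ on $\Gamma$. Circles have positive radius. *)

(* Defs.v *)
From Stdlib Require Import Reals.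
From Coquelicot Require Import Coquelicot.

(* Discs and circles are Euclidean (through [Cmod]); Coquelicot's [ball] on
   [C] is a square, although it induces the same topology. *)
Definition open_disc (c : C) (r : R) (z : C) : Prop := (Cmod (z - c) < r)%R.
Definition closed_disc (c : C) (r : R) (z : C) : Prop := (Cmod (z - c) <= r)%R.
Definition circle (c : C) (r : R) (z : C) : Prop := (Cmod (z - c) = r)%R.

(* Used for open [D] only: [ex_derive] is complex differentiability at an
   interior point. *)
Definition holomorphic_on (D : C -> Prop) (f : C -> C) : Prop :=
  forall z : C, D z -> @ex_derive C_AbsRing C_NormedModule f z.

(* [g] is only constrained on the closed disc: [continuous_on] is relative to
   it, and values elsewhere are irrelevant. *)
Definition extends_holomorphically (f : C -> C) (c : C) (r : R) : Prop :=
  exists g : C -> C,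
    @continuous_on C_UniformSpace C_UniformSpace (closed_disc c r) g /\
    holomorphic_on (open_disc c r) g /\
    (forall z : C, circle c r z -> g z = f z).

(* Main.v *)
(* Take [p = 1], and let [F_R], [G_r] be the extensions from the circles [|z| = R] and
   [|z - (1 - r)| = r].  Lift each disc to C^2 by [w = conj c + rho^2/(z - c)], so that [w = conj z]
   on its boundary circle.  For fixed [z] in the disc the lifts of both families through [z] run from
   [conj z] to [1/z]: along the line [w = R^2/z] and along an arc of a circle through [1].  Together
   they form a closed curve, and for [a] in the upper half plane
     Phi(z) = int F_R(z) dw/(w - a)^2 - int G_r(z) dw/(w - a)^2
   is holomorphic in [z] on [0 < Re z < 1 - 2 tau, Im z > 0], once it is extended by [0] to [|z| >= 1]
   (Morera: near [z0] the extensions are close to [f(z0)], and constants contribute the same to both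
   integrals).  Hence [Phi = 0].  Since [tau < 1/2], the limit at a real [x] in [(0, 1 - 2 tau)] exists;
   there the closed curve is the whole projective line.  Reflection gives the same for [a] in the lower
   half plane, so the Poisson integral of the boundary values is constant and [F_R(x)] does not depend
   on [R].  By the identity theorem [F_R = F_1] for every [R], that is, [f = F_1]. *)
Require Import Defs.
From Stdlib Require Import Reals Lra Psatz Classical ClassicalEpsilon FunctionalExtensionality.
From Coquelicot Require Import Coquelicot.
Local Open Scope R_scope.

(** * Continuity and complex differentiability *)

(** For real [c] and [Im z >= 0] the point [w = c + rho^2/(z - c)] has [Im w <= 0] or is infinite,
    so [a] in the upper half plane never lies on the path. The form [dw/(w - a)^2] is regular at
    infinity, which the second arc crosses when [z] is real, and has the single-valued primitive
    [-1/(w - a)]: its integral depends only on the end points [conj z] and [1/z], so constants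
    cancel. On the unit circle these end points coincide and both paths shrink to a point; hence the
    extension by [0] is continuous. A circle through [z] internally tangent to the unit circle at
    [1] has radius at least [(1 - Re z)/2]; this is the origin of the strip [Re z < 1 - 2 tau],
    which lies partly in [Re z > 0] because [tau < 1/2]. For one [z] only one half plane of [a] is
    available; on the real axis, where [z = conj z], reflection supplies the other. There the two
    kernels are densities of one sign on complementary arcs. Averaging [dw/(w - a)^2] over a segment
    gives [dw/((w - a)(w - b))], a multiple of the Poisson kernel at [b = conj a]; letting [a] tend
    to a boundary point recovers the value there. *)

Notation contC := (@continuous _ C_UniformSpace).
Notation contCC := (@continuous C_UniformSpace C_UniformSpace).

Lemma Cmod_sqr (z : C) : Cmod z * Cmod z = Re z * Re z + Im z * Im z.
Proof. generalize (Cmod2_alt z); simpl; intros H; nra. Qed.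

Lemma Cmod_le_Re_Im (z : C) : Cmod z <= Rabs (Re z) + Rabs (Im z).
Proof.
  pose proof (Cmod_sqr z). pose proof (Cmod_ge_0 z).
  pose proof (Rabs_pos (Re z)). pose proof (Rabs_pos (Im z)).
  pose proof (Rsqr_abs (Re z)). pose proof (Rsqr_abs (Im z)). unfold Rsqr in *.
  apply Rnot_lt_le; intros Hlt. nra.
Qed.

Lemma Im_le_Cmod (z : C) : Rabs (Im z) <= Cmod z.
Proof. eapply Rle_trans; [apply Rmax_r | apply Rmax_Cmod]. Qed.

Lemma Cmod_sub_comm (a b : C) : Cmod (a - b) = Cmod (b - a).
Proof. rewrite <- (Cmod_opp (b - a)). f_equal. ring. Qed.

Lemma Cmod_triangle_sub (a b c : C) : Cmod (a - c) <= Cmod (a - b) + Cmod (b - c).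
Proof. replace (a - c)%C with ((a - b) + (b - c))%C by ring. apply Cmod_triangle. Qed.

Lemma Cmod_reverse_triangle (a b : C) : Rabs (Cmod a - Cmod b) <= Cmod (a - b).
Proof.
  pose proof (Cmod_triangle (a - b) b). pose proof (Cmod_triangle (b - a) a).
  rewrite (Cmod_sub_comm b a) in H0.
  replace (a - b + b)%C with a in H by ring. replace (b - a + a)%C with b in H0 by ring.
  apply Rabs_le; lra.
Qed.

(** Neighbourhoods in [C] are squares; comparing [Cmod] with the coordinates lets all later
    arguments use Euclidean discs. *)
Lemma locally_Cmod (z : C) (P : C -> Prop) :
  @locally C_UniformSpace z P <-> exists d, 0 < d /\ forall w, Cmod (w - z) < d -> P w.
Proof.
  split.
  - intros [d Hd]. exists d. split; [apply cond_pos|]. intros w Hw. apply Hd.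
    apply C_NormedModule_mixin_compat1. exact Hw.
  - intros [d [Hd H]].
    assert (Hd2 : 0 < d / 2) by lra.
    exists (mkposreal _ Hd2). intros w Hw. apply H.
    destruct Hw as [H1 H2]. unfold ball in H1, H2; simpl in H1, H2.
    unfold AbsRing_ball, abs, minus, plus, opp in H1, H2; simpl in H1, H2.
    eapply Rle_lt_trans; [apply Cmod_le_Re_Im|]. unfold Re, Im; simpl.
    unfold Rminus in *. lra.
Qed.

Section Continuity.
Context {U : UniformSpace}.

Lemma contC_eps (f : U -> C) (x : U) :
  contC f x <-> forall e, 0 < e -> locally x (fun y => Cmod (f y - f x) < e).
Proof.
  split.
  - intros H e He. apply (H (fun w => Cmod (w - f x) < e)). apply locally_Cmod. exists e. auto.
  - intros H P HP. apply locally_Cmod in HP. destruct HP as [d [Hd HP]].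
    unfold filtermap. generalize (H d Hd). apply filter_imp. auto.
Qed.

Lemma contR_eps (f : U -> R) (x : U) :
  continuous f x <-> forall e, 0 < e -> locally x (fun y => Rabs (f y - f x) < e).
Proof.
  split.
  - intros H e He. apply (H (fun y => Rabs (y - f x) < e)). exists (mkposreal e He). auto.
  - intros H P [d HP]. unfold filtermap. generalize (H d (cond_pos d)). apply filter_imp. auto.
Qed.

Lemma contC_Re (f : U -> C) (x : U) : contC f x -> continuous (fun u => Re (f u)) x.
Proof.
  intros H. apply contR_eps. intros e He. generalize (proj1 (contC_eps f x) H e He).
  apply filter_imp. intros y Hy.
  replace (Re (f y) - Re (f x)) with (Re (f y - f x)) by reflexivity.
  eapply Rle_lt_trans; [apply re_le_Cmod|exact Hy].
Qed.

Lemma contC_Im (f : U -> C) (x : U) : contC f x -> continuous (fun u => Im (f u)) x.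
Proof.
  intros H. apply contR_eps. intros e He. generalize (proj1 (contC_eps f x) H e He).
  apply filter_imp. intros y Hy.
  replace (Im (f y) - Im (f x)) with (Im (f y - f x)) by reflexivity.
  eapply Rle_lt_trans; [apply Im_le_Cmod|exact Hy].
Qed.

Lemma contC_pair (f g : U -> R) (x : U) :
  continuous f x -> continuous g x -> contC (fun u => (f u, g u) : C) x.
Proof.
  intros Hf Hg. apply contC_eps. intros e He.
  assert (He2 : 0 < e / 2) by lra.
  generalize (filter_and _ _ (proj1 (contR_eps f x) Hf _ He2) (proj1 (contR_eps g x) Hg _ He2)).
  apply filter_imp. intros y [H1 H2]. eapply Rle_lt_trans; [apply Cmod_le_Re_Im|].
  unfold Re, Im; simpl. unfold Rminus in *. lra.
Qed.

Lemma contC_const (c : C) (x : U) : contC (fun _ => c) x.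
Proof. apply continuous_const. Qed.

Lemma contC_RtoC (f : U -> R) (x : U) : continuous f x -> contC (fun u => RtoC (f u)) x.
Proof. intros H. apply contC_pair; [exact H | apply continuous_const]. Qed.

Lemma contC_plus (f g : U -> C) (x : U) :
  contC f x -> contC g x -> contC (fun u => (f u + g u)%C) x.
Proof.
  intros Hf Hg. apply contC_pair.
  - apply (continuous_plus (V := R_NormedModule)); now apply contC_Re.
  - apply (continuous_plus (V := R_NormedModule)); now apply contC_Im.
Qed.

Lemma contC_opp (f : U -> C) (x : U) : contC f x -> contC (fun u => (- f u)%C) x.
Proof.
  intros Hf. apply contC_pair.
  - apply (continuous_opp (V := R_NormedModule)); now apply contC_Re.
  - apply (continuous_opp (V := R_NormedModule)); now apply contC_Im.
Qed.

Lemma contC_minus (f g : U -> C) (x : U) :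
  contC f x -> contC g x -> contC (fun u => (f u - g u)%C) x.
Proof. intros Hf Hg. apply contC_plus; [|apply contC_opp]; assumption. Qed.

Lemma contR_mult (f g : U -> R) (x : U) :
  continuous f x -> continuous g x -> continuous (fun u => f u * g u) x.
Proof. apply (continuous_mult (K := R_AbsRing)). Qed.

Lemma contR_plus (f g : U -> R) (x : U) :
  continuous f x -> continuous g x -> continuous (fun u => f u + g u) x.
Proof. apply (continuous_plus (V := R_NormedModule)). Qed.

Lemma contR_minus (f g : U -> R) (x : U) :
  continuous f x -> continuous g x -> continuous (fun u => f u - g u) x.
Proof. apply (continuous_minus (V := R_NormedModule)). Qed.

Lemma contR_inv (f : U -> R) (x : U) :
  continuous f x -> f x <> 0 -> continuous (fun u => / f u) x.
Proof.
  intros H H0. apply (continuous_comp f Rinv); [exact H|].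
  apply continuity_pt_filterlim. apply (continuity_pt_inv (fun t => t)); [|exact H0].
  apply derivable_continuous_pt, derivable_pt_id.
Qed.

Lemma contR_abs (f : U -> R) (x : U) : continuous f x -> continuous (fun u => Rabs (f u)) x.
Proof.
  intros H. apply (continuous_comp f Rabs); [exact H|].
  apply continuity_pt_filterlim, Rcontinuity_abs.
Qed.

Lemma contR_max (f g : U -> R) (x : U) :
  continuous f x -> continuous g x -> continuous (fun u => Rmax (f u) (g u)) x.
Proof.
  intros Hf Hg.
  apply (continuous_ext (fun u => / 2 * ((f u + g u) + Rabs (f u - g u)))).
  - intros u. unfold Rmax, Rabs. destruct Rle_dec; destruct Rcase_abs; lra.
  - apply contR_mult; [apply continuous_const|].
    apply contR_plus; [now apply contR_plus|]. apply contR_abs. now apply contR_minus.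
Qed.

Lemma contR_min (f g : U -> R) (x : U) :
  continuous f x -> continuous g x -> continuous (fun u => Rmin (f u) (g u)) x.
Proof.
  intros Hf Hg.
  apply (continuous_ext (fun u => / 2 * ((f u + g u) - Rabs (f u - g u)))).
  - intros u. unfold Rmin, Rabs. destruct Rle_dec; destruct Rcase_abs; lra.
  - apply contR_mult; [apply continuous_const|].
    apply contR_minus; [now apply contR_plus|]. apply contR_abs. now apply contR_minus.
Qed.

Lemma contC_mult (f g : U -> C) (x : U) :
  contC f x -> contC g x -> contC (fun u => (f u * g u)%C) x.
Proof.
  intros Hf Hg.
  pose proof (contC_Re _ _ Hf). pose proof (contC_Im _ _ Hf).
  pose proof (contC_Re _ _ Hg). pose proof (contC_Im _ _ Hg).
  apply contC_pair.
  - apply contR_minus; now apply contR_mult.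
  - apply contR_plus; now apply contR_mult.
Qed.

Lemma contC_inv (f : U -> C) (x : U) :
  contC f x -> f x <> RtoC 0 -> contC (fun u => (/ f u)%C) x.
Proof.
  intros Hf H0.
  pose proof (contC_Re _ _ Hf) as Hr. pose proof (contC_Im _ _ Hf) as Hi.
  assert (Hn : fst (f x) ^ 2 + snd (f x) ^ 2 <> 0).
  { intros E. apply H0. apply Cmod_eq_0. unfold Cmod. rewrite E. apply sqrt_0. }
  assert (Hq : continuous (fun u => / (fst (f u) ^ 2 + snd (f u) ^ 2)) x).
  { apply contR_inv; [|exact Hn]. simpl.
    apply contR_plus; apply contR_mult; [exact Hr | apply contR_mult; [exact Hr|apply continuous_const]
     | exact Hi | apply contR_mult; [exact Hi|apply continuous_const]]. }
  apply contC_pair; apply contR_mult; auto.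
  apply (continuous_opp (V := R_NormedModule)); exact Hi.
Qed.

Lemma contC_div (f g : U -> C) (x : U) :
  contC f x -> contC g x -> g x <> RtoC 0 -> contC (fun u => (f u / g u)%C) x.
Proof. intros. apply contC_mult; [|apply contC_inv]; assumption. Qed.

Lemma contC_conj (f : U -> C) (x : U) : contC f x -> contC (fun u => Cconj (f u)) x.
Proof.
  intros Hf. apply contC_pair; [now apply contC_Re|].
  apply (continuous_opp (V := R_NormedModule)); now apply contC_Im.
Qed.

Lemma contC_Cmod (f : U -> C) (x : U) : contC f x -> continuous (fun u => Cmod (f u)) x.
Proof.
  intros H. apply contR_eps. intros e He. generalize (proj1 (contC_eps f x) H e He).
  apply filter_imp. intros y Hy. eapply Rle_lt_trans; [apply Cmod_reverse_triangle|exact Hy].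
Qed.

Lemma contC_comp (g : C -> C) (f : U -> C) (x : U) :
  contC f x -> contCC g (f x) -> contC (fun u => g (f u)) x.
Proof. apply (continuous_comp (V := C_UniformSpace) (W := C_UniformSpace)). Qed.

Lemma contC_compR (g : R -> C) (f : U -> R) (x : U) :
  continuous f x -> contC g (f x) -> contC (fun u => g (f u)) x.
Proof. apply (continuous_comp (W := C_UniformSpace)). Qed.

End Continuity.

(** Used to carry identities to the edge of their range: end points of a parameter interval, the
    real axis, the origin. *)
Lemma contC_limit_eq (f : R -> C) (t : R) (k : C) : contC f t ->
  (forall d, 0 < d -> exists s, Rabs (s - t) < d /\ f s = k) -> f t = k.
Proof.
  intros Hf H. assert (Z : Cmod (k - f t) <= 0).
  { apply Rnot_lt_le. intros Hlt. destruct (proj1 (contC_eps f t) Hf _ Hlt) as [d Hd].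
    destruct (H d (cond_pos d)) as (s & Hs & E). specialize (Hd s Hs). rewrite E in Hd. lra. }
  assert (E : (k - f t)%C = RtoC 0) by (apply Cmod_eq_0; pose proof (Cmod_ge_0 (k - f t)); lra).
  replace (f t) with (k - (k - f t))%C by ring. rewrite E. ring.
Qed.

Lemma contC_id (z : C) : contCC (fun w => w) z.
Proof. apply continuous_id. Qed.

(* Caratheodory's form of complex differentiability. *)
Definition hol (f : C -> C) (z : C) : Prop :=
  exists q : C -> C, contCC q z /\
    forall w, f w = (f z + q w * (w - z))%C.

Lemma hol_iff_ex_derive (f : C -> C) (z : C) :
  hol f z <-> @ex_derive C_AbsRing C_NormedModule f z.
Proof.
  split.
  - intros [q [Hq E]]. exists (q z). split; [apply is_linear_scal_l|].
    intros x Hx. apply (is_filter_lim_locally_unique (V := AbsRing_NormedModule C_AbsRing) z x) in Hx. subst x.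
    intros eps.
    assert (Hl : @locally C_UniformSpace z (fun w => Cmod (q w - q z) < eps)).
    { apply (proj1 (contC_eps q z) Hq). apply cond_pos. }
    apply locally_Cmod in Hl. destruct Hl as [d [Hd Hl]].
    exists (mkposreal d Hd). intros w Hw.
    change (Cmod ((f w + - f z) + - ((w + - z) * q z))%C <= eps * Cmod (w + - z)%C).
    assert (Hw' : Cmod (w - z) < d) by exact Hw.
    rewrite (E w).
    replace ((f z + q w * (w - z) + - f z) + - ((w + - z) * q z))%C with ((q w - q z) * (w - z))%C by ring.
    rewrite Cmod_mult. apply Rmult_le_compat_r; [apply Cmod_ge_0|]. left. now apply Hl.
  - intros [l [_ Hl]]. specialize (Hl z (fun P HP => HP)).
    (* The difference quotient, completed by the derivative [l] at [z]. *)
    exists (fun w => if excluded_middle_informative (w = z) then l else ((f w - f z) / (w - z))%C).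
    assert (Hq : forall w, f w = (f z + (if excluded_middle_informative (w = z) then l else ((f w - f z) / (w - z))%C) * (w - z))%C).
    { intros w. destruct excluded_middle_informative as [->|Hn]; [ring|].
      field. intros E. apply Hn. replace w with ((w - z) + z)%C by ring. rewrite E. ring. }
    split; [|exact Hq].
    apply contC_eps. intros e He. assert (He2 : 0 < e / 2) by lra.
    destruct (Hl (mkposreal _ He2)) as [d Hd].
    apply locally_Cmod. exists d. split; [apply cond_pos|]. intros w Hw.
    destruct (excluded_middle_informative (z = z)) as [_|C]; [|congruence].
    specialize (Hd w Hw).
    change (Cmod ((f w + - f z) + - ((w + - z) * l))%C <= e / 2 * Cmod (w + - z)%C) in Hd.
    specialize (Hq w). destruct excluded_middle_informative as [->|Hn].
    + replace (l - l)%C with (RtoC 0) by ring. rewrite Cmod_0. exact He.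
    + assert (Hp : 0 < Cmod (w - z)).
      { apply Cmod_gt_0. intros E. apply Hn. replace w with ((w - z) + z)%C by ring. rewrite E. ring. }
      set (Q := ((f w - f z) / (w - z))%C) in *.
      replace ((f w + - f z) + - ((w + - z) * l))%C with ((Q - l) * (w - z))%C in Hd
        by (rewrite Hq; ring).
      rewrite Cmod_mult in Hd. change (w + - z)%C with (w - z)%C in Hd.
      apply Rmult_le_reg_r in Hd; [lra|exact Hp].
Qed.

Lemma hol_cont (f : C -> C) (z : C) : hol f z -> contCC f z.
Proof.
  intros [q [Hq E]]. apply (continuous_ext (fun w => (f z + q w * (w - z))%C)).
  - intros w. now rewrite <- E.
  - apply contC_plus; [apply contC_const|]. apply contC_mult; [exact Hq|].
    apply contC_minus; [apply contC_id|apply contC_const].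
Qed.

Lemma hol_const (c z : C) : hol (fun _ => c) z.
Proof. exists (fun _ => RtoC 0). split; [apply contC_const|]. intros; ring. Qed.

Lemma hol_id (z : C) : hol (fun w => w) z.
Proof. exists (fun _ => RtoC 1). split; [apply contC_const|]. intros; ring. Qed.

Lemma hol_plus (f g : C -> C) (z : C) : hol f z -> hol g z -> hol (fun w => f w + g w)%C z.
Proof.
  intros [p [Hp Ef]] [q [Hq Eg]]. exists (fun w => p w + q w)%C.
  split; [now apply contC_plus|]. intros w. rewrite (Ef w), (Eg w). ring.
Qed.

Lemma hol_mult (f g : C -> C) (z : C) : hol f z -> hol g z -> hol (fun w => f w * g w)%C z.
Proof.
  intros Hf Hg. pose proof (hol_cont g z Hg) as Cg.
  destruct Hf as [p [Hp Ef]], Hg as [q [Hq Eg]]. exists (fun w => p w * g w + f z * q w)%C.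
  split.
  - apply contC_plus; apply contC_mult; try assumption. apply contC_const.
  - intros w. rewrite (Ef w), (Eg w). ring.
Qed.

Lemma hol_minus (f g : C -> C) (z : C) : hol f z -> hol g z -> hol (fun w => f w - g w)%C z.
Proof.
  intros [p [Hp Ef]] [q [Hq Eg]]. exists (fun w => p w - q w)%C.
  split; [now apply contC_minus|]. intros w. rewrite (Ef w), (Eg w). ring.
Qed.

Lemma hol_ext_loc (f g : C -> C) (z : C) :
  @locally C_UniformSpace z (fun w => f w = g w) -> hol f z -> hol g z.
Proof.
  intros E H. apply hol_iff_ex_derive. apply hol_iff_ex_derive in H.
  destruct H as [l Hl]. exists l. apply (is_derive_ext_loc f); [|exact Hl].
  apply locally_Cmod in E. destruct E as [d [Hd E]]. exists (mkposreal d Hd).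
  intros w Hw. apply E. exact Hw.
Qed.

Lemma hol_inv (f : C -> C) (z : C) : hol f z -> f z <> RtoC 0 -> hol (fun w => / f w)%C z.
Proof.
  intros Hf H0. pose proof (hol_cont f z Hf) as Cf.
  destruct Hf as [q [Hq E]].
  (* Caratheodory's identity is global, but [1/f] satisfies it only where [f w] is nonzero; [g]
     satisfies it everywhere and equals [1/f] near [z]. *)
  set (g := fun w => (/ f z + (- q w / (f w * f z)) * (w - z))%C).
  assert (Hg : hol g z).
  { exists (fun w => - q w / (f w * f z))%C. split.
    - apply contC_div; [now apply contC_opp| |].
      + apply contC_mult; [exact Cf|apply contC_const].
      + apply Cmult_neq_0; assumption.
    - intros w. unfold g. ring. }
  apply (hol_ext_loc g); [|exact Hg].
  pose proof (contC_Cmod _ _ Cf) as Cm.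
  assert (Hp : 0 < Cmod (f z)) by (now apply Cmod_gt_0).
  generalize (proj1 (contR_eps _ _) Cm _ Hp). apply filter_imp. intros w Hw.
  assert (Hfw : f w <> RtoC 0).
  { intros E0. rewrite E0, Cmod_0 in Hw. unfold Rminus in Hw. rewrite Rplus_0_l, Rabs_Ropp, Rabs_pos_eq in Hw; lra. }
  unfold g.
  assert (Ew : (q w * (w - z))%C = (f w - f z)%C) by (rewrite (E w); ring).
  replace (- q w / (f w * f z) * (w - z))%C with (- (q w * (w - z)) / (f w * f z))%C
    by (field; split; assumption).
  rewrite Ew. field. split; assumption.
Qed.

Lemma hol_div (f g : C -> C) (z : C) :
  hol f z -> hol g z -> g z <> RtoC 0 -> hol (fun w => f w / g w)%C z.
Proof. intros. apply hol_mult; [|apply hol_inv]; assumption. Qed.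

Lemma hol_comp (g f : C -> C) (z : C) : hol f z -> hol g (f z) -> hol (fun w => g (f w)) z.
Proof.
  intros Hf Hg. pose proof (hol_cont f z Hf) as Cf.
  destruct Hf as [p [Hp Ef]], Hg as [q [Hq Eg]]. exists (fun w => q (f w) * p w)%C. split.
  - apply contC_mult; [|exact Hp]. now apply contC_comp.
  - intros w. rewrite (Eg (f w)). rewrite (Ef w) at 2. ring.
Qed.

(** * Integrals of curves in the plane *)

Definition CI (f : R -> C) (a b : R) : C := RInt (V := C_R_CompleteNormedModule) f a b.

(** Continuity at the end points is two-sided, so data given only on an interval or a disc are first
    extended by [clamp] or [retract]. *)
Definition cont_on (f : R -> C) (a b : R) : Prop :=
  forall t, Rmin a b <= t <= Rmax a b -> contC f t.

Lemma norm_Cmod (z : C) : @norm R_AbsRing C_R_NormedModule z = Cmod z.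
Proof.
  unfold norm; simpl. unfold prod_norm, Cmod, norm; simpl. unfold abs; simpl. f_equal.
  rewrite !Rmult_1_r. rewrite <- !Rabs_mult. rewrite !Rabs_pos_eq; nra.
Qed.

Lemma CI_is (f : R -> C) (a b : R) :
  cont_on f a b -> is_RInt (V := C_R_NormedModule) f a b (CI f a b).
Proof.
  intros H. apply (RInt_correct (V := C_R_CompleteNormedModule)).
  apply (ex_RInt_continuous (V := C_R_CompleteNormedModule)). exact H.
Qed.

Lemma CI_unique (f : R -> C) (a b : R) (l : C) :
  is_RInt (V := C_R_NormedModule) f a b l -> CI f a b = l.
Proof. apply (is_RInt_unique (V := C_R_CompleteNormedModule)). Qed.

Lemma CI_ext (f g : R -> C) (a b : R) :
  (forall t, Rmin a b <= t <= Rmax a b -> f t = g t) -> CI f a b = CI g a b.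
Proof.
  intros H. apply (RInt_ext (V := C_R_CompleteNormedModule)). intros t Ht. apply H. lra.
Qed.

Lemma CI_ext_le (f g : R -> C) (a b : R) : a <= b ->
  (forall t, a <= t <= b -> f t = g t) -> CI f a b = CI g a b.
Proof. intros Hab H. apply CI_ext. now rewrite Rmin_left, Rmax_right. Qed.

Lemma CI_plus (f g : R -> C) (a b : R) : cont_on f a b -> cont_on g a b ->
  CI (fun t => (f t + g t)%C) a b = (CI f a b + CI g a b)%C.
Proof.
  intros Hf Hg. apply CI_unique.
  apply (is_RInt_plus (V := C_R_NormedModule) f g); now apply CI_is.
Qed.

Lemma CI_minus (f g : R -> C) (a b : R) : cont_on f a b -> cont_on g a b ->
  CI (fun t => (f t - g t)%C) a b = (CI f a b - CI g a b)%C.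
Proof.
  intros Hf Hg. apply CI_unique.
  apply (is_RInt_minus (V := C_R_NormedModule) f g); now apply CI_is.
Qed.

Lemma is_RInt_C_fst (f : R -> C) (a b : R) (l : C) :
  is_RInt (V := C_R_NormedModule) f a b l -> is_RInt (fun t => Re (f t)) a b (Re l).
Proof. apply (is_RInt_fct_extend_fst (U := R_NormedModule) (V := R_NormedModule)). Qed.

Lemma is_RInt_C_snd (f : R -> C) (a b : R) (l : C) :
  is_RInt (V := C_R_NormedModule) f a b l -> is_RInt (fun t => Im (f t)) a b (Im l).
Proof. apply (is_RInt_fct_extend_snd (U := R_NormedModule) (V := R_NormedModule)). Qed.

Lemma is_RInt_C_pair (f : R -> C) (a b : R) (l : C) :
  is_RInt (fun t => Re (f t)) a b (Re l) -> is_RInt (fun t => Im (f t)) a b (Im l) ->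
  is_RInt (V := C_R_NormedModule) f a b l.
Proof.
  intros H1 H2. rewrite (surjective_pairing l).
  now apply (is_RInt_fct_extend_pair (U := R_NormedModule) (V := R_NormedModule)).
Qed.

(** The integral is taken in a real vector space; a complex factor is pulled out through real and
    imaginary parts. *)
Lemma CI_mult_l (c : C) (f : R -> C) (a b : R) : cont_on f a b ->
  CI (fun t => (c * f t)%C) a b = (c * CI f a b)%C.
Proof.
  intros Hf. apply CI_unique. apply CI_is in Hf.
  pose proof (is_RInt_C_fst _ _ _ _ Hf) as H1. pose proof (is_RInt_C_snd _ _ _ _ Hf) as H2.
  set (l := CI f a b) in *. apply is_RInt_C_pair.
  - apply (is_RInt_minus (V := R_NormedModule) (fun t => scal (Re c) (Re (f t))) (fun t => scal (Im c) (Im (f t))));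
      now apply (is_RInt_scal (V := R_NormedModule)).
  - apply (is_RInt_plus (V := R_NormedModule) (fun t => scal (Re c) (Im (f t))) (fun t => scal (Im c) (Re (f t))));
      now apply (is_RInt_scal (V := R_NormedModule)).
Qed.

Lemma CI_conj (f : R -> C) (a b : R) : cont_on f a b ->
  CI (fun t => Cconj (f t)) a b = Cconj (CI f a b).
Proof.
  intros Hf. apply CI_unique. apply CI_is in Hf.
  pose proof (is_RInt_C_fst _ _ _ _ Hf) as H1. pose proof (is_RInt_C_snd _ _ _ _ Hf) as H2.
  apply is_RInt_C_pair; [exact H1|].
  apply (is_RInt_opp (V := R_NormedModule) (fun t => Im (f t))). exact H2.
Qed.

Lemma CI_RtoC (f : R -> R) (a b : R) :
  (forall t, Rmin a b <= t <= Rmax a b -> continuous f t) ->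
  CI (fun t => RtoC (f t)) a b = RtoC (RInt f a b).
Proof.
  intros Hf. apply CI_unique. apply is_RInt_C_pair; simpl.
  - apply (RInt_correct (V := R_CompleteNormedModule)).
    now apply (ex_RInt_continuous (V := R_CompleteNormedModule)).
  - pose proof (is_RInt_const (V := R_NormedModule) a b (0 : R)) as H0.
    change (is_RInt (V := R_NormedModule) (fun _ => 0) a b ((b - a) * 0)) in H0.
    rewrite Rmult_0_r in H0. exact H0.
Qed.

Lemma CI_const (c : C) (a b : R) : CI (fun _ => c) a b = (RtoC (b - a) * c)%C.
Proof.
  apply CI_unique. replace (RtoC (b - a) * c)%C with (@scal _ C_R_NormedModule (b - a) c).
  - apply (is_RInt_const (V := C_R_NormedModule)).
  - unfold scal; simpl. unfold prod_scal, scal; simpl. unfold mult; simpl.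
    unfold Cmult, RtoC; simpl. f_equal; ring.
Qed.

Lemma CI_Chasles (f : R -> C) (a b c : R) : cont_on f a b -> cont_on f b c ->
  CI f a c = (CI f a b + CI f b c)%C.
Proof.
  intros H1 H2. apply CI_unique.
  apply (is_RInt_Chasles (V := C_R_NormedModule) f a b c); now apply CI_is.
Qed.

Lemma CI_point (f : R -> C) (a : R) : CI f a a = RtoC 0.
Proof. apply CI_unique. apply (is_RInt_point (V := C_R_NormedModule)). Qed.

Lemma CI_swap (f : R -> C) (a b : R) : cont_on f a b -> CI f b a = (- CI f a b)%C.
Proof.
  intros H. apply CI_unique. apply (is_RInt_swap (V := C_R_NormedModule)). now apply CI_is.
Qed.

Lemma CI_bound (f : R -> C) (a b M : R) : a <= b -> cont_on f a b ->
  (forall t, a <= t <= b -> Cmod (f t) <= M) -> Cmod (CI f a b) <= (b - a) * M.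
Proof.
  intros Hab Hf HM. rewrite <- norm_Cmod.
  apply (norm_RInt_le_const (V := C_R_NormedModule) f); [exact Hab| |now apply CI_is].
  intros t Ht. rewrite norm_Cmod. now apply HM.
Qed.

Lemma CI_bound_abs (f : R -> C) (a b M : R) : cont_on f a b ->
  (forall t, Rmin a b <= t <= Rmax a b -> Cmod (f t) <= M) -> Cmod (CI f a b) <= Rabs (b - a) * M.
Proof.
  intros Hf HM. rewrite <- norm_Cmod.
  apply (norm_RInt_le_const_abs (V := C_R_NormedModule) f); [|now apply CI_is].
  intros t Ht. rewrite norm_Cmod. now apply HM.
Qed.

Lemma CI_bound_fun (f : R -> C) (g : R -> R) (a b : R) : a <= b -> cont_on f a b ->
  (forall t, a <= t <= b -> continuous g t) ->
  (forall t, a <= t <= b -> Cmod (f t) <= g t) -> Cmod (CI f a b) <= RInt g a b.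
Proof.
  intros Hab Hf Hg HM. rewrite <- norm_Cmod.
  apply (norm_RInt_le (V := C_R_NormedModule) f g a b _ _ Hab); [|now apply CI_is|].
  - intros t Ht. rewrite norm_Cmod. now apply HM.
  - apply (RInt_correct (V := R_CompleteNormedModule)).
    apply (ex_RInt_continuous (V := R_CompleteNormedModule)).
    intros t. rewrite Rmin_left, Rmax_right by assumption. auto.
Qed.

(* Caratheodory's form of the derivative of a curve. *)
Definition dcurve (F : R -> C) (t : R) (l : C) : Prop :=
  exists q : R -> C, contC q t /\ q t = l /\ forall s, F s = (F t + q s * RtoC (s - t))%C.

Lemma scal_minus_C (u v l : C) (s t : R) :
  @minus C_R_NormedModule (@minus C_R_NormedModule u v) (@scal _ C_R_NormedModule (@minus R_AbelianGroup s t) l)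
  = (u - v - RtoC (s - t) * l)%C.
Proof.
  change (Cplus (Cplus u (Copp v)) (Copp (((s + - t) * fst l)%R, ((s + - t) * snd l)%R)) = (u - v - RtoC (s - t) * l)%C).
  apply injective_projections; simpl; ring.
Qed.

Lemma dcurve_is_derive (F : R -> C) (t : R) (l : C) :
  dcurve F t l <-> is_derive (V := C_R_NormedModule) F t l.
Proof.
  split.
  - intros [q [Hq [El E]]]. subst l. split; [apply is_linear_scal_l|].
    intros x Hx. apply (is_filter_lim_locally_unique (V := AbsRing_NormedModule R_AbsRing) t x) in Hx. subst x.
    intros eps.
    generalize (proj1 (contC_eps q t) Hq eps (cond_pos eps)). apply filter_imp. intros s Hs.
    rewrite norm_Cmod.
    rewrite scal_minus_C. change (norm (minus s t)) with (Rabs (s - t)).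
    rewrite (E s).
    replace (F t + q s * RtoC (s - t) - F t - RtoC (s - t) * q t)%C with ((q s - q t) * RtoC (s - t))%C by ring.
    rewrite Cmod_mult, Cmod_R. apply Rmult_le_compat_r; [apply Rabs_pos|]. now left.
  - intros [_ Hl]. specialize (Hl t (fun P HP => HP)).
    exists (fun s => if excluded_middle_informative (s = t) then l else ((F s - F t) / RtoC (s - t))%C).
    assert (Hq : forall s, F s = (F t + (if excluded_middle_informative (s = t) then l else ((F s - F t) / RtoC (s - t))%C) * RtoC (s - t))%C).
    { intros s. destruct excluded_middle_informative as [->|Hn].
      - replace (t - t) with 0 by ring. ring.
      - field. intros E. apply RtoC_inj in E. apply Hn. lra. }
    split; [|split; [destruct excluded_middle_informative; congruence | exact Hq]].
    apply contC_eps. intros e He. assert (He2 : 0 < e / 2) by lra.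
    generalize (Hl (mkposreal _ He2)). apply filter_imp. intros s Hs.
    destruct (excluded_middle_informative (t = t)) as [_|C]; [|congruence].
    rewrite norm_Cmod, scal_minus_C in Hs. specialize (Hq s).
    destruct excluded_middle_informative as [->|Hn].
    + replace (l - l)%C with (RtoC 0) by ring. rewrite Cmod_0. exact He.
    + set (Q := ((F s - F t) / RtoC (s - t))%C) in *.
      assert (Hp : 0 < Rabs (s - t)) by (apply Rabs_pos_lt; lra).
      rewrite Hq in Hs.
      replace (F t + Q * RtoC (s - t) - F t - RtoC (s - t) * l)%C with ((Q - l) * RtoC (s - t))%C in Hs by ring.
      rewrite Cmod_mult, Cmod_R in Hs.
      change (norm (minus s t)) with (Rabs (s - t)) in Hs. simpl in Hs.
      apply Rmult_le_reg_r in Hs; lra.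
Qed.

Lemma dcurve_cont (F : R -> C) (t : R) (l : C) : dcurve F t l -> contC F t.
Proof.
  intros [q [Hq [_ E]]]. apply (continuous_ext (fun s => (F t + q s * RtoC (s - t))%C)).
  - intros s. now rewrite <- E.
  - apply contC_plus; [apply contC_const|]. apply contC_mult; [exact Hq|].
    apply contC_RtoC. apply contR_minus; [apply continuous_id | apply continuous_const].
Qed.

Lemma dcurve_eps (F : R -> C) (t : R) (l : C) :
  (forall e, 0 < e -> exists d, 0 < d /\ forall s, Rabs (s - t) < d ->
     Cmod (F s - F t - RtoC (s - t) * l) <= e * Rabs (s - t)) -> dcurve F t l.
Proof.
  intros H. apply dcurve_is_derive. split; [apply is_linear_scal_l|].
  intros x Hx. apply (is_filter_lim_locally_unique (V := AbsRing_NormedModule R_AbsRing) t x) in Hx. subst x.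
  intros eps. destruct (H eps (cond_pos eps)) as [d [Hd Hs]].
  exists (mkposreal d Hd). intros s Hst. rewrite norm_Cmod.
  rewrite scal_minus_C. apply Hs. exact Hst.
Qed.

Lemma CI_derive (F f : R -> C) (a b : R) :
  (forall t, Rmin a b <= t <= Rmax a b -> dcurve F t (f t)) -> cont_on f a b ->
  CI f a b = (F b - F a)%C.
Proof.
  intros HF Hf. apply CI_unique.
  apply (is_RInt_derive (V := C_R_CompleteNormedModule) F f a b); [|exact Hf].
  intros t Ht. apply dcurve_is_derive. now apply HF.
Qed.

Lemma dcurve_const (c : C) (t : R) : dcurve (fun _ => c) t 0.
Proof. exists (fun _ => RtoC 0). split; [apply contC_const|]. split; [reflexivity|]. intros; ring. Qed.

Lemma dcurve_RtoC (f : R -> R) (t l : R) : is_derive f t l -> dcurve (fun s => RtoC (f s)) t (RtoC l).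
Proof.
  intros H. apply dcurve_eps. intros e He. destruct H as [_ H].
  destruct (H t (fun P HP => HP) (mkposreal e He)) as [d Hd]. exists d. split; [apply cond_pos|].
  intros s Hs. specialize (Hd s Hs).
  rewrite <- RtoC_mult, <- !RtoC_minus, Cmod_R. exact Hd.
Qed.

Lemma dcurve_plus (F G : R -> C) (t : R) (l m : C) :
  dcurve F t l -> dcurve G t m -> dcurve (fun s => F s + G s)%C t (l + m).
Proof.
  intros [p [Hp [El EF]]] [q [Hq [Em EG]]]. exists (fun s => p s + q s)%C.
  split; [now apply contC_plus|]. split; [now rewrite El, Em|].
  intros s. rewrite (EF s), (EG s). ring.
Qed.

Lemma dcurve_mult (F G : R -> C) (t : R) (l m : C) :
  dcurve F t l -> dcurve G t m -> dcurve (fun s => F s * G s)%C t (l * G t + F t * m).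
Proof.
  intros HF HG. pose proof (dcurve_cont _ _ _ HG) as CG.
  destruct HF as [p [Hp [El EF]]], HG as [q [Hq [Em EG]]]. exists (fun s => p s * G s + F t * q s)%C.
  split; [apply contC_plus; apply contC_mult; try assumption; apply contC_const|].
  split; [now rewrite El, Em|].
  intros s. rewrite (EF s), (EG s). ring.
Qed.

Lemma dcurve_eq (F : R -> C) (t : R) (l m : C) : dcurve F t l -> l = m -> dcurve F t m.
Proof. now intros H <-. Qed.

Lemma dcurve_scal (c : C) (F : R -> C) (t : R) (l : C) :
  dcurve F t l -> dcurve (fun s => c * F s)%C t (c * l).
Proof.
  intros H. eapply dcurve_eq; [apply (dcurve_mult (fun _ => c) F); [apply dcurve_const|exact H]|ring].
Qed.

Lemma dcurve_minus (F G : R -> C) (t : R) (l m : C) :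
  dcurve F t l -> dcurve G t m -> dcurve (fun s => F s - G s)%C t (l - m).
Proof.
  intros [p [Hp [El EF]]] [q [Hq [Em EG]]]. exists (fun s => p s - q s)%C.
  split; [now apply contC_minus|]. split; [now rewrite El, Em|].
  intros s. rewrite (EF s), (EG s). ring.
Qed.

Lemma dcurve_id (t : R) : dcurve RtoC t 1.
Proof. apply (dcurve_RtoC (fun s => s)). apply (is_derive_id (K := R_AbsRing)). Qed.

Lemma dcurve_linear (c : C) (t : R) : dcurve (fun s => RtoC s * c)%C t c.
Proof.
  eapply dcurve_eq; [apply (dcurve_mult RtoC (fun _ => c)); [apply dcurve_id|apply dcurve_const]|].
  cbv beta; ring.
Qed.

Lemma dcurve_inv (F : R -> C) (t : R) (l : C) : F t <> RtoC 0 ->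
  dcurve F t l -> dcurve (fun s => / F s)%C t (- l / (F t * F t)).
Proof.
  intros H0 HF. pose proof (dcurve_cont _ _ _ HF) as CF. destruct HF as [p [Hp [El EF]]].
  set (g := fun s => (/ F t + (- p s / (F s * F t)) * RtoC (s - t))%C).
  apply dcurve_is_derive. apply (is_derive_ext_loc g).
  - pose proof (contC_Cmod _ _ CF) as Cm.
    assert (Hpos : 0 < Cmod (F t)) by (now apply Cmod_gt_0).
    generalize (proj1 (contR_eps _ _) Cm _ Hpos). apply filter_imp. intros s Hs.
    assert (Hs0 : F s <> RtoC 0).
    { intros E0. rewrite E0, Cmod_0 in Hs. unfold Rminus in Hs.
      rewrite Rplus_0_l, Rabs_Ropp, Rabs_pos_eq in Hs; lra. }
    change (@eq C (g s) (/ F s)%C). unfold g.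
    replace (- p s / (F s * F t) * RtoC (s - t))%C with (- (p s * RtoC (s - t)) / (F s * F t))%C
      by (field; split; assumption).
    replace (p s * RtoC (s - t))%C with (F s - F t)%C by (rewrite (EF s); ring).
    field. split; assumption.
  - apply dcurve_is_derive. exists (fun s => - p s / (F s * F t))%C. split; [|split].
    + apply contC_div; [now apply contC_opp| |].
      * apply contC_mult; [exact CF|apply contC_const].
      * now apply Cmult_neq_0.
    + now rewrite El.
    + intros s. unfold g. replace (t - t) with 0 by ring. ring.
Qed.

(** * Integrals depending continuously on a parameter *)

Lemma tube {U : UniformSpace} (H : R * U -> C) (a b : R) (u0 : U) :
  (forall t, a <= t <= b -> contC H (t, u0)) ->
  forall e, 0 < e -> locally u0 (fun u => forall t, a <= t <= b -> Cmod (H (t, u) - H (t, u0)) < e).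
Proof.
  intros HH e He.
  assert (He2 : 0 < e / 2) by lra.
  assert (Hd : forall t, exists d : posreal, a <= t <= b ->
     forall s u, ball t d s -> ball u0 d u -> Cmod (H (s, u) - H (t, u0)) < e / 2).
  { intros t. destruct (classic (a <= t <= b)) as [Ht|Ht].
    - destruct (proj1 (contC_eps H (t, u0)) (HH t Ht) _ He2) as [d Hd].
      exists d. intros _ s u Hs Hu. apply Hd. split; assumption.
    - exists (mkposreal 1 Rlt_0_1). tauto. }
  set (delta := fun t => proj1_sig (constructive_indefinite_description _ (Hd t))).
  assert (Hdelta : forall t, a <= t <= b -> forall s u, ball t (delta t) s -> ball u0 (delta t) u ->
    Cmod (H (s, u) - H (t, u0)) < e / 2).
  { intros t. unfold delta. destruct constructive_indefinite_description as [d Hd']. exact Hd'. }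
  destruct (compactness_value_1d a b delta) as [d Hc].
  exists d. intros u Hu s Hs.
  (* Compactness gives, under a double negation, a centre [t] whose gauge contains [s] and is at
     least [d]; thus one [d] serves every [s]. *)
  destruct (NNPP _ (Hc s Hs)) as [t [Ht [Hst Hdt]]].
  assert (H1 : Cmod (H (s, u) - H (t, u0)) < e / 2).
  { apply (Hdelta t Ht); [exact Hst|]. eapply ball_le; [exact Hdt|exact Hu]. }
  assert (H2 : Cmod (H (s, u0) - H (t, u0)) < e / 2).
  { apply (Hdelta t Ht); [exact Hst|]. apply ball_center. }
  eapply Rle_lt_trans; [apply (Cmod_triangle_sub _ (H (t, u0)))|].
  rewrite (Cmod_sub_comm (H (t, u0))). lra.
Qed.

Lemma cont_slice_l {U : UniformSpace} (H : R * U -> C) (t : R) (u : U) :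
  contC H (t, u) -> contC (fun s => H (s, u)) t.
Proof.
  intros HH. apply (continuous_comp (V := prod_UniformSpace R_UniformSpace U) (W := C_UniformSpace) (fun s => (s, u)) H).
  - intros P [d HP]. exists d. intros s Hs. apply HP. split; [exact Hs|apply ball_center].
  - exact HH.
Qed.

Lemma cont_slice_r {U : UniformSpace} (H : R * U -> C) (t : R) (u : U) :
  contC H (t, u) -> contC (fun v => H (t, v)) u.
Proof.
  intros HH. apply (continuous_comp (V := prod_UniformSpace R_UniformSpace U) (W := C_UniformSpace) (fun s => (t, s)) H).
  - intros P [d HP]. exists d. intros s Hs. apply HP. split; [apply ball_center|exact Hs].
  - exact HH.
Qed.

Lemma contC_CI_param {U : UniformSpace} (H : R * U -> C) (a b : R) (u0 : U) : a <= b ->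
  (forall t u, a <= t <= b -> contC H (t, u)) -> contC (fun u => CI (fun t => H (t, u)) a b) u0.
Proof.
  intros Hab HH. apply contC_eps. intros e He.
  set (e' := e / (2 * (b - a + 1))).
  assert (He' : 0 < e') by (apply Rdiv_lt_0_compat; lra).
  generalize (tube H a b u0 (fun t => HH t u0) e' He'). apply filter_imp. intros u Hu.
  assert (Hc : forall v, cont_on (fun t => H (t, v)) a b).
  { intros v t. rewrite Rmin_left, Rmax_right by assumption. intros Ht. apply cont_slice_l. auto. }
  rewrite <- CI_minus by auto.
  eapply Rle_lt_trans; [apply (CI_bound _ _ _ e' Hab)|].
  - intros t Ht. apply contC_minus; now apply Hc.
  - intros t Ht. left. now apply Hu.
  - unfold e'. apply (Rmult_lt_reg_r (2 * (b - a + 1))); [lra|].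
    field_simplify; [|lra]. nra.
Qed.

(** * Fubini's theorem and Goursat's bisection *)

Lemma contC_CI_param_any {U : UniformSpace} (H : R * U -> C) (a b : R) (u0 : U) :
  (forall p, contC H p) -> contC (fun u => CI (fun t => H (t, u)) a b) u0.
Proof.
  intros HH. destruct (Rle_dec a b) as [Hab|Hab].
  - apply contC_CI_param; auto.
  - apply (continuous_ext (fun u => (- CI (fun t => H (t, u)) b a)%C)).
    + intros u. symmetry. apply CI_swap. intros t _. now apply cont_slice_l.
    + apply contC_opp. apply contC_CI_param; [lra|auto].
Qed.

Lemma contC_swap (f : R * R -> C) (x y : R) :
  contC f (x, y) -> contC (fun p : R * R => f (snd p, fst p)) (y, x).
Proof.
  intros H. apply (continuous_comp_2 (W := R_UniformSpace) (X := C_UniformSpace)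
    (fun p : R * R => snd p) (fun p : R * R => fst p) (fun a b => f (a, b))).
  - apply continuous_snd.
  - apply continuous_fst.
  - apply (continuous_ext f); [now intros []|exact H].
Qed.

(** The error of the increment is an integral of [f (x, y) - f (t, y)] over [x] between [t] and [s],
    small uniformly in [y] by [tube]. *)
Lemma dcurve_CI_param (f : R * R -> C) (a c d t : R) : c <= d -> (forall p, contC f p) ->
  dcurve (fun t => CI (fun y => CI (fun x => f (x, y)) a t) c d) t (CI (fun y => f (t, y)) c d).
Proof.
  intros Hcd Hf.
  assert (Hx : forall y u v, cont_on (fun x => f (x, y)) u v)
    by (intros y u v x _; now apply cont_slice_l).
  assert (Hy : forall x u v, cont_on (fun y => f (x, y)) u v)
    by (intros x u v y _; now apply cont_slice_r).
  assert (HI : forall u v w z, cont_on (fun y => CI (fun x => f (x, y)) u v) w z)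
    by (intros u v w z y _; now apply contC_CI_param_any).
  apply dcurve_eps. intros e He.
  set (e' := e / (d - c + 1)).
  assert (He' : 0 < e') by (apply Rdiv_lt_0_compat; lra).
  destruct (tube (fun p : R * R => f (snd p, fst p)) c d t) with (e := e') as [dl Hdl]; [|exact He'|].
  { intros y _. now apply contC_swap. }
  exists dl. split; [apply cond_pos|]. intros s Hs.
  assert (E : (CI (fun y => CI (fun x => f (x, y)) a s) c d - CI (fun y => CI (fun x => f (x, y)) a t) c d
      - RtoC (s - t) * CI (fun y => f (t, y)) c d)%C
      = CI (fun y => (CI (fun x => (f (x, y) - f (t, y))%C) t s)) c d).
  { rewrite <- CI_mult_l by auto. rewrite <- CI_minus by auto.
    rewrite <- CI_minus.
    - apply CI_ext. intros y _. rewrite (CI_minus (fun x => f (x, y)) (fun _ => f (t, y))); [|auto|intros ? _; apply contC_const].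
      rewrite CI_const. rewrite (CI_Chasles (fun x => f (x, y)) a t s) by auto. ring.
    - intros y Hyy. apply contC_minus; now apply (HI _ _ c d).
    - intros y Hyy. apply contC_mult; [apply contC_const|now apply (Hy _ c d)]. }
  rewrite E. clear E.
  eapply Rle_trans; [apply (CI_bound _ c d (Rabs (s - t) * e') Hcd)|].
  - intros y _. apply (contC_CI_param_any (fun p : R * R => (f (fst p, snd p) - f (t, snd p))%C)).
    intros [x y']. apply contC_minus.
    + apply (continuous_ext f); [now intros []|apply Hf].
    + apply (continuous_comp (V := prod_UniformSpace R_UniformSpace R_UniformSpace) (W := C_UniformSpace)
        (fun p : R * R => (t, snd p)) f); [|apply Hf].
      apply (continuous_comp_2 (V := R_UniformSpace) (W := R_UniformSpace) (fun _ : R * R => t) (fun p : R * R => snd p) (fun a b => (a, b))).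
      * apply continuous_const.
      * apply continuous_snd.
      * apply (continuous_ext (fun p => p)); [now intros []|apply continuous_id].
  - intros y Hyy. apply CI_bound_abs.
    + intros x _. apply contC_minus; [now apply cont_slice_l|apply contC_const].
    + intros x Hx'. left. apply (Hdl x); [|exact Hyy].
      change (Rabs (x - t) < dl). eapply Rle_lt_trans; [|exact Hs].
      unfold Rmin, Rmax in Hx'. unfold Rabs. destruct Rle_dec; repeat destruct Rcase_abs; lra.
  - unfold e'. pose proof (Rabs_pos (s - t)).
    apply (Rmult_le_reg_r (d - c + 1)); [lra|]. field_simplify; [|lra]. nra.
Qed.

Lemma Fubini_global (f : R * R -> C) (a b c d : R) : c <= d -> (forall p, contC f p) ->
  CI (fun x => CI (fun y => f (x, y)) c d) a b = CI (fun y => CI (fun x => f (x, y)) a b) c d.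
Proof.
  intros Hcd Hf.
  (* As functions of the upper limit [b], both sides vanish at [a] and have the same derivative. *)
  rewrite (CI_derive (fun t => CI (fun y => CI (fun x => f (x, y)) a t) c d)).
  - replace (CI (fun y => CI (fun x => f (x, y)) a a) c d) with (RtoC 0); [ring|].
    rewrite (CI_ext _ (fun _ => RtoC 0)); [rewrite CI_const; ring|]. intros; apply CI_point.
  - intros t _. now apply dcurve_CI_param.
  - intros t _. apply (contC_CI_param_any (fun p : R * R => f (snd p, fst p))).
    intros [x y]. now apply contC_swap.
Qed.

Definition clamp (a b t : R) : R := Rmax a (Rmin b t).

Lemma clamp_in (a b t : R) : a <= b -> a <= clamp a b t <= b.
Proof. intros. unfold clamp, Rmax, Rmin. repeat destruct Rle_dec; lra. Qed.

Lemma clamp_id (a b t : R) : a <= t <= b -> clamp a b t = t.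
Proof. intros. unfold clamp, Rmax, Rmin. repeat destruct Rle_dec; lra. Qed.

Lemma cont_clamp {U : UniformSpace} (a b : R) (f : U -> R) (x : U) :
  continuous f x -> continuous (fun u => clamp a b (f u)) x.
Proof.
  intros H. apply contR_max; [apply continuous_const|]. apply contR_min; [apply continuous_const|exact H].
Qed.

Lemma Fubini (f : R -> R -> C) (a b c d : R) : a <= b -> c <= d ->
  (forall x y, a <= x <= b -> c <= y <= d -> contC (fun p : R * R => f (fst p) (snd p)) (x, y)) ->
  CI (fun x => CI (fun y => f x y) c d) a b = CI (fun y => CI (fun x => f x y) a b) c d.
Proof.
  intros Hab Hcd Hf.
  (* Clamping both variables extends [f] continuously from the rectangle to the plane. *)
  set (g := fun p : R * R => f (clamp a b (fst p)) (clamp c d (snd p))).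
  transitivity (CI (fun x => CI (fun y => g (x, y)) c d) a b); [|transitivity (CI (fun y => CI (fun x => g (x, y)) a b) c d)].
  - apply CI_ext_le; [assumption|]. intros x Hx.
    apply CI_ext_le; [assumption|]. intros y Hy.
    unfold g; simpl. now rewrite !clamp_id.
  - apply Fubini_global; [exact Hcd|]. intros [x y].
    apply (continuous_comp_2 (V := R_UniformSpace) (W := R_UniformSpace) (X := C_UniformSpace)
      (fun p : R * R => clamp a b (fst p)) (fun p : R * R => clamp c d (snd p)) f).
    + apply cont_clamp, continuous_fst.
    + apply cont_clamp, continuous_snd.
    + apply Hf; now apply clamp_in.
  - apply CI_ext_le; [assumption|]. intros y Hy.
    apply CI_ext_le; [assumption|]. intros x Hx.
    unfold g; simpl. now rewrite !clamp_id.
Qed.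

(* Boundary integral of the form [psi dx + phi dy]. *)
Definition FI (psi phi : R -> R -> C) (a b c d : R) : C :=
  (CI (fun x => psi x c) a b + CI (fun y => phi b y) c d
   - CI (fun x => psi x d) a b - CI (fun y => phi a y) c d)%C.

(** Each coefficient is continuous along its own direction of integration; this is all that the
    sides of subrectangles use. *)
Definition form_cont (psi phi : R -> R -> C) (a b c d : R) : Prop :=
  forall x y, a <= x <= b -> c <= y <= d ->
    contC (fun s => psi s y) x /\ contC (fun s => phi x s) y.

Lemma form_cont_sub (psi phi : R -> R -> C) (a b c d a' b' c' d' : R) :
  form_cont psi phi a b c d -> a <= a' -> b' <= b -> c <= c' -> d' <= d ->
  form_cont psi phi a' b' c' d'.
Proof. intros H ? ? ? ? x y Hx Hy. apply H; lra. Qed.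

Lemma form_cont_psi (psi phi : R -> R -> C) (a b c d u v y : R) :
  form_cont psi phi a b c d -> a <= u <= b -> a <= v <= b -> c <= y <= d ->
  cont_on (fun x => psi x y) u v.
Proof.
  intros H Hu Hv Hy t Ht. refine (proj1 (H t y _ Hy)).
  unfold Rmin, Rmax in Ht. destruct Rle_dec; lra.
Qed.

Lemma form_cont_phi (psi phi : R -> R -> C) (a b c d u v x : R) :
  form_cont psi phi a b c d -> c <= u <= d -> c <= v <= d -> a <= x <= b ->
  cont_on (fun y => phi x y) u v.
Proof.
  intros H Hu Hv Hx t Ht. refine (proj2 (H x t Hx _)).
  unfold Rmin, Rmax in Ht. destruct Rle_dec; lra.
Qed.

Lemma FI_bound (psi phi : R -> R -> C) (a b c d M : R) : a <= b -> c <= d ->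
  form_cont psi phi a b c d ->
  (forall x y, a <= x <= b -> c <= y <= d -> Cmod (psi x y) <= M /\ Cmod (phi x y) <= M) ->
  Cmod (FI psi phi a b c d) <= 2 * ((b - a) + (d - c)) * M.
Proof.
  intros Hab Hcd Hc HM.
  assert (H1 : forall y, c <= y <= d -> Cmod (CI (fun x => psi x y) a b) <= (b - a) * M).
  { intros y Hy. apply CI_bound; [lra| |].
    - apply (form_cont_psi psi phi a b c d); auto; lra.
    - intros t Ht. now apply (HM t y). }
  assert (H2 : forall x, a <= x <= b -> Cmod (CI (fun y => phi x y) c d) <= (d - c) * M).
  { intros x Hx. apply CI_bound; [lra| |].
    - apply (form_cont_phi psi phi a b c d); auto; lra.
    - intros t Ht. now apply (HM x t). }
  unfold FI, Cminus.
  eapply Rle_trans; [apply Cmod_triangle|]. rewrite Cmod_opp.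
  eapply Rle_trans; [apply Rplus_le_compat_r, Cmod_triangle|]. rewrite Cmod_opp.
  eapply Rle_trans; [apply Rplus_le_compat_r, Rplus_le_compat_r, Cmod_triangle|].
  pose proof (H1 c). pose proof (H1 d). pose proof (H2 a). pose proof (H2 b). lra.
Qed.

Lemma FI_split (psi phi : R -> R -> C) (a m b c n d : R) :
  a <= m <= b -> c <= n <= d -> form_cont psi phi a b c d ->
  FI psi phi a b c d = (FI psi phi a m c n + FI psi phi m b c n
                        + FI psi phi a m n d + FI psi phi m b n d)%C.
Proof.
  intros Hm Hn Hc. unfold FI.
  assert (Hx : forall u v y, a <= u <= b -> a <= v <= b -> c <= y <= d -> cont_on (fun x => psi x y) u v)
    by (intros; now apply (form_cont_psi psi phi a b c d)).
  assert (Hy : forall u v x, c <= u <= d -> c <= v <= d -> a <= x <= b -> cont_on (fun y => phi x y) u v)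
    by (intros; now apply (form_cont_phi psi phi a b c d)).
  rewrite (CI_Chasles (fun x => psi x c) a m b), (CI_Chasles (fun x => psi x d) a m b) by (apply Hx; lra).
  rewrite (CI_Chasles (fun y => phi b y) c n d), (CI_Chasles (fun y => phi a y) c n d) by (apply Hy; lra).
  ring.
Qed.

Lemma FI_minus (psi phi psi' phi' : R -> R -> C) (a b c d : R) : a <= b -> c <= d ->
  form_cont psi phi a b c d -> form_cont psi' phi' a b c d ->
  FI (fun x y => psi x y - psi' x y)%C (fun x y => phi x y - phi' x y)%C a b c d
  = (FI psi phi a b c d - FI psi' phi' a b c d)%C.
Proof.
  intros Hab Hcd H H'. unfold FI.
  assert (Hx : forall f g y, form_cont f g a b c d -> c <= y <= d -> cont_on (fun x => f x y) a b)
    by (intros f g y Hf Hy; apply (form_cont_psi f g a b c d); auto; lra).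
  assert (Hy : forall f g x, form_cont f g a b c d -> a <= x <= b -> cont_on (fun y => g x y) c d)
    by (intros f g x Hf Hx'; apply (form_cont_phi f g a b c d); auto; lra).
  rewrite (CI_minus (fun x => psi x c) (fun x => psi' x c)), (CI_minus (fun x => psi x d) (fun x => psi' x d))
    by (eapply Hx; [eassumption|lra]).
  rewrite (CI_minus (fun y => phi b y) (fun y => phi' b y)), (CI_minus (fun y => phi a y) (fun y => phi' a y))
    by (eapply Hy; [eassumption|lra]).
  ring.
Qed.

Lemma FI_ext (psi phi psi' phi' : R -> R -> C) (a b c d : R) : a <= b -> c <= d ->
  (forall x y, a <= x <= b -> c <= y <= d -> psi x y = psi' x y /\ phi x y = phi' x y) ->
  FI psi phi a b c d = FI psi' phi' a b c d.
Proof.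
  intros Hab Hcd H. unfold FI.
  assert (H1 : forall y, c <= y <= d -> CI (fun x => psi x y) a b = CI (fun x => psi' x y) a b).
  { intros y Hy. apply CI_ext. intros x. rewrite Rmin_left, Rmax_right by assumption. intros. now apply H. }
  assert (H2 : forall x, a <= x <= b -> CI (fun y => phi x y) c d = CI (fun y => phi' x y) c d).
  { intros x Hx. apply CI_ext. intros y. rewrite Rmin_left, Rmax_right by assumption. intros. now apply H. }
  rewrite (H1 c), (H1 d), (H2 a), (H2 b) by lra. reflexivity.
Qed.

Lemma quarter_step (psi phi : R -> R -> C) (a b c d : R) : a <= b -> c <= d ->
  form_cont psi phi a b c d ->
  exists a' b' c' d', a <= a' <= b' /\ b' <= b /\ c <= c' <= d' /\ d' <= d /\
    b' - a' = (b - a) / 2 /\ d' - c' = (d - c) / 2 /\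
    Cmod (FI psi phi a b c d) / 4 <= Cmod (FI psi phi a' b' c' d').
Proof.
  intros Hab Hcd Hc.
  set (m := (a + b) / 2). set (n := (c + d) / 2).
  assert (E := FI_split psi phi a m b c n d ltac:(unfold m; lra) ltac:(unfold n; lra) Hc).
  set (K := Cmod (FI psi phi a b c d)) in *.
  assert (HK : K <= Cmod (FI psi phi a m c n) + Cmod (FI psi phi m b c n)
                    + Cmod (FI psi phi a m n d) + Cmod (FI psi phi m b n d)).
  { unfold K. rewrite E.
    eapply Rle_trans; [apply Cmod_triangle|]. apply Rplus_le_compat_r.
    eapply Rle_trans; [apply Cmod_triangle|]. apply Rplus_le_compat_r. apply Cmod_triangle. }
  destruct (Rle_dec (K / 4) (Cmod (FI psi phi a m c n))).
  { exists a, m, c, n. unfold m, n in *. repeat split; try lra; assumption. }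
  destruct (Rle_dec (K / 4) (Cmod (FI psi phi m b c n))).
  { exists m, b, c, n. unfold m, n in *. repeat split; try lra; assumption. }
  destruct (Rle_dec (K / 4) (Cmod (FI psi phi a m n d))).
  { exists a, m, n, d. unfold m, n in *. repeat split; try lra; assumption. }
  exists m, b, n, d. unfold m, n in *. repeat split; try lra.
Qed.

Lemma nested_point (a b : nat -> R) :
  (forall n, a n <= a (S n) /\ b (S n) <= b n /\ a n <= b n) ->
  exists x, forall n, a n <= x <= b n.
Proof.
  intros H.
  assert (Ha : forall n k, a n <= a (n + k)%nat).
  { intros n k. induction k as [|k IH]; [rewrite Nat.add_0_r; lra|].
    rewrite Nat.add_succ_r. destruct (H (n + k)%nat). lra. }
  assert (Hb : forall n k, b (n + k)%nat <= b n).
  { intros n k. induction k as [|k IH]; [rewrite Nat.add_0_r; lra|].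
    rewrite Nat.add_succ_r. destruct (H (n + k)%nat). lra. }
  assert (Hab : forall n k, a n <= b k).
  { intros n k. specialize (Ha n k). specialize (Hb k n). rewrite (Nat.add_comm k n) in Hb.
    destruct (H (n + k)%nat). lra. }
  destruct (completeness (fun x => exists n, x = a n)) as [x [Hx1 Hx2]].
  - exists (b 0%nat). intros y [n ->]. apply Hab.
  - exists (a 0%nat). now exists 0%nat.
  - exists x. intros n. split.
    + apply Hx1. now exists n.
    + apply Hx2. intros y [k ->]. apply Hab.
Qed.

(** Goursat's argument separated from holomorphy: quartering keeps at least a quarter of the
    integral while the sides halve, so a local bound quadratic in the size, with arbitrarily small
    constant, forces [0]. It serves Cauchy's theorem for pulled-back forms and also functions for
    which only such a local estimate is known. *)
Lemma bisection (psi phi : R -> R -> C) (a b c d : R) : a <= b -> c <= d ->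
  form_cont psi phi a b c d ->
  (forall x0 y0, a <= x0 <= b -> c <= y0 <= d -> forall e, 0 < e -> exists eta, 0 < eta /\
    forall a' b' c' d', a <= a' <= x0 -> x0 <= b' <= b -> c <= c' <= y0 -> y0 <= d' <= d ->
      (b' - a') + (d' - c') < eta ->
      Cmod (FI psi phi a' b' c' d') <= e * ((b' - a') + (d' - c')) ^ 2) ->
  FI psi phi a b c d = RtoC 0.
Proof.
  intros Hab Hcd Hc Hloc. apply Cmod_eq_0.
  set (K := Cmod (FI psi phi a b c d)).
  destruct (Rle_lt_dec K 0) as [|HK]; [pose proof (Cmod_ge_0 (FI psi phi a b c d)); unfold K in *; lra|exfalso].
  set (ok := fun q : (R * R) * (R * R) => a <= fst (fst q) <= snd (fst q) /\ snd (fst q) <= b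
     /\ c <= fst (snd q) <= snd (snd q) /\ snd (snd q) <= d).
  set (I := fun q : (R * R) * (R * R) => Cmod (FI psi phi (fst (fst q)) (snd (fst q)) (fst (snd q)) (snd (snd q)))).
  (* The requirement is conditional on [ok q], so that choice yields a total function that can be
     iterated. *)
  assert (Hstep : forall q, exists q', ok q -> ok q' /\
     fst (fst q) <= fst (fst q') /\ snd (fst q') <= snd (fst q) /\
     fst (snd q) <= fst (snd q') /\ snd (snd q') <= snd (snd q) /\
     snd (fst q') - fst (fst q') = (snd (fst q) - fst (fst q)) / 2 /\
     snd (snd q') - fst (snd q') = (snd (snd q) - fst (snd q)) / 2 /\ I q / 4 <= I q').
  { intros q. destruct (classic (ok q)) as [Hq|Hq]; [|now exists q].
    destruct q as [[a1 b1] [c1 d1]]. unfold ok in *; simpl in *.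
    destruct (quarter_step psi phi a1 b1 c1 d1) as (a' & b' & c' & d' & Hs); try lra.
    { eapply form_cont_sub; [exact Hc|..]; lra. }
    exists ((a', b'), (c', d')). unfold I; simpl. intros _.
    repeat split; try lra; tauto. }
  set (step := fun q => proj1_sig (constructive_indefinite_description _ (Hstep q))).
  assert (Hst : forall q, ok q -> ok (step q) /\
     fst (fst q) <= fst (fst (step q)) /\ snd (fst (step q)) <= snd (fst q) /\
     fst (snd q) <= fst (snd (step q)) /\ snd (snd (step q)) <= snd (snd q) /\
     snd (fst (step q)) - fst (fst (step q)) = (snd (fst q) - fst (fst q)) / 2 /\
     snd (snd (step q)) - fst (snd (step q)) = (snd (snd q) - fst (snd q)) / 2 /\ I q / 4 <= I (step q)).
  { intros q. unfold step. destruct constructive_indefinite_description; assumption. }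
  set (s := fun n => Nat.iter n step ((a, b), (c, d))).
  assert (Hok : forall n, ok (s n)).
  { induction n as [|n IH]; [unfold ok; simpl; lra|]. apply (Hst _ IH). }
  assert (Hsn : forall n, s (S n) = step (s n)) by reflexivity.
  assert (Hsize : forall n, snd (fst (s n)) - fst (fst (s n)) = (b - a) / 2 ^ n /\
     snd (snd (s n)) - fst (snd (s n)) = (d - c) / 2 ^ n /\ K / (2 ^ n * 2 ^ n) <= I (s n)).
  { induction n as [|n IH].
    - simpl. unfold I, K; simpl. repeat split; try field. lra.
    - assert (H2 : 0 < 2 ^ n) by (apply pow_lt; lra).
      rewrite Hsn. destruct (Hst _ (Hok n)) as (_ & _ & _ & _ & _ & E1 & E2 & E3).
      destruct IH as (I1 & I2 & I3). rewrite E1, E2, I1, I2. simpl. repeat split; try (field; lra).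
      eapply Rle_trans; [|exact E3]. apply Rle_trans with (K / (2 ^ n * 2 ^ n) / 4); [right; field; lra|lra]. }
  destruct (nested_point (fun n => fst (fst (s n))) (fun n => snd (fst (s n)))) as [x0 Hx0].
  { intros n. rewrite Hsn. destruct (Hst _ (Hok n)) as (_ & ? & ? & _).
    pose proof (Hok n) as Ho. unfold ok in Ho. lra. }
  destruct (nested_point (fun n => fst (snd (s n))) (fun n => snd (snd (s n)))) as [y0 Hy0].
  { intros n. rewrite Hsn. destruct (Hst _ (Hok n)) as (_ & _ & _ & ? & ? & _).
    pose proof (Hok n) as Ho. unfold ok in Ho. lra. }
  set (P := (b - a) + (d - c)).
  assert (HP : 0 <= P) by (unfold P; lra).
  (* After cancelling [4^n] the local bound would read [K <= e * P^2 <= K / 2]; the summand [1]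
     covers [P = 0]. *)
  set (e := K / (2 * (P ^ 2 + 1))).
  assert (He : 0 < e) by (apply Rdiv_lt_0_compat; nra).
  destruct (Hloc x0 y0) with (e := e) as [eta [Heta Hl]]; [apply (Hx0 0%nat)|apply (Hy0 0%nat)|exact He|].
  assert (Hn : exists n, P / 2 ^ n < eta).
  { destruct (Pow_x_infinity 2) with (b := P / eta + 1) as [n Hn].
    - rewrite Rabs_pos_eq; lra.
    - exists n. specialize (Hn n (Nat.le_refl n)).
      assert (H2 : 0 < 2 ^ n) by (apply pow_lt; lra).
      rewrite Rabs_pos_eq in Hn by lra.
      apply (Rmult_lt_reg_r (2 ^ n)); [exact H2|].
      replace (P / 2 ^ n * 2 ^ n) with (P / eta * eta) by (field; lra).
      rewrite (Rmult_comm eta). apply Rmult_lt_compat_r; lra. }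
  destruct Hn as [n Hn].
  destruct (Hsize n) as (S1 & S2 & S3).
  pose proof (Hok n) as Ho. unfold ok in Ho. specialize (Hx0 n). specialize (Hy0 n). simpl in Hx0, Hy0.
  specialize (Hl (fst (fst (s n))) (snd (fst (s n))) (fst (snd (s n))) (snd (snd (s n)))).
  fold (I (s n)) in Hl. rewrite S1, S2 in Hl.
  assert (H2 : 0 < 2 ^ n) by (apply pow_lt; lra).
  replace ((b - a) / 2 ^ n + (d - c) / 2 ^ n) with (P / 2 ^ n) in Hl by (unfold P; field; lra).
  specialize (Hl ltac:(lra) ltac:(lra) ltac:(lra) ltac:(lra) Hn).
  assert (H3 : K / (2 ^ n * 2 ^ n) <= e * (P / 2 ^ n) ^ 2) by lra.
  replace (e * (P / 2 ^ n) ^ 2) with (e * P ^ 2 / (2 ^ n * 2 ^ n)) in H3 by (field; lra).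
  apply Rmult_le_reg_r in H3; [|apply Rinv_0_lt_compat; nra].
  unfold e in H3. assert (Hpp : 0 <= P ^ 2) by (apply pow2_ge_0).
  replace (K / (2 * (P ^ 2 + 1)) * P ^ 2) with (K * (P ^ 2 / (2 * (P ^ 2 + 1)))) in H3 by (field; lra).
  assert (P ^ 2 / (2 * (P ^ 2 + 1)) <= 1 / 2).
  { apply (Rmult_le_reg_r (2 * (P ^ 2 + 1))); [lra|]. field_simplify; lra. }
  nra.
Qed.

(** * Cauchy's formula *)

Section Goursat.
Variables (h : C -> C) (H Hx Hy : R -> R -> C) (a b c d L : R).
Hypothesis Hab : a <= b.
Hypothesis Hcd : c <= d.
Hypothesis HHx : forall x y, a <= x <= b -> c <= y <= d -> dcurve (fun s => H s y) x (Hx x y).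
Hypothesis HHy : forall x y, a <= x <= b -> c <= y <= d -> dcurve (fun s => H x s) y (Hy x y).
Hypothesis HC : form_cont Hx Hy a b c d.
Hypothesis HL : forall x y, a <= x <= b -> c <= y <= d -> Cmod (Hx x y) <= L /\ Cmod (Hy x y) <= L.
Hypothesis Hh : forall x y, a <= x <= b -> c <= y <= d -> hol h (H x y).

Lemma pullback_lipschitz (x y x0 y0 : R) :
  a <= x <= b -> a <= x0 <= b -> c <= y <= d -> c <= y0 <= d ->
  Cmod (H x y - H x0 y0) <= L * (Rabs (x - x0) + Rabs (y - y0)).
Proof.
  intros Xx Xx0 Yy Yy0.
  eapply Rle_trans; [apply (Cmod_triangle_sub _ (H x0 y))|].
  rewrite Rmult_plus_distr_l. apply Rplus_le_compat.
  - rewrite <- (CI_derive (fun s => H s y) (fun s => Hx s y) x0 x).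
    + rewrite Rmult_comm. apply CI_bound_abs.
      * apply (form_cont_psi Hx Hy a b c d); auto.
      * intros t Ht. apply HL; [|auto]. unfold Rmin, Rmax in Ht. destruct Rle_dec; lra.
    + intros t Ht. apply HHx; [|auto]. unfold Rmin, Rmax in Ht. destruct Rle_dec; lra.
    + apply (form_cont_psi Hx Hy a b c d); auto.
  - rewrite <- (CI_derive (fun s => H x0 s) (fun s => Hy x0 s) y0 y).
    + rewrite Rmult_comm. apply CI_bound_abs.
      * apply (form_cont_phi Hx Hy a b c d); auto.
      * intros t Ht. apply HL; [auto|]. unfold Rmin, Rmax in Ht. destruct Rle_dec; lra.
    + intros t Ht. apply HHy; [auto|]. unfold Rmin, Rmax in Ht. destruct Rle_dec; lra.
    + apply (form_cont_phi Hx Hy a b c d); auto.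
Qed.

Lemma pullback_form_cont (g : C -> C) :
  (forall x y, a <= x <= b -> c <= y <= d -> contCC g (H x y)) ->
  form_cont (fun x y => g (H x y) * Hx x y)%C (fun x y => g (H x y) * Hy x y)%C a b c d.
Proof.
  intros Hg x y Xx Yy. destruct (HC x y Xx Yy) as [HCx HCy].
  split; (apply contC_mult; [|assumption]).
  - apply (contC_comp g (fun s => H s y)); [|now apply Hg]. eapply dcurve_cont. now apply HHx.
  - apply (contC_comp g (fun s => H x s)); [|now apply Hg]. eapply dcurve_cont. now apply HHy.
Qed.

Lemma pullback_affine (A B : C) (a' b' c' d' : R) :
  a <= a' -> a' <= b' -> b' <= b -> c <= c' -> c' <= d' -> d' <= d ->
  FI (fun x y => (A + B * H x y) * Hx x y)%C (fun x y => (A + B * H x y) * Hy x y)%C a' b' c' d' = RtoC 0.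
Proof.
  intros H1 H2 H3 H4 H5 H6.
  (* The primitive [A w + B w^2/2] of [A + B w], evaluated along [H]; the four sides then
     telescope. *)
  set (T := fun x y => (A * H x y + (B / (1 + 1)) * (H x y * H x y))%C).
  assert (Hc : form_cont (fun x y => (A + B * H x y) * Hx x y)%C (fun x y => (A + B * H x y) * Hy x y)%C a b c d).
  { apply (pullback_form_cont (fun w => A + B * w)%C). intros.
    apply contC_plus; [apply contC_const|]. apply contC_mult; [apply contC_const|apply contC_id]. }
  assert (E2 : (1 + 1)%C <> RtoC 0) by (rewrite <- RtoC_plus; intros E; apply RtoC_inj in E; lra).
  assert (Tx : forall y, c <= y <= d -> CI (fun x => (A + B * H x y) * Hx x y)%C a' b' = (T b' y - T a' y)%C).
  { intros y Yy. apply (CI_derive (fun x => T x y)).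
    - intros t. rewrite Rmin_left, Rmax_right by assumption. intros Ht. unfold T.
      eapply dcurve_eq; [apply dcurve_plus; apply dcurve_scal; [|apply dcurve_mult]; apply HHx; lra|].
      cbv beta; field; exact E2.
    - apply (form_cont_psi _ _ a b c d _ _ _ Hc); lra. }
  assert (Ty : forall x, a <= x <= b -> CI (fun y => (A + B * H x y) * Hy x y)%C c' d' = (T x d' - T x c')%C).
  { intros x Xx. apply (CI_derive (fun y => T x y)).
    - intros t. rewrite Rmin_left, Rmax_right by assumption. intros Ht. unfold T.
      eapply dcurve_eq; [apply dcurve_plus; apply dcurve_scal; [|apply dcurve_mult]; apply HHy; lra|].
      cbv beta; field; exact E2.
    - apply (form_cont_phi _ _ a b c d _ _ _ Hc); lra. }
  unfold FI. rewrite (Tx c'), (Tx d'), (Ty a'), (Ty b') by lra. ring.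
Qed.

(** Near [H x0 y0] the function [h] is affine up to an error small compared with the distance. The
    affine part is exact, and the error times the perimeter is small compared with the squared size,
    as [bisection] demands. A parametrization [H] is allowed so that families of circles, swept out
    in polar form, are covered. *)
Lemma Goursat : FI (fun x y => h (H x y) * Hx x y)%C (fun x y => h (H x y) * Hy x y)%C a b c d = RtoC 0.
Proof.
  assert (Hc : form_cont (fun x y => h (H x y) * Hx x y)%C (fun x y => h (H x y) * Hy x y)%C a b c d).
  { apply pullback_form_cont. intros. apply hol_cont. now apply Hh. }
  assert (L0 : 0 <= L).
  { eapply Rle_trans; [apply Cmod_ge_0|apply (HL a c); lra]. }
  apply bisection; [exact Hab|exact Hcd|exact Hc|].
  intros x0 y0 X0 Y0 e He.
  destruct (Hh x0 y0 X0 Y0) as [q [Hq Eq]]. set (w0 := H x0 y0) in *.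
  (* The final bound is [e * P^2] times [2 L^2/(2 L^2 + 1)]; the summand [1] covers [L = 0]. *)
  set (e' := e / (2 * (L * L) + 1)).
  assert (He' : 0 < e') by (apply Rdiv_lt_0_compat; nra).
  pose proof (proj1 (contC_eps q w0) Hq e' He') as Hl. apply locally_Cmod in Hl.
  destruct Hl as [dl [Hdl Hl]].
  exists (dl / (L + 1)). split; [apply Rdiv_lt_0_compat; lra|].
  intros a' b' c' d' A1 A2 A3 A4 Hs.
  set (P := b' - a' + (d' - c')) in *.
  assert (HP : 0 <= P) by (unfold P; lra).
  assert (HLP : L * P < dl).
  { apply (Rmult_lt_compat_r (L + 1)) in Hs; [|lra]. unfold Rdiv in Hs.
    rewrite Rmult_assoc, Rinv_l, Rmult_1_r in Hs by lra. nra. }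
  set (A := (h w0 - q w0 * w0)%C). set (B := q w0).
  assert (Hca : form_cont (fun x y => (A + B * H x y) * Hx x y)%C (fun x y => (A + B * H x y) * Hy x y)%C a b c d).
  { apply (pullback_form_cont (fun w => A + B * w)%C). intros.
    apply contC_plus; [apply contC_const|]. apply contC_mult; [apply contC_const|apply contC_id]. }
  replace (FI _ _ a' b' c' d') with
   (FI (fun x y => h (H x y) * Hx x y - (A + B * H x y) * Hx x y)%C
       (fun x y => h (H x y) * Hy x y - (A + B * H x y) * Hy x y)%C a' b' c' d').
  2:{ rewrite (FI_minus (fun x y => h (H x y) * Hx x y)%C (fun x y => h (H x y) * Hy x y)%C
        (fun x y => (A + B * H x y) * Hx x y)%C (fun x y => (A + B * H x y) * Hy x y)%C); try lra.
      - rewrite pullback_affine by lra. ring.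
      - eapply form_cont_sub; [exact Hc|..]; lra.
      - eapply form_cont_sub; [exact Hca|..]; lra. }
  eapply Rle_trans; [apply (FI_bound _ _ _ _ _ _ (e' * (L * P) * L)); try lra|].
  - intros x y Xx Yy.
    destruct (form_cont_sub _ _ _ _ _ _ a' b' c' d' Hc ltac:(lra) ltac:(lra) ltac:(lra) ltac:(lra) x y Xx Yy).
    destruct (form_cont_sub _ _ _ _ _ _ a' b' c' d' Hca ltac:(lra) ltac:(lra) ltac:(lra) ltac:(lra) x y Xx Yy).
    split; now apply contC_minus.
  - intros x y Xx Yy.
    assert (Hd : Cmod (H x y - w0) <= L * P).
    { eapply Rle_trans; [apply pullback_lipschitz; lra|]. apply Rmult_le_compat_l; [exact L0|].
      unfold P. unfold Rabs; repeat destruct Rcase_abs; lra. }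
    assert (Hr : Cmod (h (H x y) - (A + B * H x y)) <= e' * (L * P)).
    { rewrite (Eq (H x y)). unfold A, B.
      replace (h w0 + q (H x y) * (H x y - w0) - (h w0 - q w0 * w0 + q w0 * H x y))%C
        with ((q (H x y) - q w0) * (H x y - w0))%C by ring.
      rewrite Cmod_mult. apply Rmult_le_compat; try apply Cmod_ge_0; [|exact Hd].
      left. apply Hl. lra. }
    destruct (HL x y ltac:(lra) ltac:(lra)) as [L1 L2].
    split.
    + replace (h (H x y) * Hx x y - (A + B * H x y) * Hx x y)%C with ((h (H x y) - (A + B * H x y)) * Hx x y)%C by ring.
      rewrite Cmod_mult. apply Rmult_le_compat; auto; apply Cmod_ge_0.
    + replace (h (H x y) * Hy x y - (A + B * H x y) * Hy x y)%C with ((h (H x y) - (A + B * H x y)) * Hy x y)%C by ring.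
      rewrite Cmod_mult. apply Rmult_le_compat; auto; apply Cmod_ge_0.
  - fold P. unfold e'. replace (2 * P * (e / (2 * (L * L) + 1) * (L * P) * L))
      with (e * P ^ 2 * (2 * (L * L) / (2 * (L * L) + 1))) by (field; nra).
    assert (2 * (L * L) / (2 * (L * L) + 1) <= 1).
    { apply (Rmult_le_reg_r (2 * (L * L) + 1)); [nra|]. field_simplify; nra. }
    assert (0 <= e * P ^ 2) by (apply Rmult_le_pos; [lra|apply pow2_ge_0]).
    nra.
Qed.
End Goursat.

Definition cis (t : R) : C := (cos t, sin t).

Lemma Cmod_cis (t : R) : Cmod (cis t) = 1.
Proof.
  unfold Cmod, cis; simpl.
  pose proof (sin2_cos2 t) as E. unfold Rsqr in E.
  transitivity (sqrt 1); [apply f_equal; lra|apply sqrt_1].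
Qed.

Lemma cis_neq_0 (t : R) : cis t <> RtoC 0.
Proof. intros E. pose proof (Cmod_cis t) as H. rewrite E, Cmod_0 in H. lra. Qed.

Lemma dcurve_cis (t : R) : dcurve cis t (Ci * cis t).
Proof.
  eapply dcurve_eq.
  - apply (dcurve_eq _ _ (RtoC (- sin t) + Ci * RtoC (cos t))%C); [|reflexivity].
    assert (E : cis = (fun s => RtoC (cos s) + Ci * RtoC (sin s))%C).
    { apply functional_extensionality; intros s. unfold cis. apply injective_projections; simpl; ring. }
    rewrite E. apply dcurve_plus.
    + apply dcurve_RtoC. apply is_derive_cos.
    + apply dcurve_scal, dcurve_RtoC, is_derive_sin.
  - unfold cis. apply injective_projections; simpl; ring.
Qed.

Lemma cont_cis (t : R) : contC cis t.
Proof. eapply dcurve_cont, dcurve_cis. Qed.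

Lemma cont_cis_comp {U : UniformSpace} (f : U -> R) (x : U) :
  continuous f x -> contC (fun u => cis (f u)) x.
Proof. intros H. apply (contC_compR cis); [exact H|apply cont_cis]. Qed.

Lemma cis_2PI : cis (2 * PI) = cis 0.
Proof. unfold cis. rewrite cos_2PI, sin_2PI, cos_0, sin_0. reflexivity. Qed.

Lemma two_pi_pos : 0 < 2 * PI.
Proof. pose proof PI_RGT_0. lra. Qed.

Lemma RtoC_neq_0 (r : R) : r <> 0 -> RtoC r <> RtoC 0.
Proof. intros H E. apply H. now apply RtoC_inj in E. Qed.

Lemma circle_pt_neq (r s : R) (u : C) (t : R) : 0 <= s <= 1 -> Cmod u < r ->
  (RtoC r * cis t - RtoC s * u)%C <> RtoC 0.
Proof.
  intros Hs Hu E.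
  assert (Hr : Cmod (RtoC r * cis t) = Cmod (RtoC s * u)).
  { f_equal. replace (RtoC r * cis t)%C with ((RtoC r * cis t - RtoC s * u) + RtoC s * u)%C by ring.
    rewrite E. ring. }
  pose proof (Cmod_ge_0 u).
  rewrite !Cmod_mult, !Cmod_R, Cmod_cis, !Rabs_pos_eq in Hr by lra. nra.
Qed.

Lemma Ci_neq_0 : Ci <> RtoC 0.
Proof. intros E. pose proof Cmod_Ci as H. rewrite E, Cmod_0 in H. lra. Qed.

(** [Goursat] for [dw/w] along the circle translated by [- s u]: since [|s u| < r] it avoids [0],
    and the sides [t = 0] and [t = 2 pi] cancel by periodicity. At [s = 0] the integrand is the
    constant [Ci]. *)
Lemma circle_kernel_integral (r : R) (u : C) : Cmod u < r ->
  CI (fun t => (RtoC r * cis t / (RtoC r * cis t - u))%C) 0 (2 * PI) = RtoC (2 * PI).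
Proof.
  intros Hu. pose proof two_pi_pos as HPI. pose proof (Cmod_ge_0 u) as Hu0.
  set (H := fun s t => (RtoC r * cis t - RtoC s * u)%C).
  set (Hx := fun _ _ : R => (- u)%C). set (Hy := fun _ t : R => (RtoC r * (Ci * cis t))%C).
  assert (cHy : forall t, contC (fun t => (RtoC r * (Ci * cis t))%C) t).
  { intros t. apply contC_mult; [apply contC_const|].
    apply contC_mult; [apply contC_const|apply cont_cis]. }
  assert (G := Goursat (fun w => (/ w)%C) H Hx Hy 0 1 0 (2 * PI) r ltac:(lra) ltac:(lra)).
  unfold FI in G.
  rewrite (CI_ext (fun x => (/ H x (2 * PI)%R * Hx x (2 * PI)%R)%C) (fun x => (/ H x 0 * Hx x 0)%C)) in G
    by (intros; unfold H, Hx; now rewrite cis_2PI).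
  rewrite (CI_ext (fun y => (/ H 0 y * Hy 0 y)%C) (fun _ => Ci)) in G.
  2:{ intros t _. unfold H, Hy. field.
      pose proof (circle_pt_neq r 0 u t ltac:(lra) Hu) as E.
      split; intros E0; apply E; rewrite E0; ring. }
  rewrite (CI_ext (fun y => (/ H 1 y * Hy 1 y)%C) (fun t => (Ci * (RtoC r * cis t / (RtoC r * cis t - u)))%C)) in G.
  2:{ intros t _. unfold H, Hy.
      pose proof (circle_pt_neq r 1 u t ltac:(lra) Hu) as E.
      replace (RtoC 1 * u)%C with u in * by ring. field. exact E. }
  rewrite CI_mult_l in G.
  2:{ intros t _. pose proof (circle_pt_neq r 1 u t ltac:(lra) Hu) as E.
      replace (RtoC 1 * u)%C with u in E by ring.
      apply contC_div; [| |exact E]; [|apply contC_minus; [|apply contC_const]];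
      (apply contC_mult; [apply contC_const|apply cont_cis]). }
  rewrite CI_const in G.
  assert (G' : (Ci * CI (fun t => (RtoC r * cis t / (RtoC r * cis t - u))%C) 0 (2 * PI))%C = (Ci * RtoC (2 * PI))%C).
  { match type of G with _ -> _ -> _ -> _ -> _ -> (?A + ?B - ?A - ?D)%C = _ =>
      replace (Ci * RtoC (2 * PI))%C with D by (rewrite Rminus_0_r; ring);
      replace B with ((A + B - A - D) + D)%C by ring end.
    rewrite G; [ring|..]; clear G.
    - intros s t _ _. unfold H, Hx.
      eapply dcurve_eq; [apply (dcurve_minus (fun _ => (RtoC r * cis t)%C)); [apply dcurve_const|apply dcurve_linear]|ring].
    - intros s t _ _. unfold H, Hy.
      eapply dcurve_eq; [apply (dcurve_minus _ (fun _ => (RtoC s * u)%C)); [apply dcurve_scal, dcurve_cis|apply dcurve_const]|ring].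
    - intros s t _ _. split; [apply contC_const|apply cHy].
    - intros s t _ _. unfold Hx, Hy. rewrite Cmod_opp, !Cmod_mult, Cmod_R, Cmod_Ci, Cmod_cis, Rabs_pos_eq; lra.
    - intros s t Hs _. apply hol_inv; [apply hol_id|]. now apply circle_pt_neq. }
  apply (f_equal (fun z => (/ Ci * z)%C)) in G'.
  rewrite !Cmult_assoc, Cinv_l, !Cmult_1_l in G' by apply Ci_neq_0. exact G'.
Qed.

Section Cauchy.
Variables (g : C -> C) (c : C) (r : R).
Hypothesis Hr : 0 < r.
Hypothesis Cg : forall z, contCC g z.
Hypothesis Hg : holomorphic_on (open_disc c r) g.

Lemma Cauchy_cont (z : C) (t : R) : Cmod (z - c) < r ->
  contC (fun s => (RtoC r * cis s / (RtoC r * cis s - (z - c)))%C) t.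
Proof.
  intros Hz. pose proof (circle_pt_neq r 1 (z - c)%C t ltac:(lra) Hz) as E.
  replace (RtoC 1 * (z - c))%C with (z - c)%C in E by ring.
  apply contC_div; [| |exact E]; [|apply contC_minus; [|apply contC_const]];
      (apply contC_mult; [apply contC_const|apply cont_cis]).
Qed.

(** The curves [z + s (zeta - z)] shrink the boundary circle to [z]. As [g] is holomorphic only
    inside, [Goursat] compares parameters in the open interval; continuity of [N] adds [s = 1], the
    boundary integral, and [s = 0], where [g z] times the kernel integral remains. *)
Lemma Cauchy (z : C) : Cmod (z - c) < r ->
  CI (fun t => (g (c + RtoC r * cis t) * (RtoC r * cis t / (RtoC r * cis t - (z - c))))%C) 0 (2 * PI)
  = (RtoC (2 * PI) * g z)%C.
Proof.
  intros Hz. pose proof two_pi_pos as HPI. pose proof (Cmod_ge_0 (z - c)) as Hz0.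
  set (v := fun t => (c + RtoC r * cis t - z)%C).
  assert (Ev : forall t, v t = (RtoC r * cis t - (z - c))%C) by (intros; unfold v; ring).
  assert (v0 : forall t, v t <> RtoC 0).
  { intros t. rewrite Ev. pose proof (circle_pt_neq r 1 (z - c)%C t ltac:(lra) Hz) as E.
    replace (RtoC 1 * (z - c))%C with (z - c)%C in E by ring. exact E. }
  assert (cv : forall t, contC v t).
  { intros t. apply contC_minus; [|apply contC_const]. apply contC_plus; [apply contC_const|].
    apply contC_mult; [apply contC_const|apply cont_cis]. }
  set (N := fun s => CI (fun t => (g (z + RtoC s * v t) * (RtoC r * cis t / v t))%C) 0 (2 * PI)).
  assert (cI : forall s t, contC (fun p : R * R => (g (z + RtoC (snd p) * v (fst p)) * (RtoC r * cis (fst p) / v (fst p)))%C) (t, s)).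
  { intros s t.
    assert (c1 : contC (fun p : R * R => v (fst p)) (t, s)) by (apply (contC_compR v); [apply continuous_fst|apply cv]).
    apply contC_mult.
    - apply (contC_comp g); [|apply Cg]. apply contC_plus; [apply contC_const|].
      apply contC_mult; [|exact c1]. apply contC_RtoC, continuous_snd.
    - apply contC_div; [|exact c1|apply v0]. apply contC_mult; [apply contC_const|].
      apply cont_cis_comp, continuous_fst. }
  assert (cN : forall s, contC N s).
  { intros s. unfold N. apply (contC_CI_param_any (fun p : R * R => (g (z + RtoC (snd p) * v (fst p)) * (RtoC r * cis (fst p) / v (fst p)))%C)).
    intros [t s']. apply cI. }
  assert (cs : forall s, cont_on (fun t => (g (z + RtoC s * v t) * (RtoC r * cis t / v t))%C) 0 (2 * PI)).
  { intros s t _. apply (cont_slice_l (fun p : R * R => (g (z + RtoC (snd p) * v (fst p)) * (RtoC r * cis (fst p) / v (fst p)))%C)). apply cI. }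
  (* Integrating [g(w)/(w-z)] along [z + s(zeta - z)], where the factor [s] cancels. *)
  assert (EN : forall s1 s2, 0 < s1 -> s1 <= s2 -> s2 < 1 -> N s1 = N s2).
  { intros s1 s2 H1 H2 H3.
    set (H := fun s t => (z + RtoC s * v t)%C).
    set (Hx := fun _ t : R => v t). set (Hy := fun s t : R => (RtoC s * (RtoC r * (Ci * cis t)))%C).
    assert (G := Goursat (fun w => (g w / (w - z))%C) H Hx Hy s1 s2 0 (2 * PI) (2 * r + 1) ltac:(lra) ltac:(lra)).
    assert (Ephi : forall s, 0 < s -> CI (fun t => ((g (H s t) / (H s t - z)) * Hy s t)%C) 0 (2 * PI) = (Ci * N s)%C).
    { intros s Hs. unfold N. rewrite <- CI_mult_l by apply cs. apply CI_ext. intros t _.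
      unfold H, Hy. specialize (v0 t). pose proof (RtoC_neq_0 s ltac:(lra)).
      replace (z + RtoC s * v t - z)%C with (RtoC s * v t)%C by ring. field. tauto. }
    unfold FI in G. rewrite (Ephi s1), (Ephi s2) in G by lra.
    rewrite (CI_ext (fun x => (g (H x (2 * PI)%R) / (H x (2 * PI)%R - z) * Hx x (2 * PI)%R)%C)
       (fun x => (g (H x 0) / (H x 0 - z) * Hx x 0)%C)) in G
      by (intros; unfold H, Hx, v; now rewrite cis_2PI).
    assert (E : (Ci * N s1)%C = (Ci * N s2)%C).
    { match type of G with _ -> _ -> _ -> _ -> _ -> (?A + ?B - ?A - ?D)%C = _ =>
        replace D with (B - (A + B - A - D))%C by ring end.
      rewrite G; [ring|..]; clear G.
      - intros s t _ _. unfold H, Hx.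
        eapply dcurve_eq; [apply (dcurve_plus (fun _ => z)); [apply dcurve_const|apply dcurve_linear]|ring].
      - intros s t _ _. unfold H, Hy, v.
        eapply dcurve_eq; [apply (dcurve_plus (fun _ => z)); [apply dcurve_const|apply dcurve_scal];
          apply (dcurve_minus (fun t => (c + RtoC r * cis t)%C) (fun _ => z)); [|apply dcurve_const];
          apply (dcurve_plus (fun _ => c)); [apply dcurve_const|apply dcurve_scal, dcurve_cis]|ring].
      - intros s t _ _. split; [apply contC_const|].
        apply contC_mult; [apply contC_const|]. apply contC_mult; [apply contC_const|].
        apply contC_mult; [apply contC_const|apply cont_cis].
      - intros s t Hs _. unfold Hx, Hy. split.
        + rewrite Ev. unfold Cminus. eapply Rle_trans; [apply Cmod_triangle|].
          rewrite Cmod_opp, Cmod_mult, Cmod_R, Cmod_cis, Rabs_pos_eq by lra. unfold Cminus in Hz. lra.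
        + rewrite !Cmod_mult, !Cmod_R, Cmod_cis, Cmod_Ci, !Rabs_pos_eq by lra. nra.
      - intros s t Hs _. apply hol_div.
        + apply hol_iff_ex_derive. apply Hg. unfold open_disc, H.
          replace (z + RtoC s * v t - c)%C with (RtoC (1 - s) * (z - c) + RtoC s * (RtoC r * cis t))%C
            by (rewrite RtoC_minus; unfold v; ring).
          eapply Rle_lt_trans; [apply Cmod_triangle|].
          rewrite !Cmod_mult, !Cmod_R, Cmod_cis, !Rabs_pos_eq by lra. nra.
        + apply hol_minus; [apply hol_id|apply hol_const].
        + unfold H. replace (z + RtoC s * v t - z)%C with (RtoC s * v t)%C by ring.
          apply Cmult_neq_0; [apply RtoC_neq_0; lra|apply v0]. }
    apply (f_equal (fun z => (/ Ci * z)%C)) in E.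
    rewrite !Cmult_assoc, Cinv_l, !Cmult_1_l in E by apply Ci_neq_0. exact E. }
  assert (E12 : N 0 = N 1).
  { assert (Eh : forall s, 0 < s < 1 -> N s = N (1 / 2)).
    { intros s Hs. destruct (Rle_dec s (1 / 2)); [apply EN; lra|symmetry; apply EN; lra]. }
    transitivity (N (1 / 2)); [|symmetry]; (apply contC_limit_eq; [apply cN|]); intros d Hd; set (q := Rmin (1 / 2) (d / 2));
      (assert (Hq : 0 < q /\ q <= 1 / 2 /\ q <= d / 2) by (unfold q, Rmin; destruct Rle_dec; lra)).
    - exists q. split; [rewrite Rabs_pos_eq; lra|apply Eh; lra].
    - exists (1 - q). split; [rewrite Rabs_left; lra|apply Eh; lra]. }
  transitivity (N 1).
  - apply CI_ext. intros t _. rewrite Ev. f_equal. f_equal. unfold v. ring.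
  - rewrite <- E12. unfold N. rewrite (CI_ext _ (fun t => (g z * (RtoC r * cis t / (RtoC r * cis t - (z - c))))%C)).
    + rewrite CI_mult_l by (intros t _; now apply Cauchy_cont).
      rewrite circle_kernel_integral by exact Hz. ring.
    + intros t _. rewrite <- Ev. f_equal. f_equal. ring.
Qed.

Lemma cont_on_circle (t : R) : contC (fun s => g (c + RtoC r * cis s)) t.
Proof.
  apply (contC_comp g); [|apply Cg]. apply contC_plus; [apply contC_const|].
  apply contC_mult; [apply contC_const|apply cont_cis].
Qed.

Lemma Cauchy_estimate (z : C) (M : R) : Cmod (z - c) < r ->
  (forall t, 0 <= t <= 2 * PI -> Cmod (g (c + RtoC r * cis t)) <= M) ->
  Cmod (g z) <= M * (r / (r - Cmod (z - c))).
Proof.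
  intros Hz HM. pose proof two_pi_pos as HPI. pose proof (Cmod_ge_0 (z - c)) as Hz0.
  assert (H : Cmod (RtoC (2 * PI) * g z) <= (2 * PI - 0) * (M * (r / (r - Cmod (z - c))))).
  { rewrite <- Cauchy by exact Hz. apply CI_bound; [lra| |].
    - intros t _. apply contC_mult; [apply cont_on_circle|now apply Cauchy_cont].
    - intros t Ht. rewrite Cmod_mult. apply Rmult_le_compat; try apply Cmod_ge_0; [apply HM; lra|].
      pose proof (circle_pt_neq r 1 (z - c)%C t ltac:(lra) Hz) as E.
      replace (RtoC 1 * (z - c))%C with (z - c)%C in E by ring.
      rewrite Cmod_div by exact E. rewrite Cmod_mult, Cmod_R, Cmod_cis, Rabs_pos_eq, Rmult_1_r by lra.
      apply Rmult_le_compat_l; [lra|]. apply Rinv_le_contravar; [lra|].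
      pose proof (Cmod_reverse_triangle (RtoC r * cis t) (z - c)) as Hrt.
      rewrite Cmod_mult, Cmod_R, Cmod_cis, (Rabs_pos_eq r), Rmult_1_r in Hrt by lra.
      apply Rabs_le_between in Hrt. lra. }
  rewrite Cmod_mult, Cmod_R, Rabs_pos_eq in H by lra. rewrite Rminus_0_r in H.
  now apply Rmult_le_reg_l in H.
Qed.
End Cauchy.

(** * Maximum principle and identity theorem *)

Lemma hol_pow (f : C -> C) (n : nat) (z : C) : hol f z -> hol (fun w => (f w ^ n)%C) z.
Proof.
  intros H. induction n as [|n IH]; simpl; [apply hol_const|]. now apply (hol_mult f).
Qed.

Lemma contC_pow {U : UniformSpace} (f : U -> C) (n : nat) (x : U) :
  contC f x -> contC (fun u => (f u ^ n)%C) x.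
Proof.
  intros H. induction n as [|n IH]; simpl; [apply contC_const|]. now apply contC_mult.
Qed.

Lemma closed_disc_limit (g : C -> C) (c : C) (r M : R) (z : C) : 0 < r -> contCC g z ->
  (forall w, Cmod (w - c) < r -> Cmod (g w) <= M) -> Cmod (z - c) <= r -> Cmod (g z) <= M.
Proof.
  intros Hr Cg HM [Hz|Hz]; [now apply HM|].
  apply Rnot_lt_le. intros Hlt.
  destruct (proj1 (locally_Cmod _ _) (proj1 (contC_eps g z) Cg (Cmod (g z) - M) ltac:(lra))) as [d [Hd H]].
  (* Moving [z] towards the centre by the fraction [s] enters the open disc and displaces it by less
     than [d]. *)
  set (s := Rmin (1 / 2) (d / (2 * r))).
  assert (Hs : 0 < s /\ s <= 1 / 2 /\ s * r < d).
  { assert (0 < d / (2 * r)) by (apply Rdiv_lt_0_compat; lra).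
    assert (d / (2 * r) * r = d / 2) by (field; lra).
    unfold s, Rmin. destruct Rle_dec; repeat split; nra. }
  set (w := (z - RtoC s * (z - c))%C).
  assert (Hw : Cmod (g w) <= M).
  { apply HM. replace (w - c)%C with (RtoC (1 - s) * (z - c))%C by (rewrite RtoC_minus; unfold w; ring).
    rewrite Cmod_mult, Cmod_R, Rabs_pos_eq by lra. nra. }
  specialize (H w).
  replace (w - z)%C with (- (RtoC s * (z - c)))%C in H by (unfold w; ring).
  rewrite Cmod_opp, Cmod_mult, Cmod_R, Rabs_pos_eq, Hz in H by lra.
  specialize (H ltac:(lra)). rewrite Cmod_sub_comm in H.
  pose proof (Cmod_reverse_triangle (g z) (g w)) as Hrt. apply Rabs_le_between in Hrt. lra.
Qed.

Section Disc.
Variables (g : C -> C) (c : C) (r : R).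
Hypothesis Hr : 0 < r.
Hypothesis Cg : forall z, contCC g z.
Hypothesis Hg : holomorphic_on (open_disc c r) g.

(* Cauchy's estimate for [g^n] has a constant independent of [n]; take [n]-th roots. *)
Lemma maximum_principle_open (M : R) (z : C) :
  (forall t, 0 <= t <= 2 * PI -> Cmod (g (c + RtoC r * cis t)) <= M) -> Cmod (z - c) < r -> Cmod (g z) <= M.
Proof.
  intros HM Hz. set (K := r / (r - Cmod (z - c))).
  assert (HK : forall n, Cmod (g z) ^ n <= M ^ n * K).
  { intros n. rewrite <- Cmod_pow.
    apply (Cauchy_estimate (fun w => (g w ^ n)%C)); auto.
    - intros w. now apply contC_pow.
    - intros w Hw. apply hol_iff_ex_derive, hol_pow, hol_iff_ex_derive. now apply Hg.
    - intros t Ht. rewrite Cmod_pow. apply pow_incr. split; [apply Cmod_ge_0|now apply HM]. }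
  assert (M0 : 0 <= M) by (eapply Rle_trans; [apply Cmod_ge_0|apply (HM 0); pose proof two_pi_pos; lra]).
  apply Rnot_lt_le. intros Hlt.
  destruct (Req_dec M 0) as [EM|NM].
  - specialize (HK 1%nat). rewrite EM in *. simpl in HK. lra.
  - set (q := Cmod (g z) / M).
    assert (Hq : 1 < q).
    { unfold q. apply (Rmult_lt_reg_r M); [lra|]. field_simplify; lra. }
    destruct (Pow_x_infinity q) with (b := K + 1) as [n Hn]; [rewrite Rabs_pos_eq; lra|].
    specialize (Hn n (Nat.le_refl n)). rewrite Rabs_pos_eq in Hn by (apply pow_le; lra).
    specialize (HK n). assert (Hp : 0 < M ^ n) by (apply pow_lt; lra).
    unfold q, Rdiv in Hn. rewrite Rpow_mult_distr, pow_inv in Hn.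
    assert (Cmod (g z) ^ n * / M ^ n <= K).
    { apply (Rmult_le_reg_r (M ^ n)); [exact Hp|]. rewrite Rmult_assoc, Rinv_l by lra. lra. }
    lra.
Qed.

Lemma maximum_principle (M : R) (z : C) :
  (forall t, 0 <= t <= 2 * PI -> Cmod (g (c + RtoC r * cis t)) <= M) -> Cmod (z - c) <= r -> Cmod (g z) <= M.
Proof.
  intros HM Hz. apply (closed_disc_limit g c r); auto. intros w. now apply maximum_principle_open.
Qed.

Lemma circle_bound : exists M, 0 <= M /\ forall t, 0 <= t <= 2 * PI -> Cmod (g (c + RtoC r * cis t)) <= M.
Proof.
  destruct (continuity_ab_maj (fun t => Cmod (g (c + RtoC r * cis t))) 0 (2 * PI)) as [m [Hm _]].
  - pose proof two_pi_pos; lra.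
  - intros t _. apply continuity_pt_filterlim. apply (contC_Cmod (fun t => g (c + RtoC r * cis t))). now apply cont_on_circle.
  - exists (Cmod (g (c + RtoC r * cis m))). split; [apply Cmod_ge_0|exact Hm].
Qed.

(* [2 pi / (z - c)^n] times the Taylor remainder of order [n] of [g] at [c]. *)
Definition remainder (n : nat) (z : C) : C :=
  CI (fun t => (g (c + RtoC r * cis t) * (RtoC r * cis t / (RtoC r * cis t - (z - c))) * (/ (RtoC r * cis t) ^ n))%C)
    0 (2 * PI).

Lemma rcis_neq_0 (t : R) : (RtoC r * cis t)%C <> RtoC 0.
Proof. apply Cmult_neq_0; [apply RtoC_neq_0; lra|apply cis_neq_0]. Qed.

Lemma rcis_minus_neq_0 (z : C) (t : R) : Cmod (z - c) < r -> (RtoC r * cis t - (z - c))%C <> RtoC 0.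
Proof.
  intros Hz. pose proof (circle_pt_neq r 1 (z - c)%C t ltac:(lra) Hz) as E.
  now replace (RtoC 1 * (z - c))%C with (z - c)%C in E by ring.
Qed.

Lemma remainder_cont (n : nat) (z : C) (t : R) : Cmod (z - c) < r ->
  contC (fun t => (g (c + RtoC r * cis t) * (RtoC r * cis t / (RtoC r * cis t - (z - c))) * (/ (RtoC r * cis t) ^ n))%C) t.
Proof.
  intros Hz. apply contC_mult; [apply contC_mult|].
  - now apply cont_on_circle.
  - now apply Cauchy_cont.
  - apply contC_inv; [|apply Cpow_nz, rcis_neq_0].
    apply contC_pow, contC_mult; [apply contC_const|apply cont_cis].
Qed.

Lemma remainder_0 (z : C) : Cmod (z - c) < r -> remainder 0 z = (RtoC (2 * PI) * g z)%C.
Proof.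
  intros Hz. rewrite <- (Cauchy g c r) by assumption. unfold remainder. apply CI_ext. intros t _. simpl.
  field. now apply rcis_minus_neq_0.
Qed.

Lemma Cmod_c_c : Cmod (c - c) < r.
Proof. replace (c - c)%C with (RtoC 0) by ring. now rewrite Cmod_0. Qed.

(** One step of the geometric series, [zeta/(zeta - h) = 1 + (h/zeta) * (zeta/(zeta - h))] with
    [h = z - c], divided by [zeta^n]. Here [remainder n c] is [2 pi] times the Taylor coefficient of
    order [n]. *)
Lemma remainder_step (n : nat) (z : C) : Cmod (z - c) < r ->
  remainder n z = (remainder n c + (z - c) * remainder (S n) z)%C.
Proof.
  intros Hz. unfold remainder.
  rewrite <- CI_mult_l by (intros t _; now apply remainder_cont).
  rewrite <- CI_plus.
  - apply CI_ext. intros t _. simpl. pose proof (rcis_neq_0 t).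
    pose proof (rcis_minus_neq_0 z t Hz). pose proof (rcis_minus_neq_0 c t Cmod_c_c).
    pose proof (Cpow_nz (RtoC r * cis t) n (rcis_neq_0 t)).
    replace (RtoC r * cis t - (c - c))%C with (RtoC r * cis t)%C in * by ring.
    field. repeat split; try assumption; try apply cis_neq_0; apply RtoC_neq_0; lra.
  - intros t _. apply remainder_cont, Cmod_c_c.
  - intros t _. apply contC_mult; [apply contC_const|now apply remainder_cont].
Qed.

Lemma remainder_bound (M : R) (n : nat) (z : C) : Cmod (z - c) < r -> 0 <= M ->
  (forall t, 0 <= t <= 2 * PI -> Cmod (g (c + RtoC r * cis t)) <= M) ->
  Cmod (remainder n z) <= 2 * PI * (M * (r / (r - Cmod (z - c))) * / r ^ n).
Proof.
  intros Hz M0 HM. pose proof two_pi_pos.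
  rewrite <- (Rminus_0_r (2 * PI)) at 1. unfold remainder. apply CI_bound; [lra| |].
  - intros t _. now apply remainder_cont.
  - intros t Ht. rewrite !Cmod_mult.
    rewrite Cmod_inv by apply Cpow_nz, rcis_neq_0.
    rewrite Cmod_pow, Cmod_div by (now apply rcis_minus_neq_0).
    rewrite Cmod_mult, Cmod_R, Cmod_cis, Rmult_1_r, Rabs_pos_eq by lra.
    assert (0 < / r ^ n) by (apply Rinv_0_lt_compat, pow_lt; lra).
    apply Rmult_le_compat_r; [lra|].
    assert (0 <= / Cmod (RtoC r * cis t - (z - c))).
    { left. apply Rinv_0_lt_compat. now apply Cmod_gt_0, rcis_minus_neq_0. }
    apply Rmult_le_compat; [apply Cmod_ge_0|apply Rmult_le_pos; lra|now apply HM|].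
    apply Rmult_le_compat_l; [lra|]. apply Rinv_le_contravar; [lra|].
    pose proof (Cmod_reverse_triangle (RtoC r * cis t) (z - c)) as Hrt.
    rewrite Cmod_mult, Cmod_R, Cmod_cis, (Rabs_pos_eq r), Rmult_1_r in Hrt by lra.
    apply Rabs_le_between in Hrt. lra.
Qed.

(** Vanishing along the segment kills the Taylor coefficients at [c] one after another, so
    [2 pi g z] equals its remainder of every order; this is at most a constant times [q^n] with
    [q = |z - c|/r < 1]. *)
Lemma identity_segment (e : C) (dl : R) : Cmod e = 1 -> 0 < dl ->
  (forall t, 0 < t < dl -> g (c + RtoC t * e) = RtoC 0) ->
  forall z, Cmod (z - c) < r -> g z = RtoC 0.
Proof.
  intros He Hdl H0. destruct circle_bound as [M [M0 HM]]. pose proof two_pi_pos as HPI.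
  assert (Hind : forall n, (forall z, Cmod (z - c) < r -> (RtoC (2 * PI) * g z)%C = ((z - c) ^ n * remainder n z)%C)).
  { induction n as [|n IH]; intros z Hz.
    - rewrite remainder_0 by assumption. simpl. ring.
    - assert (Hc : remainder n c = RtoC 0).
      { set (B := 2 * PI * (M * (r / (r - r / 2)) * / r ^ S n)).
        (* On the segment [g] vanishes, hence so does [remainder n]; one more Taylor step shows that
           [remainder n c] is of order [t]. *)
        assert (HB : forall t, 0 < t -> t < dl -> t <= r / 2 -> Cmod (remainder n c) <= t * B).
        { intros t T0 T1 T2. set (w := (c + RtoC t * e)%C).
          assert (Ew : (w - c)%C = (RtoC t * e)%C) by (unfold w; ring).
          assert (Hw : Cmod (w - c) = t) by (rewrite Ew, Cmod_mult, Cmod_R, He, Rabs_pos_eq; lra).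
          pose proof (IH w ltac:(lra)) as E. unfold w in E at 1. rewrite H0 in E by lra.
          assert (Rw : remainder n w = RtoC 0).
          { destruct (classic (remainder n w = RtoC 0)) as [|N]; [assumption|exfalso].
            assert (P : ((w - c) ^ n * remainder n w)%C <> RtoC 0).
            { apply Cmult_neq_0; [|exact N]. apply Cpow_nz. intros E0. rewrite E0, Cmod_0 in Hw. lra. }
            apply P. rewrite <- E. ring. }
          rewrite remainder_step in Rw by lra.
          replace (remainder n c) with (- ((w - c) * remainder (S n) w) + (remainder n c + (w - c) * remainder (S n) w))%C by ring.
          rewrite Rw, Cplus_0_r, Cmod_opp, Cmod_mult, Hw.
          apply Rmult_le_compat_l; [lra|].
          eapply Rle_trans; [apply (remainder_bound M); [lra|exact M0|exact HM]|].
          unfold B. rewrite Hw. apply Rmult_le_compat_l; [lra|].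
          apply Rmult_le_compat_r; [left; apply Rinv_0_lt_compat, pow_lt; lra|].
          apply Rmult_le_compat_l; [lra|]. apply Rmult_le_compat_l; [lra|]. apply Rinv_le_contravar; lra. }
        apply Cmod_eq_0. apply Rle_antisym; [|apply Cmod_ge_0].
        apply Rnot_lt_le. intros Hlt. set (X := Cmod (remainder n c)) in *.
        set (t := Rmin (dl / 2) (Rmin (r / 2) (X / (2 * (Rabs B + 1))))).
        pose proof (Rabs_pos B). pose proof (Rle_abs B).
        assert (0 < X / (2 * (Rabs B + 1))) by (apply Rdiv_lt_0_compat; lra).
        assert (Ht : 0 < t /\ t <= dl / 2 /\ t <= r / 2 /\ t <= X / (2 * (Rabs B + 1))).
        { unfold t, Rmin. repeat destruct Rle_dec; lra. }
        specialize (HB t ltac:(lra) ltac:(lra) ltac:(lra)).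
        assert (t * B <= X / (2 * (Rabs B + 1)) * (Rabs B + 1)) by (apply Rle_trans with (t * (Rabs B + 1)); [nra|apply Rmult_le_compat_r; lra]).
        replace (X / (2 * (Rabs B + 1)) * (Rabs B + 1)) with (X / 2) in * by (field; lra). lra. }
      rewrite IH, remainder_step, Hc by assumption. simpl. ring. }
  intros z Hz. apply Cmod_eq_0. apply Rle_antisym; [|apply Cmod_ge_0].
  pose proof (Cmod_ge_0 (z - c)) as Hz0.
  set (q := Cmod (z - c) / r). assert (Hq : 0 <= q < 1).
  { unfold q. split; [apply Rmult_le_pos; [lra|left; apply Rinv_0_lt_compat; lra]|].
    apply (Rmult_lt_reg_r r); [lra|]. field_simplify; lra. }
  set (B := 2 * PI * (M * (r / (r - Cmod (z - c))))).
  assert (HB : forall n, 2 * PI * Cmod (g z) <= q ^ n * B).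
  { intros n. replace (2 * PI * Cmod (g z)) with (Cmod (RtoC (2 * PI) * g z)) by (rewrite Cmod_mult, Cmod_R, Rabs_pos_eq; lra).
    rewrite (Hind n z Hz), Cmod_mult, Cmod_pow.
    apply Rle_trans with (Cmod (z - c) ^ n * (2 * PI * (M * (r / (r - Cmod (z - c))) * / r ^ n))).
    - apply Rmult_le_compat_l; [now apply pow_le|]. now apply remainder_bound.
    - right. unfold q, B, Rdiv. rewrite Rpow_mult_distr, pow_inv. ring. }
  apply Rnot_lt_le. intros Hlt.
  assert (B0 : 0 < B) by (specialize (HB 0%nat); simpl in HB; nra).
  destruct (pow_lt_1_zero q) with (y := 2 * PI * Cmod (g z) / B) as [n Hn].
  - rewrite Rabs_pos_eq; lra.
  - apply Rdiv_lt_0_compat; nra.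
  - specialize (Hn n (Nat.le_refl n)). rewrite Rabs_pos_eq in Hn by (apply pow_le; lra).
    specialize (HB n). apply (Rmult_lt_compat_r B) in Hn; [|exact B0].
    replace (2 * PI * Cmod (g z) / B * B) with (2 * PI * Cmod (g z)) in Hn by (field; lra). lra.
Qed.
End Disc.

(** * A vanishing form of Morera's theorem *)

Lemma hol_eps (f : C -> C) (z l : C) :
  (forall e, 0 < e -> exists d, 0 < d /\ forall w, Cmod (w - z) < d ->
     Cmod (f w - f z - l * (w - z)) <= e * Cmod (w - z)) -> hol f z.
Proof.
  intros H. apply hol_iff_ex_derive. exists l. split; [apply is_linear_scal_l|].
  intros x Hx. apply (is_filter_lim_locally_unique (V := AbsRing_NormedModule C_AbsRing) z x) in Hx. subst x.
  intros eps. destruct (H eps (cond_pos eps)) as [d [Hd Hs]].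
  exists (mkposreal d Hd). intros w Hw. specialize (Hs w Hw).
  change (Cmod ((f w + - f z) + - ((w + - z) * l))%C <= eps * Cmod (w + - z)%C).
  replace ((f w + - f z) + - ((w + - z) * l))%C with (f w - f z - l * (w - z))%C by ring. exact Hs.
Qed.

(** Radial projection onto the closed disc. Composing with it turns continuity relative to the disc
    into continuity on the plane without changing any value on the disc. *)
Definition retract (c : C) (r : R) (z : C) : C := (c + RtoC (/ Rmax 1 (Cmod (z - c) / r)) * (z - c))%C.

Lemma retract_id (c : C) (r : R) (z : C) : 0 < r -> Cmod (z - c) <= r -> retract c r z = z.
Proof.
  intros Hr Hz. unfold retract. rewrite Rmax_left.
  - rewrite Rinv_1. ring.
  - apply (Rmult_le_reg_r r); [exact Hr|]. field_simplify; lra.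
Qed.

Lemma retract_in (c : C) (r : R) (z : C) : 0 < r -> Cmod (retract c r z - c) <= r.
Proof.
  intros Hr. unfold retract.
  replace (c + RtoC (/ Rmax 1 (Cmod (z - c) / r)) * (z - c) - c)%C
    with (RtoC (/ Rmax 1 (Cmod (z - c) / r)) * (z - c))%C by ring.
  set (m := Rmax 1 (Cmod (z - c) / r)).
  assert (H1 : 1 <= m) by apply Rmax_l.
  assert (H2 : Cmod (z - c) / r <= m) by apply Rmax_r.
  rewrite Cmod_mult, Cmod_R, Rabs_pos_eq by (left; apply Rinv_0_lt_compat; lra).
  apply (Rmult_le_reg_l m); [lra|]. rewrite <- Rmult_assoc, Rinv_r, Rmult_1_l by lra.
  apply (Rmult_le_compat_r r) in H2; [|lra]. unfold Rdiv in H2.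
  rewrite Rmult_assoc, Rinv_l, Rmult_1_r in H2 by lra. exact H2.
Qed.

Lemma retract_cont_gen {U : UniformSpace} (c z : U -> C) (r : U -> R) (u : U) :
  contC c u -> contC z u -> continuous r u -> 0 < r u -> contC (fun u => retract (c u) (r u) (z u)) u.
Proof.
  intros Hc Hz Hr H0. unfold retract.
  assert (H1 : contC (fun u => (z u - c u)%C) u) by now apply contC_minus.
  apply contC_plus; [exact Hc|]. apply contC_mult; [|exact H1].
  apply contC_RtoC. apply contR_inv.
  - apply contR_max; [apply continuous_const|]. apply contR_mult; [now apply contC_Cmod|].
    apply contR_inv; [exact Hr|lra].
  - pose proof (Rmax_l 1 (Cmod (z u - c u) / r u)). lra.
Qed.

Lemma retract_cont (c : C) (r : R) (z : C) : 0 < r ->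
  contCC (retract c r) z.
Proof.
  intros Hr. apply (retract_cont_gen (fun _ => c) (fun z => z) (fun _ => r)).
  - apply contC_const. - apply contC_id. - apply continuous_const. - exact Hr.
Qed.

Lemma cont_retract (g : C -> C) (c : C) (r : R) (z : C) : 0 < r ->
  @continuous_on C_UniformSpace C_UniformSpace (closed_disc c r) g ->
  contCC (fun w => g (retract c r w)) z.
Proof.
  intros Hr Hg. unfold continuous.
  apply (filterlim_comp _ _ _ (retract c r) g _ (within (closed_disc c r) (@locally C_UniformSpace (retract c r z)))).
  - intros P HP. unfold within in HP. pose proof (retract_cont c r z Hr _ HP) as H.
    unfold filtermap in *. generalize H. apply filter_imp. intros w Hw. apply Hw.
    now apply retract_in.
  - apply Hg. now apply retract_in.
Qed.

Lemma locally_open_disc (c : C) (r : R) (z : C) : open_disc c r z -> @locally C_UniformSpace z (open_disc c r).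
Proof.
  intros Hz. apply locally_Cmod. unfold open_disc in *. exists (r - Cmod (z - c)).
  split; [lra|]. intros w Hw.
  eapply Rle_lt_trans; [apply (Cmod_triangle_sub _ z)|]. lra.
Qed.

Lemma hol_retract (g : C -> C) (c : C) (r : R) : 0 < r ->
  holomorphic_on (open_disc c r) g -> holomorphic_on (open_disc c r) (fun w => g (retract c r w)).
Proof.
  intros Hr Hg z Hz. apply hol_iff_ex_derive. apply (hol_ext_loc g).
  - generalize (locally_open_disc c r z Hz). apply filter_imp. intros w Hw.
    rewrite retract_id; auto. now left.
  - apply hol_iff_ex_derive. now apply Hg.
Qed.

Lemma identity_segment_on (g : C -> C) (c : C) (r : R) (e : C) (dl : R) : 0 < r ->
  @continuous_on C_UniformSpace C_UniformSpace (closed_disc c r) g ->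
  holomorphic_on (open_disc c r) g -> Cmod e = 1 -> 0 < dl ->
  (forall t, 0 < t < dl -> t < r -> g (c + RtoC t * e)%C = RtoC 0) ->
  forall z, Cmod (z - c) < r -> g z = RtoC 0.
Proof.
  intros Hr Cg Hg He Hdl H0 z Hz.
  rewrite <- (retract_id c r z) by lra.
  apply (identity_segment (fun w => g (retract c r w)) c r Hr) with (e := e) (dl := Rmin dl r); auto.
  - intros w. now apply cont_retract.
  - now apply hol_retract.
  - unfold Rmin; destruct Rle_dec; lra.
  - intros t [T0 T1].
    assert (t < dl /\ t < r) by (unfold Rmin in T1; destruct Rle_dec; lra).
    rewrite retract_id; [apply H0; lra|lra|].
    replace (c + RtoC t * e - c)%C with (RtoC t * e)%C by ring.
    rewrite Cmod_mult, Cmod_R, He, Rabs_pos_eq; lra.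
Qed.

Lemma cont_line_x (f : C -> C) (x y : R) : contCC f (x, y) ->
  contC (fun s => f (s, y)) x.
Proof.
  intros H. apply (contC_comp f (fun s => (s, y) : C)); [|exact H].
  apply contC_pair; [apply continuous_id|apply continuous_const].
Qed.

Lemma cont_line_y (f : C -> C) (x y : R) : contCC f (x, y) ->
  contC (fun s => f (x, s)) y.
Proof.
  intros H. apply (contC_comp f (fun s => (x, s) : C)); [|exact H].
  apply contC_pair; [apply continuous_const|apply continuous_id].
Qed.

(* [oint F dz] over the boundary of a rectangle. *)
Definition rect_int (F : C -> C) : R -> R -> R -> R -> C :=
  FI (fun x y => F (x, y)) (fun x y => (Ci * F (x, y))%C).

Section Morera.
Variables (F : C -> C) (x1 x2 : R).
Hypothesis CF : forall x y, x1 < x < x2 -> 0 < y -> contCC F (x, y).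
Hypothesis LF : forall x0 y0, x1 < x0 < x2 -> 0 < y0 -> forall e, 0 < e -> exists eta, 0 < eta /\
  forall a b c d, x1 < a <= x0 -> x0 <= b < x2 -> 0 < c <= y0 -> y0 <= d ->
    (b - a) + (d - c) < eta -> Cmod (rect_int F a b c d) <= e * ((b - a) + (d - c)) ^ 2.
Hypothesis ZF : forall x y, x1 < x < x2 -> 2 <= y -> F (x, y) = RtoC 0.

Lemma rect_form_cont (a b c d : R) : x1 < a -> b < x2 -> 0 < c ->
  form_cont (fun x y => F (x, y)) (fun x y => (Ci * F (x, y))%C) a b c d.
Proof.
  intros Ha Hb Hc x y Hx Hy. split.
  - apply cont_line_x. apply CF; lra.
  - apply contC_mult; [apply contC_const|]. apply cont_line_y. apply CF; lra.
Qed.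

Lemma rect_int_0 (a b c d : R) : x1 < a -> a <= b -> b < x2 -> 0 < c -> c <= d -> rect_int F a b c d = RtoC 0.
Proof.
  intros H1 H2 H3 H4 H5. unfold rect_int. apply bisection; [exact H2|exact H5|now apply rect_form_cont|].
  - intros x0 y0 X0 Y0 e He. destruct (LF x0 y0 ltac:(lra) ltac:(lra) e He) as [eta [Heta H]].
    exists eta. split; [exact Heta|]. intros a' b' c' d' A1 A2 A3 A4 A5.
    apply H; lra.
Qed.

(** The integral of [F dz] along the vertical path from height [2] to [z]. As [F] vanishes from that
    height on, the top side of a rectangle contributes nothing and all columns share one
    normalization. *)
Definition primitive (z : C) : C := (- (Ci * CI (fun t => F (Re z, t)) (Im z) 2))%C.

Lemma cont_on_y (x u v : R) : x1 < x < x2 -> 0 < u -> 0 < v -> cont_on (fun t => F (x, t)) u v.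
Proof.
  intros Hx Hu Hv t Ht. apply cont_line_y. apply CF; [exact Hx|].
  unfold Rmin in Ht. destruct Rle_dec; lra.
Qed.

Lemma cont_on_x (y u v : R) : x1 < u < x2 -> x1 < v < x2 -> 0 < y -> cont_on (fun t => F (t, y)) u v.
Proof.
  intros Hu Hv Hy t Ht. apply cont_line_x. apply CF; [|exact Hy].
  unfold Rmin, Rmax in Ht. destruct Rle_dec; lra.
Qed.

Lemma primitive_x_le (x x0 y : R) : x1 < x0 -> x0 <= x -> x < x2 -> 0 < y <= 2 ->
  (primitive (x, y) - primitive (x0, y))%C = CI (fun s => F (s, y)) x0 x.
Proof.
  intros H1 H2 H3 H4.
  pose proof (rect_int_0 x0 x y 2 H1 H2 H3 ltac:(lra) ltac:(lra)) as E. unfold rect_int, FI in E.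
  rewrite (CI_ext (fun s => F (s, 2)) (fun _ => RtoC 0)), CI_const in E.
  2:{ intros t. rewrite Rmin_left, Rmax_right by lra. intros Ht. apply ZF; lra. }
  rewrite !CI_mult_l in E by (apply cont_on_y; lra).
  unfold primitive; simpl.
  match type of E with (?A + ?B - _ - ?D)%C = _ => replace A with ((A + B - RtoC (x - x0) * 0 - D) - B + D)%C by ring end.
  rewrite E. ring.
Qed.

Lemma primitive_x (x x0 y : R) : x1 < x0 < x2 -> x1 < x < x2 -> 0 < y <= 2 ->
  (primitive (x, y) - primitive (x0, y))%C = CI (fun s => F (s, y)) x0 x.
Proof.
  intros H1 H2 H3. destruct (Rle_dec x0 x).
  - apply primitive_x_le; lra.
  - rewrite CI_swap by (apply cont_on_x; lra). rewrite <- primitive_x_le by lra. ring.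
Qed.

Lemma primitive_y (x y y0 : R) : x1 < x < x2 -> 0 < y -> 0 < y0 ->
  (primitive (x, y) - primitive (x, y0))%C = (Ci * CI (fun t => F (x, t)) y0 y)%C.
Proof.
  intros Hx Hy Hy0. unfold primitive; simpl.
  rewrite (CI_Chasles (fun t => F (x, t)) y0 y 2) by (apply cont_on_y; lra). ring.
Qed.

Lemma primitive_top (x y : R) : x1 < x < x2 -> 2 <= y -> primitive (x, y) = RtoC 0.
Proof.
  intros Hx Hy. unfold primitive; simpl.
  rewrite (CI_ext _ (fun _ => RtoC 0)), CI_const; [ring|].
  intros t. rewrite Rmin_right, Rmax_left by lra. intros. apply ZF; lra.
Qed.

Lemma primitive_x_all (x x0 y : R) : x1 < x0 < x2 -> x1 < x < x2 -> 0 < y ->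
  (primitive (x, y) - primitive (x0, y))%C = CI (fun s => F (s, y)) x0 x.
Proof.
  intros H1 H2 H3. destruct (Rle_dec y 2); [apply primitive_x; lra|].
  rewrite !primitive_top by lra.
  rewrite (CI_ext _ (fun _ => RtoC 0)), CI_const; [ring|].
  intros t Ht. apply ZF; [|lra]. unfold Rmin, Rmax in Ht. destruct Rle_dec; lra.
Qed.

Lemma primitive_eps (x0 y0 : R) : x1 < x0 < x2 -> 0 < y0 -> forall e, 0 < e -> exists d, 0 < d /\
  forall w, Cmod (w - (x0, y0)) < d ->
    Cmod (primitive w - primitive (x0, y0) - F (x0, y0) * (w - (x0, y0))) <= e * Cmod (w - (x0, y0)).
Proof.
  intros Hx Hy e He.
  destruct (proj1 (locally_Cmod _ _) (proj1 (contC_eps F (x0, y0)) (CF x0 y0 Hx Hy) (e / 2) ltac:(lra))) as [d [Hd H]].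
  set (d' := Rmin (d / 2) (Rmin y0 (Rmin (x0 - x1) (x2 - x0)))).
  assert (Hd' : 0 < d' /\ d' <= d / 2 /\ d' <= y0 /\ d' <= x0 - x1 /\ d' <= x2 - x0).
  { unfold d', Rmin. repeat destruct Rle_dec; lra. }
  exists d'. split; [lra|]. intros [x y] Hw.
  pose proof (re_le_Cmod ((x, y) - (x0, y0))) as Hre. pose proof (Im_le_Cmod ((x, y) - (x0, y0))) as Him.
  unfold Re, Im in Hre, Him; simpl in Hre, Him.
  set (D := Cmod ((x, y) - (x0, y0))) in *.
  pose proof (Rle_lt_trans _ _ _ Hre Hw) as H1. pose proof (Rle_lt_trans _ _ _ Him Hw) as H2.
  apply Rabs_lt_between in H1. apply Rabs_lt_between in H2.
  assert (Ew : (primitive (x, y) - primitive (x0, y0) - F (x0, y0) * ((x, y) - (x0, y0)))%C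
    = (CI (fun s => F (s, y) - F (x0, y0))%C x0 x + Ci * CI (fun t => F (x0, t) - F (x0, y0))%C y0 y)%C).
  { rewrite (CI_minus (fun s => F (s, y)) (fun _ => F (x0, y0))), (CI_minus (fun t => F (x0, t)) (fun _ => F (x0, y0))).
    - rewrite !CI_const. rewrite <- primitive_x_all by lra.
      replace ((x, y) - (x0, y0))%C with (RtoC (x - x0) + Ci * RtoC (y - y0))%C
        by (apply injective_projections; simpl; ring).
      replace (Ci * (CI (fun t => F (x0, t)) y0 y - RtoC (y - y0) * F (x0, y0)))%C
        with (Ci * CI (fun t => F (x0, t)) y0 y - Ci * RtoC (y - y0) * F (x0, y0))%C by ring.
      rewrite <- primitive_y by lra. ring.
    - apply cont_on_y; lra.
    - intros ? _; apply contC_const.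
    - apply cont_on_x; lra.
    - intros ? _; apply contC_const. }
  rewrite Ew.
  assert (B1 : Cmod (CI (fun s => F (s, y) - F (x0, y0))%C x0 x) <= Rabs (x - x0) * (e / 2)).
  { apply CI_bound_abs.
    - intros t Ht. apply contC_minus; [|apply contC_const]. apply (cont_on_x y x0 x); auto; lra.
    - intros t Ht. left. apply H. eapply Rle_lt_trans; [apply Cmod_le_Re_Im|]. unfold Re, Im; simpl.
      assert (Rabs (t + - x0) < d / 2) by (apply Rabs_lt_between; unfold Rmin, Rmax in Ht; destruct Rle_dec; lra).
      assert (Rabs (y + - y0) < d / 2) by (apply Rabs_lt_between; lra). lra. }
  assert (B2 : Cmod (CI (fun t => F (x0, t) - F (x0, y0))%C y0 y) <= Rabs (y - y0) * (e / 2)).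
  { apply CI_bound_abs.
    - intros t Ht. apply contC_minus; [|apply contC_const]. apply (cont_on_y x0 y0 y); auto; lra.
    - intros t Ht. left. apply H. eapply Rle_lt_trans; [apply Cmod_le_Re_Im|]. unfold Re, Im; simpl.
      assert (Rabs (t + - y0) < d / 2) by (apply Rabs_lt_between; unfold Rmin, Rmax in Ht; destruct Rle_dec; lra).
      rewrite Rplus_opp_r, Rabs_R0. lra. }
  eapply Rle_trans; [apply Cmod_triangle|]. rewrite Cmod_mult, Cmod_Ci, Rmult_1_l.
  unfold Rminus in *. nra.
Qed.

Lemma primitive_hol (x0 y0 : R) : x1 < x0 < x2 -> 0 < y0 -> hol primitive (x0, y0).
Proof. intros Hx Hy. apply (hol_eps _ _ (F (x0, y0))). now apply primitive_eps. Qed.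

(** Each step descends by [rho]. The disc of radius [3 rho/2] about the point [rho] higher lies in
    the half strip, as its centre has height at least [2 rho]; the primitive already vanishes on the
    segment going up from that centre, and the target lies inside the disc. *)
Lemma primitive_march (x0 y0 rho : R) : 0 < rho -> rho <= y0 -> x1 < x0 - 2 * rho -> x0 + 2 * rho < x2 ->
  forall n y, y0 <= y -> 2 - INR n * rho <= y -> primitive (x0, y) = RtoC 0.
Proof.
  intros Hr Hry Hl Hrr. induction n as [|n IH]; intros y Hy Hn.
  - simpl in Hn. apply primitive_top; lra.
  - rewrite S_INR in Hn.
    assert (Hin : forall w, Cmod (w - (x0, y + rho)%R) <= 3 / 2 * rho -> x1 < fst w < x2 /\ 0 < snd w).
    { intros [u v] Hw. pose proof (re_le_Cmod ((u, v) - (x0, (y + rho)%R))) as Hre.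
      pose proof (Im_le_Cmod ((u, v) - (x0, (y + rho)%R))) as Him.
      unfold Re, Im in Hre, Him; simpl in *.
      pose proof (Rle_trans _ _ _ Hre Hw) as H1. pose proof (Rle_trans _ _ _ Him Hw) as H2.
      apply Rabs_le_between in H1. apply Rabs_le_between in H2. lra. }
    apply (identity_segment_on primitive (x0, (y + rho)%R) (3 / 2 * rho) Ci 1); try lra.
    + intros [u v] Hw.
      assert (Hc : contCC primitive (u, v)).
      { apply hol_cont. destruct (Hin _ Hw). now apply primitive_hol. }
      intros P HP. specialize (Hc P HP). unfold filtermap, within in *.
      generalize Hc. apply filter_imp. auto.
    + intros [u v] Hw. apply hol_iff_ex_derive. destruct (Hin (u, v)); [left; exact Hw|]. now apply primitive_hol.
    + apply Cmod_Ci.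
    + intros t Ht _.
      replace ((x0, (y + rho)%R) + RtoC t * Ci)%C with ((x0, (y + rho + t)%R) : C)
        by (apply injective_projections; simpl; ring).
      apply IH; lra.
    + replace ((x0, y) - (x0, (y + rho)%R))%C with (RtoC (- rho) * Ci)%C
        by (apply injective_projections; simpl; ring).
      rewrite Cmod_mult, Cmod_R, Cmod_Ci, Rabs_left; lra.
Qed.

(** Marching down to height [y / 2] shows that the primitive vanishes around [(x, y)], and [F] is
    its derivative. Holomorphy of [F] itself is never established. *)
Lemma Morera_vanishing (x y : R) : x1 < x < x2 -> 0 < y -> F (x, y) = RtoC 0.
Proof.
  intros Hx Hy.
  assert (HP : forall v, y / 2 <= v -> primitive (x, v) = RtoC 0).
  { intros v Hv. set (rho := Rmin (y / 2) (Rmin ((x - x1) / 3) ((x2 - x) / 3))).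
    assert (Hrho : 0 < rho /\ rho <= y / 2 /\ rho <= (x - x1) / 3 /\ rho <= (x2 - x) / 3).
    { unfold rho, Rmin. repeat destruct Rle_dec; lra. }
    destruct (INR_archimed rho 2) as [n Hn]; [lra|].
    apply (primitive_march x (y / 2) rho) with (n := n); lra. }
  apply Cmod_eq_0. apply Rle_antisym; [|apply Cmod_ge_0].
  apply Rnot_lt_le. intros Hlt. set (X := Cmod (F (x, y))) in *.
  destruct (primitive_eps x y Hx Hy (X / 2) ltac:(lra)) as [d [Hd H]].
  specialize (H (x, y + d / 2)%R).
  replace ((x, (y + d / 2)%R) - (x, y))%C with (RtoC (d / 2) * Ci)%C in H
    by (apply injective_projections; simpl; ring).
  rewrite !HP in H by lra.
  replace (RtoC 0 - RtoC 0 - F (x, y) * (RtoC (d / 2) * Ci))%C with (- (F (x, y) * (RtoC (d / 2) * Ci)))%C in H by ring.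
  rewrite Cmod_opp, !Cmod_mult, Cmod_R, Cmod_Ci, Rabs_pos_eq in H by lra. fold X in H.
  specialize (H ltac:(lra)). nra.
Qed.
End Morera.

(** * One-parameter families of circles *)

Lemma rect_int_hol (g : C -> C) (a b c d : R) : a <= b -> c <= d ->
  (forall x y, a <= x <= b -> c <= y <= d -> hol g (x, y)) -> rect_int g a b c d = RtoC 0.
Proof.
  intros Hab Hcd Hg. unfold rect_int.
  rewrite (FI_ext _ _ (fun x y => (g (x, y) * RtoC 1)%C) (fun x y => (g (x, y) * Ci)%C)); auto.
  - apply (Goursat g (fun x y => (x, y) : C) (fun _ _ => RtoC 1) (fun _ _ => Ci) a b c d 1); auto.
    + intros x y _ _. exists (fun _ => RtoC 1). split; [apply contC_const|]. split; [reflexivity|].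
      intros s. apply injective_projections; simpl; ring.
    + intros x y _ _. exists (fun _ => Ci). split; [apply contC_const|]. split; [reflexivity|].
      intros s. apply injective_projections; simpl; ring.
    + intros x y _ _. split; apply contC_const.
    + intros x y _ _. rewrite Cmod_1, Cmod_Ci. lra.
  - intros x y _ _. split; ring.
Qed.

Lemma rect_int_CI (K : R * C -> C) (s u a b c d : R) : a <= b -> c <= d -> s <= u ->
  (forall p, @continuous (prod_UniformSpace R_UniformSpace C_UniformSpace) C_UniformSpace K p) ->
  rect_int (fun z => CI (fun t => K (t, z)) s u) a b c d
  = CI (fun t => rect_int (fun z => K (t, z)) a b c d) s u.
Proof.
  intros Hab Hcd Hsu HK.
  assert (Kx : forall y p, contC (fun p : R * R => K (snd p, (fst p, y))) p).
  { intros y [x t]. apply (continuous_comp_2 (V := R_UniformSpace) (W := C_UniformSpace) (X := C_UniformSpace)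
      (fun p : R * R => snd p) (fun p : R * R => (fst p, y) : C) (fun t z => K (t, z))).
    - apply continuous_snd.
    - apply contC_pair; [apply continuous_fst|apply continuous_const].
    - apply (continuous_ext K); [now intros []|apply HK]. }
  assert (Ky : forall x p, contC (fun p : R * R => (Ci * K (snd p, (x, fst p)))%C) p).
  { intros x [y t]. apply contC_mult; [apply contC_const|].
    apply (continuous_comp_2 (V := R_UniformSpace) (W := C_UniformSpace) (X := C_UniformSpace)
      (fun p : R * R => snd p) (fun p : R * R => (x, fst p) : C) (fun t z => K (t, z))).
    - apply continuous_snd.
    - apply contC_pair; [apply continuous_const|apply continuous_fst].
    - apply (continuous_ext K); [now intros []|apply HK]. }
  assert (Kz : forall z v w, cont_on (fun t => K (t, z)) v w).
  { intros z v w t _. apply (cont_slice_l (U := C_UniformSpace)). apply HK. }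
  unfold rect_int, FI.
  assert (Ex : forall y, CI (fun x => CI (fun t => K (t, (x, y))) s u) a b = CI (fun t => CI (fun x => K (t, (x, y))) a b) s u).
  { intros y. apply (Fubini_global (fun p : R * R => K (snd p, (fst p, y)))); auto. }
  assert (Ey : forall x, CI (fun y => (Ci * CI (fun t => K (t, (x, y))) s u)%C) c d = CI (fun t => CI (fun y => (Ci * K (t, (x, y)))%C) c d) s u).
  { intros x. rewrite <- (Fubini_global (fun p : R * R => (Ci * K (snd p, (x, fst p)))%C)); auto.
    apply CI_ext. intros y _. simpl. rewrite CI_mult_l; auto. }
  rewrite !Ex, !Ey.
  assert (c1 : forall y, cont_on (fun t => CI (fun x => K (t, (x, y))) a b) s u).
  { intros y t _. apply (contC_CI_param_any (fun p : R * R => K (snd p, (fst p, y)))). auto. }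
  assert (c2 : forall x, cont_on (fun t => CI (fun y => (Ci * K (t, (x, y)))%C) c d) s u).
  { intros x t _. apply (contC_CI_param_any (fun p : R * R => (Ci * K (snd p, (x, fst p)))%C)). auto. }
  assert (c3 : cont_on (fun t => (CI (fun x => K (t, (x, c))) a b + CI (fun y => Ci * K (t, (b, y)))%C c d)%C) s u).
  { intros t Ht. apply contC_plus; [now apply c1|now apply c2]. }
  rewrite <- CI_plus by auto. rewrite <- CI_minus by auto.
  rewrite <- CI_minus; auto.
  intros t Ht. apply contC_minus; [now apply c3|now apply c1].
Qed.

(** Rescaling to [[0, 1]] moves a variable lower limit into the integrand, where continuity in a
    parameter applies; [l > 1] is allowed. *)
Lemma CI_unit (f : R -> C) (l : R) : (forall t, contC f t) ->
  CI f l 1 = (RtoC (1 - l) * CI (fun t => f ((1 - l) * t + l)%R) 0 1)%C.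
Proof.
  intros Hf.
  assert (c : cont_on (fun t => f ((1 - l) * t + l)) 0 1).
  { intros t _. apply (contC_compR f); [|apply Hf].
    apply contR_plus; [|apply continuous_const].
    apply contR_mult; [apply continuous_const|apply continuous_id]. }
  rewrite <- CI_mult_l by exact c.
  symmetry. apply CI_unique.
  assert (H : is_RInt (V := C_R_NormedModule) f ((1 - l) * 0 + l) ((1 - l) * 1 + l) (CI f l 1)).
  { replace ((1 - l) * 0 + l) with l by ring. replace ((1 - l) * 1 + l) with 1 by ring.
    apply CI_is. intros t _. apply Hf. }
  apply (is_RInt_comp_lin (V := C_R_NormedModule)) in H.
  eapply (is_RInt_ext (V := C_R_NormedModule)); [|exact H].
  intros t _. simpl. apply injective_projections; simpl; unfold scal; simpl; unfold mult; simpl; ring.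
Qed.

Lemma contC_CI_lower (K : R * C -> C) (l : C -> R) (z0 : C) :
  (forall p, @continuous (prod_UniformSpace R_UniformSpace C_UniformSpace) C_UniformSpace K p) ->
  @continuous C_UniformSpace R_UniformSpace l z0 ->
  contCC (fun z => CI (fun t => K (t, z)) (l z) 1) z0.
Proof.
  intros HK Hl.
  set (UU := prod_UniformSpace R_UniformSpace C_UniformSpace).
  set (J := fun p : UU => (RtoC (1 - fst p) * CI (fun t => K ((1 - fst p) * t + fst p, snd p)%R) 0 1)%C).
  apply (continuous_ext (T := C_UniformSpace) (U := C_UniformSpace) (fun z => J (l z, z))).
  { intros z. unfold J; simpl. symmetry. apply (CI_unit (fun t => K (t, z))).
    intros t. apply (cont_slice_l (U := C_UniformSpace)). apply HK. }
  apply (continuous_comp_2 (V := R_UniformSpace) (W := C_UniformSpace) (X := C_UniformSpace)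
    l (fun z => z) (fun u z => J (u, z)) z0 Hl); [apply contC_id|].
  apply (continuous_ext (T := UU) J); [now intros []|].
  unfold J. apply contC_mult.
  - apply (contC_RtoC (U := UU)). apply (contR_minus (U := UU)); [apply continuous_const|apply continuous_fst].
  - apply (contC_CI_param_any (U := UU) (fun q : R * UU => K ((1 - fst (snd q)) * fst q + fst (snd q), snd (snd q))%R)).
    intros q.
    set (VV := prod_UniformSpace R_UniformSpace UU).
    assert (f1 : @continuous VV R_UniformSpace (fun q => fst (snd q)) q).
    { apply (continuous_comp (U := VV) (V := UU) (W := R_UniformSpace) snd fst).
      - destruct q. apply continuous_snd.
      - destruct q as [? []]. apply continuous_fst. }
    assert (f2 : @continuous VV C_UniformSpace (fun q => snd (snd q)) q).
    { apply (continuous_comp (U := VV) (V := UU) (W := C_UniformSpace) snd snd).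
      - destruct q. apply continuous_snd.
      - destruct q as [? []]. apply continuous_snd. }
    assert (f3 : @continuous VV R_UniformSpace (fun q => fst q) q) by (destruct q; apply continuous_fst).
    apply (continuous_comp_2 (U := VV) (V := R_UniformSpace) (W := C_UniformSpace) (X := C_UniformSpace)
      (fun q => (1 - fst (snd q)) * fst q + fst (snd q)) (fun q => snd (snd q)) (fun t z => K (t, z))).
    + apply (contR_plus (U := VV)); [|exact f1]. apply (contR_mult (U := VV)); [|exact f3].
      apply (contR_minus (U := VV)); [apply continuous_const|exact f1].
    + exact f2.
    + apply (continuous_ext (T := UU) K); [now intros []|apply HK].
Qed.

(** Retraction onto the closed upper half plane, where the denominators [Lden] have no zero; it
    makes the kernels continuous everywhere. *)
Definition upper (z : C) : C := (Re z, Rmax 0 (Im z)).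

Lemma upper_id (z : C) : 0 <= Im z -> upper z = z.
Proof. intros H. unfold upper. rewrite Rmax_right by exact H. now destruct z. Qed.

Lemma upper_Im (z : C) : 0 <= Im (upper z).
Proof. apply Rmax_l. Qed.

Lemma upper_cont (z : C) : contCC upper z.
Proof.
  apply contC_pair.
  - apply (contC_Re (fun z => z)), contC_id.
  - apply contR_max; [apply continuous_const|]. apply (contC_Im (fun z => z)), contC_id.
Qed.

(* With [w = c + rho^2/(z - c)], the value of [conj z] on the circle, [(z - c)(w - a) = Lden]. *)
Definition Lden (a : C) (c rho : R) (z : C) : C := ((RtoC c - a) * (z - RtoC c) + RtoC (rho * rho))%C.

(** Inversion in a circle with real centre followed by conjugation maps the closed upper half plane
    to the closed lower one, so [w] never equals [a]; at [z = c] only [rho^2] is left. *)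
Lemma Lden_neq_0 (a : C) (c rho : R) (z : C) : 0 < Im a -> 0 < rho -> 0 <= Im z -> Lden a c rho z <> RtoC 0.
Proof.
  intros Ha Hr Hz E. destruct a as [p y], z as [X Y]. unfold Im in *; simpl in *.
  pose proof (f_equal fst E) as E1. pose proof (f_equal snd E) as E2. unfold Lden in *; simpl in *.
  assert (0 < rho * rho) by nra.
  (* The imaginary part of [Lden] multiplied by the conjugate of [c - a]. *)
  assert (Q : Y * (y * y + (c - p) * (c - p)) + y * (rho * rho) = 0).
  { replace (Y * (y * y + (c - p) * (c - p)) + y * (rho * rho)) with
     (y * ((c + - p) * (X + - c) - (0 + - y) * (Y + - 0) + rho * rho) + (c - p) * ((c + - p) * (Y + - 0) + (0 + - y) * (X + - c) + 0)) by ring.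
    rewrite E1, E2. ring. }
  assert (0 <= Y * (y * y + (c - p) * (c - p))).
  { apply Rmult_le_pos; [exact Hz|]. apply Rplus_le_le_0_compat; apply Rle_0_sqr. }
  assert (0 < y * (rho * rho)) by now apply Rmult_lt_0_compat.
  lra.
Qed.

Lemma cont_Lden {U : UniformSpace} (a : C) (c rho : U -> R) (z : U -> C) (u : U) :
  continuous c u -> continuous rho u -> contC z u -> contC (fun u => Lden a (c u) (rho u) (z u)) u.
Proof.
  intros Hc Hr Hz. pose proof (contC_RtoC _ _ Hc). unfold Lden.
  apply contC_plus; [apply contC_mult; apply contC_minus; try assumption; apply contC_const|].
  apply contC_RtoC. now apply contR_mult.
Qed.

(* A one-parameter family of circles with real centres [cn s] and radii [rho s], [m <= s <= 1],
   with the extensions [G s]; [sg z] is the parameter of the circle through [z].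
   Differentiating [-1/(w - a)] in [s] gives [n z / Lden^2]. *)
Record circle_family (f : C -> C) (cn rho : R -> R) (m : R) (G : R -> C -> C) (n : C -> C) (sg : C -> R) (x1 x2 : R) : Prop := {
  fam_m : m < 1;
  fam_cn : forall s, continuous cn s;
  fam_rho : forall s, continuous rho s;
  fam_rho_pos : forall s, m <= s <= 1 -> 0 < rho s;
  fam_cn_1 : cn 1 = 0;
  fam_rho_1 : rho 1 = 1;
  fam_G_cont : forall s z, m <= s <= 1 -> contCC (G s) z;
  fam_G_hol : forall s, m <= s <= 1 -> holomorphic_on (open_disc (RtoC (cn s)) (rho s)) (G s);
  fam_G_eq : forall s z, m <= s <= 1 -> circle (RtoC (cn s)) (rho s) z -> G s z = f z;
  fam_n : forall z, hol n z;
  fam_V : forall a z s, 0 < Im a -> 0 <= Im z -> m <= s <= 1 ->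
    dcurve (fun s => - ((z - RtoC (cn s)) / Lden a (cn s) (rho s) z))%C s
      (n z / (Lden a (cn s) (rho s) z * Lden a (cn s) (rho s) z));
  fam_sg_min : forall z, x1 < Re z < x2 -> m <= sg z;
  fam_sg_circle : forall z, x1 < Re z < x2 -> sg z <= 1 -> circle (RtoC (cn (sg z))) (rho (sg z)) z;
  fam_sg_disc : forall z s, x1 < Re z < x2 -> sg z < s <= 1 -> open_disc (RtoC (cn s)) (rho s) z;
  fam_sg_lip : forall z0, x1 < Re z0 < x2 -> exists L d, 0 < L /\ 0 < d /\
    forall z, Cmod (z - z0) < d -> Rabs (sg z - sg z0) <= L * Cmod (z - z0)
}.

Arguments fam_m {_ _ _ _ _ _ _ _ _}.
Arguments fam_cn {_ _ _ _ _ _ _ _ _}.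
Arguments fam_rho {_ _ _ _ _ _ _ _ _}.
Arguments fam_rho_pos {_ _ _ _ _ _ _ _ _}.
Arguments fam_cn_1 {_ _ _ _ _ _ _ _ _}.
Arguments fam_rho_1 {_ _ _ _ _ _ _ _ _}.
Arguments fam_G_cont {_ _ _ _ _ _ _ _ _}.
Arguments fam_G_hol {_ _ _ _ _ _ _ _ _}.
Arguments fam_G_eq {_ _ _ _ _ _ _ _ _}.
Arguments fam_n {_ _ _ _ _ _ _ _ _}.
Arguments fam_V {_ _ _ _ _ _ _ _ _}.
Arguments fam_sg_min {_ _ _ _ _ _ _ _ _}.
Arguments fam_sg_circle {_ _ _ _ _ _ _ _ _}.
Arguments fam_sg_disc {_ _ _ _ _ _ _ _ _}.
Arguments fam_sg_lip {_ _ _ _ _ _ _ _ _}.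

Section Family.
Variables (f : C -> C) (cn rho : R -> R) (m : R) (G : R -> C -> C) (n : C -> C) (sg : C -> R) (x1 x2 : R).
Hypothesis Cf : forall z, contCC f z.
Hypothesis Fam : circle_family f cn rho m G n sg x1 x2.
Let UU := prod_UniformSpace R_UniformSpace C_UniformSpace.

(** Clamping the parameter and retracting the point make the family of extensions a function on the
    whole product. *)
Definition ext_fam (s : R) (z : C) : C :=
  G (clamp m 1 s) (retract (RtoC (cn (clamp m 1 s))) (rho (clamp m 1 s)) z).

Lemma clamp_m (s : R) : m <= clamp m 1 s <= 1.
Proof. apply clamp_in. pose proof (fam_m Fam). lra. Qed.

(** The extensions are chosen separately for each [s], yet they depend continuously on it: carried
    to the unit disc, two of them differ by at most their difference on the boundary, where both are
    values of [f] and are uniformly close by [tube]. *)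
Lemma ext_fam_cont (p : UU) : @continuous UU C_UniformSpace (fun p => ext_fam (fst p) (snd p)) p.
Proof.
  destruct p as [s0 z0].
  set (cc := fun s => RtoC (cn (clamp m 1 s))). set (rr := fun s => rho (clamp m 1 s)).
  assert (rpos : forall s, 0 < rr s) by (intros s; apply (fam_rho_pos Fam), clamp_m).
  assert (rrc : forall (V : UniformSpace) (h : V -> R) v, continuous h v -> continuous (fun v => rr (h v)) v).
  { intros V h v Hh. apply (continuous_comp (fun v => clamp m 1 (h v)) rho); [now apply cont_clamp|apply (fam_rho Fam)]. }
  assert (ccc : forall (V : UniformSpace) (h : V -> R) v, continuous h v -> contC (fun v => cc (h v)) v).
  { intros V h v Hh. apply contC_RtoC. apply (continuous_comp (fun v => clamp m 1 (h v)) cn); [now apply cont_clamp|apply (fam_cn Fam)]. }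
  (* The coordinate of the retracted point in the unit disc, where extensions from different circles
     can be compared. *)
  set (zeta := fun p : UU => ((retract (cc (fst p)) (rr (fst p)) (snd p) - cc (fst p)) / RtoC (rr (fst p)))%C).
  set (G0 := G (clamp m 1 s0)).
  assert (G0c : forall z, contCC G0 z)
    by (intros; apply (fam_G_cont Fam), clamp_m).
  assert (rn0 : forall s, RtoC (rr s) <> RtoC 0) by (intros s; apply RtoC_neq_0; specialize (rpos s); lra).
  assert (zin : forall p, Cmod (zeta p) <= 1).
  { intros p. unfold zeta. rewrite Cmod_div by apply rn0. specialize (rpos (fst p)).
    rewrite Cmod_R, Rabs_pos_eq by lra. apply (Rmult_le_reg_r (rr (fst p))); [lra|].
    unfold Rdiv. rewrite Rmult_assoc, Rinv_l, Rmult_1_r, Rmult_1_l by lra. now apply retract_in. }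
  assert (Eext : forall p, ext_fam (fst p) (snd p) = G (clamp m 1 (fst p)) (cc (fst p) + RtoC (rr (fst p)) * zeta p)%C).
  { intros p. unfold zeta.
    change (ext_fam (fst p) (snd p)) with (G (clamp m 1 (fst p)) (retract (cc (fst p)) (rr (fst p)) (snd p))).
    f_equal. enough (Q : forall u v w : C, v <> RtoC 0 -> w = (u + v * ((w - u) / v))%C) by (apply Q, rn0).
    intros; field; assumption. }
  assert (zc : @continuous UU C_UniformSpace zeta (s0, z0)).
  { assert (h1 : @continuous UU R_UniformSpace (fun p => fst p) (s0, z0)) by apply continuous_fst.
    unfold zeta. apply contC_div; [|apply contC_RtoC, rrc; exact h1|apply rn0].
    apply contC_minus; [|apply ccc; exact h1].
    apply (retract_cont_gen (U := UU) (fun p => cc (fst p)) (fun p => snd p) (fun p => rr (fst p))).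
    - apply ccc; exact h1. - apply continuous_snd. - apply rrc; exact h1. - apply rpos. }
  apply contC_eps. intros e He.
  assert (H1 : locally (s0, z0) (fun p : UU => Cmod (G0 (cc s0 + RtoC (rr s0) * zeta p)%C - G0 (cc s0 + RtoC (rr s0) * zeta (s0, z0))%C) < e / 2)).
  { apply (proj1 (contC_eps (U := UU) (fun p => G0 (cc s0 + RtoC (rr s0) * zeta p)%C) (s0, z0))); [|lra].
    apply (contC_comp (U := UU) G0); [|apply G0c]. apply contC_plus; [apply contC_const|].
    apply contC_mult; [apply contC_const|exact zc]. }
  assert (H2 : locally s0 (fun s => forall t, 0 <= t <= 2 * PI ->
     Cmod (f (cc s + RtoC (rr s) * cis t) - f (cc s0 + RtoC (rr s0) * cis t)) < e / 2)).
  { apply (tube (fun p : R * R => f (cc (snd p) + RtoC (rr (snd p)) * cis (fst p))%C)); [|lra].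
    intros t _. apply (contC_comp f); [|apply Cf].
    apply contC_plus; [apply ccc, continuous_snd|]. apply contC_mult; [apply contC_RtoC, rrc, continuous_snd|].
    apply cont_cis_comp, continuous_fst. }
  assert (H2' : locally (s0, z0) (fun p : UU => forall t, 0 <= t <= 2 * PI ->
     Cmod (f (cc (fst p) + RtoC (rr (fst p)) * cis t) - f (cc s0 + RtoC (rr s0) * cis t)) < e / 2)).
  { apply (continuous_fst (U := R_UniformSpace) (V := C_UniformSpace) s0 z0 _ H2). }
  generalize (filter_and _ _ H1 H2'). apply filter_imp. intros p [A B].
  rewrite !Eext. simpl fst. fold G0.
  set (s := fst p) in *. set (g := G (clamp m 1 s)).
  assert (gc : forall z, contCC g z)
    by (intros; apply (fam_G_cont Fam), clamp_m).
  assert (Q : Cmod (g (cc s + RtoC (rr s) * zeta p)%C - G0 (cc s0 + RtoC (rr s0) * zeta p)%C) <= e / 2).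
  { apply (maximum_principle (fun w => g (cc s + RtoC (rr s) * w)%C - G0 (cc s0 + RtoC (rr s0) * w)%C)%C 0 1); try lra.
    - intros w. apply contC_minus; [apply (contC_comp g); [|apply gc]|apply (contC_comp G0); [|apply G0c]];
        (apply contC_plus; [apply contC_const|apply contC_mult; [apply contC_const|apply contC_id]]).
    - intros w Hw. unfold open_disc in Hw. replace (w - RtoC 0)%C with w in Hw by ring.
      assert (K : forall v, open_disc (cc v) (rr v) (cc v + RtoC (rr v) * w)%C).
      { intros v. unfold open_disc. replace (cc v + RtoC (rr v) * w - cc v)%C with (RtoC (rr v) * w)%C by ring.
        specialize (rpos v). rewrite Cmod_mult, Cmod_R, Rabs_pos_eq by lra. nra. }
      assert (KL : forall v, hol (fun w => (cc v + RtoC (rr v) * w)%C) w).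
      { intros v. apply hol_plus; [apply hol_const|]. apply hol_mult; [apply hol_const|apply hol_id]. }
      apply hol_iff_ex_derive. apply hol_minus.
      + apply (hol_comp g (fun w => (cc s + RtoC (rr s) * w)%C)); [apply KL|].
        apply hol_iff_ex_derive. apply (fam_G_hol Fam); [apply clamp_m|apply K].
      + apply (hol_comp G0 (fun w => (cc s0 + RtoC (rr s0) * w)%C)); [apply KL|].
        apply hol_iff_ex_derive. apply (fam_G_hol Fam); [apply clamp_m|apply K].
    - intros t Ht. replace (RtoC 0 + RtoC 1 * cis t)%C with (cis t) by ring.
      assert (K : forall v, circle (cc v) (rr v) (cc v + RtoC (rr v) * cis t)%C).
      { intros v. unfold circle. replace (cc v + RtoC (rr v) * cis t - cc v)%C with (RtoC (rr v) * cis t)%C by ring.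
        specialize (rpos v). rewrite Cmod_mult, Cmod_R, Cmod_cis, Rabs_pos_eq by lra. ring. }
      unfold g, G0. rewrite !(fam_G_eq Fam) by (try apply clamp_m; apply K).
      left. now apply B.
    - replace (zeta p - RtoC 0)%C with (zeta p) by ring. apply zin. }
  pose proof (Cmod_triangle_sub (g (cc s + RtoC (rr s) * zeta p)%C) (G0 (cc s0 + RtoC (rr s0) * zeta p)%C)
    (G0 (cc s0 + RtoC (rr s0) * zeta (s0, z0))%C)) as T.
  eapply Rle_lt_trans; [exact T|lra].
Qed.

Variable a : C.
Hypothesis Ha : 0 < Im a.

Definition fam_den (s : R) (z : C) : C := Lden a (cn (clamp m 1 s)) (rho (clamp m 1 s)) (upper z).
Definition fam_ker (s : R) (z : C) : C := (n (upper z) / (fam_den s z * fam_den s z))%C.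

Lemma fam_den_neq_0 (s : R) (z : C) : fam_den s z <> RtoC 0.
Proof.
  apply Lden_neq_0; [exact Ha| |apply upper_Im]. apply (fam_rho_pos Fam), clamp_m.
Qed.

Lemma fam_ker_cont (p : UU) : @continuous UU C_UniformSpace (fun p => fam_ker (fst p) (snd p)) p.
Proof.
  assert (h1 : @continuous UU R_UniformSpace (fun p => fst p) p) by (destruct p; apply continuous_fst).
  assert (h2 : @continuous UU C_UniformSpace (fun p => upper (snd p)) p).
  { apply (contC_comp (U := UU) upper); [destruct p; apply continuous_snd|apply upper_cont]. }
  assert (hd : @continuous UU C_UniformSpace (fun p => fam_den (fst p) (snd p)) p).
  { apply (cont_Lden (U := UU)); [| |exact h2].
    - apply (continuous_comp (U := UU) (fun v => clamp m 1 (fst v)) cn); [now apply (cont_clamp (U := UU))|apply (fam_cn Fam)].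
    - apply (continuous_comp (U := UU) (fun v => clamp m 1 (fst v)) rho); [now apply (cont_clamp (U := UU))|apply (fam_rho Fam)]. }
  unfold fam_ker. apply (contC_div (U := UU)).
  - apply (contC_comp (U := UU) n); [exact h2|]. apply hol_cont, (fam_n Fam).
  - now apply (contC_mult (U := UU)).
  - apply Cmult_neq_0; apply fam_den_neq_0.
Qed.

(** The final identity has [kappa = 0]; local estimates at [z0] take [kappa = f z0], which makes the
    integrand vanish at [(sg z0, z0)]. *)
Definition fam_int (kappa : C) (p : R * C) : C := ((ext_fam (fst p) (snd p) - kappa) * fam_ker (fst p) (snd p))%C.

Lemma fam_int_cont (kappa : C) (p : UU) : @continuous UU C_UniformSpace (fam_int kappa) p.
Proof.
  apply (contC_mult (U := UU)); [|apply fam_ker_cont].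
  apply (contC_minus (U := UU)); [apply ext_fam_cont|apply contC_const].
Qed.

(** Cutting at [1], the parameter of the unit circle, encodes the extension by [0]: beyond it the
    integral is over a point. *)
Definition low (z : C) : R := Rmin 1 (sg z).
Definition Phi (kappa : C) (z : C) : C := CI (fun s => fam_int kappa (s, z)) (low z) 1.

Lemma sg_cont (z : C) : x1 < Re z < x2 -> @continuous C_UniformSpace R_UniformSpace sg z.
Proof.
  intros Hz. destruct (fam_sg_lip Fam z Hz) as (L & d & HL & Hd & H).
  apply contR_eps. intros e He. apply locally_Cmod.
  exists (Rmin d (e / L)). assert (0 < e / L) by (apply Rdiv_lt_0_compat; lra).
  split; [unfold Rmin; destruct Rle_dec; lra|]. intros w Hw.
  assert (Cmod (w - z) < d /\ Cmod (w - z) < e / L) as [W1 W2] by (unfold Rmin in Hw; destruct Rle_dec; lra).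
  eapply Rle_lt_trans; [now apply H|].
  apply (Rmult_lt_compat_l L) in W2; [|lra]. replace (L * (e / L)) with e in W2 by (field; lra). exact W2.
Qed.

Lemma Phi_cont (kappa z : C) : x1 < Re z < x2 -> contCC (Phi kappa) z.
Proof.
  intros Hz. apply (contC_CI_lower (fam_int kappa) low); [apply fam_int_cont|].
  apply (contR_min (U := C_UniformSpace)); [apply continuous_const|now apply sg_cont].
Qed.

Lemma Phi_outside (kappa z : C) : 1 <= sg z -> Phi kappa z = RtoC 0.
Proof. intros H. unfold Phi, low. rewrite Rmin_left by exact H. apply CI_point. Qed.

Lemma slice_cont (K : R * C -> C) (z : C) (u v : R) :
  (forall p : UU, @continuous UU C_UniformSpace K p) -> cont_on (fun s => K (s, z)) u v.
Proof. intros HK t _. apply (cont_slice_l (U := C_UniformSpace)). apply HK. Qed.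

Lemma ker_slice_cont (z : C) (u v : R) : cont_on (fun s => fam_ker s z) u v.
Proof. apply (slice_cont (fun p => fam_ker (fst p) (snd p))). apply fam_ker_cont. Qed.

Lemma Phi_split (kappa z : C) : Phi (RtoC 0) z = (Phi kappa z + kappa * CI (fun s => fam_ker s z) (low z) 1)%C.
Proof.
  unfold Phi. rewrite <- CI_mult_l by apply ker_slice_cont. rewrite <- CI_plus.
  - apply CI_ext. intros s _. unfold fam_int; simpl. ring.
  - apply slice_cont, fam_int_cont.
  - intros t Ht. apply contC_mult; [apply contC_const|]. now apply (ker_slice_cont z (low z) 1).
Qed.

Lemma ext_fam_diag (z : C) : x1 < Re z < x2 -> sg z <= 1 -> ext_fam (sg z) z = f z.
Proof.
  intros Hz H1. pose proof (fam_sg_min Fam z Hz) as Hm.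
  pose proof (fam_sg_circle Fam z Hz H1) as Hc.
  unfold ext_fam. rewrite clamp_id by lra. rewrite retract_id.
  - apply (fam_G_eq Fam); [lra|exact Hc].
  - apply (fam_rho_pos Fam). lra.
  - unfold circle in Hc. lra.
Qed.

(** The kernel has the primitive [-1/(w - a)]. At [s = sg z] the circle passes through [z], so
    [w = conj z]; at [s = 1] it is the unit circle, so [w = 1/z]. The value is therefore the same
    for every family. *)
Lemma ker_integral (z : C) : x1 < Re z < x2 -> 0 <= Im z -> sg z <= 1 ->
  CI (fun s => fam_ker s z) (low z) 1 = (- (z / (RtoC 1 - a * z)) + / (Cconj z - a))%C.
Proof.
  intros Hz Hi H1. pose proof (fam_sg_min Fam z Hz) as Hm.
  pose proof (fam_sg_circle Fam z Hz H1) as Hc.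
  assert (El : low z = sg z) by (unfold low; now rewrite Rmin_right).
  rewrite (CI_derive (fun s => - ((z - RtoC (cn s)) / Lden a (cn s) (rho s) z))%C).
  - rewrite El, (fam_cn_1 Fam), (fam_rho_1 Fam).
    set (c := cn (sg z)) in *. set (r := rho (sg z)) in *.
    assert (r0 : 0 < r) by (apply (fam_rho_pos Fam); lra).
    pose proof (Lden_neq_0 a 0 1 z Ha Rlt_0_1 Hi) as N1.
    pose proof (Lden_neq_0 a c r z Ha r0 Hi) as N2.
    assert (E1 : Lden a 0 1 z = (RtoC 1 - a * z)%C).
    { unfold Lden. rewrite Rmult_1_r. ring. }
    assert (E2 : Lden a c r z = ((z - RtoC c) * (Cconj z - a))%C).
    { unfold Lden. rewrite <- Hc. replace (Cmod (z - RtoC c) * Cmod (z - RtoC c)) with (Cmod (z - RtoC c) ^ 2) by ring.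
      rewrite Cmod2_conj.
      replace (Cconj (z - RtoC c)) with (Cconj z - RtoC c)%C by (apply injective_projections; simpl; ring).
      cbv beta. ring. }
    rewrite E1 in *. rewrite E2 in *.
    assert (N3 : (z - RtoC c)%C <> RtoC 0) by (intros E; apply N2; rewrite E; ring).
    assert (N4 : (Cconj z - a)%C <> RtoC 0) by (intros E; apply N2; rewrite E; ring).
    field. repeat split; assumption.
  - intros t Ht. rewrite El, Rmin_left, Rmax_right in Ht by assumption.
    unfold fam_ker, fam_den. rewrite clamp_id by lra. rewrite upper_id by exact Hi.
    apply (fam_V Fam); auto. lra.
  - apply ker_slice_cont.
Qed.

Lemma fam_int_hol (kappa z : C) (s : R) : x1 < Re z < x2 -> 0 < Im z -> sg z < s <= 1 ->
  hol (fun w => fam_int kappa (s, w)) z.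
Proof.
  intros Hz Hi Hs. pose proof (fam_sg_min Fam z Hz) as Hm.
  assert (Ec : clamp m 1 s = s) by (apply clamp_id; lra).
  unfold fam_int; simpl. apply hol_mult; [apply hol_minus; [|apply hol_const]|].
  - unfold ext_fam. rewrite Ec. apply hol_iff_ex_derive.
    apply (hol_retract (G s)).
    + apply (fam_rho_pos Fam). lra.
    + apply (fam_G_hol Fam). lra.
    + now apply (fam_sg_disc Fam).
  - assert (Hden : Lden a (cn s) (rho s) z <> RtoC 0).
    { apply Lden_neq_0; [exact Ha| |lra]. apply (fam_rho_pos Fam). lra. }
    assert (HL : hol (Lden a (cn s) (rho s)) z).
    { apply hol_plus; [|apply hol_const]. apply hol_mult; [apply hol_const|].
      apply hol_minus; [apply hol_id|apply hol_const]. }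
    apply (hol_ext_loc (fun z => n z / (Lden a (cn s) (rho s) z * Lden a (cn s) (rho s) z))%C).
    + apply locally_Cmod. exists (Im z). split; [exact Hi|]. intros w Hw.
      unfold fam_ker, fam_den. rewrite Ec, upper_id; [reflexivity|].
      pose proof (Im_le_Cmod (w - z)) as Hb. unfold Im in *; simpl in Hb.
      pose proof (Rle_lt_trans _ _ _ Hb Hw) as Hb'. apply Rabs_lt_between in Hb'. lra.
    + apply hol_div; [apply (fam_n Fam)|now apply hol_mult|now apply Cmult_neq_0].
Qed.

Lemma rect_int_point (F : C -> C) (x y : R) : rect_int F x x y y = RtoC 0.
Proof. unfold rect_int, FI. rewrite !CI_point. ring. Qed.

Lemma rect_cont (F : C -> C) (b1 b2 c d : R) : x1 < b1 -> b2 < x2 ->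
  (forall z, x1 < Re z < x2 -> contCC F z) ->
  form_cont (fun x y => F (x, y)) (fun x y => (Ci * F (x, y))%C) b1 b2 c d.
Proof.
  intros H1 H2 HF x y Hx Hy. split.
  - apply cont_line_x, HF. simpl; lra.
  - apply contC_mult; [apply contC_const|]. apply cont_line_y, HF. simpl; lra.
Qed.

(** Circles that contain the whole rectangle strictly inside give holomorphic integrands, with zero
    boundary integral. The other parameters form an interval of length of order [D], on which the
    integrand is small because it vanishes at [(sg z0, z0)]. *)
Lemma Phi_local (x0 y0 : R) : x1 < x0 < x2 -> 0 < y0 -> sg (x0, y0) <= 1 ->
  forall e, 0 < e -> exists eta, 0 < eta /\
  forall b1 b2 c d, x1 < b1 <= x0 -> x0 <= b2 < x2 -> 0 < c <= y0 -> y0 <= d ->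
    (b2 - b1) + (d - c) < eta ->
    Cmod (rect_int (Phi (f (x0, y0))) b1 b2 c d) <= e * ((b2 - b1) + (d - c)) ^ 2.
Proof.
  intros Hx Hy H1 e He. set (z0 := (x0, y0) : C) in *. set (kappa := f z0).
  pose proof (fam_sg_min Fam z0 Hx) as Hm.
  destruct (fam_sg_lip Fam z0 Hx) as (L & dl & HL & Hdl & Hlip).
  assert (K0 : fam_int kappa (sg z0, z0) = RtoC 0).
  { unfold fam_int; simpl. rewrite ext_fam_diag by assumption. unfold kappa. ring. }
  (* The leftover integral is at most [3 L D e'], and the boundary integral adds the factor
     [2 D]. *)
  set (e' := e / (6 * L)). assert (He' : 0 < e') by (apply Rdiv_lt_0_compat; lra).
  destruct (proj1 (contC_eps (U := UU) (fam_int kappa) (sg z0, z0)) (fam_int_cont kappa _) e' He') as [d1 Hd1].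
  assert (Hloc : @locally C_UniformSpace z0 (fun w => ball z0 d1 w)) by (exists d1; auto).
  apply locally_Cmod in Hloc. destruct Hloc as (d2 & Hd2 & Hball).
  pose proof (cond_pos d1) as Hd1p.
  exists (Rmin dl (Rmin d2 (d1 / (2 * L)))).
  assert (Hq : 0 < d1 / (2 * L)) by (apply Rdiv_lt_0_compat; lra).
  split; [unfold Rmin; repeat destruct Rle_dec; lra|].
  intros b1 b2 c d B1 B2 C1 D1 HD. set (D := b2 - b1 + (d - c)) in *.
  assert (D < dl /\ D < d2 /\ D < d1 / (2 * L)) as (W1 & W2 & W3) by (unfold Rmin in HD; repeat destruct Rle_dec; lra).
  assert (W4 : 2 * L * D < d1).
  { apply (Rmult_lt_compat_l (2 * L)) in W3; [|lra]. replace (2 * L * (d1 / (2 * L))) with (d1 : R) in W3 by (field; lra). exact W3. }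
  (* The margin chosen below puts points strictly inside the circles only if [D] is positive. *)
  destruct (Req_dec D 0) as [D0|D0].
  { assert (b1 = x0 /\ b2 = x0 /\ c = y0 /\ d = y0) as (-> & -> & -> & ->) by (unfold D in D0; lra).
    rewrite rect_int_point, Cmod_0. unfold D in *. rewrite D0. lra. }
  assert (Dp : 0 < D) by (unfold D in *; lra).
  (* On the rectangle [sg] stays below [sg z0 + L D], so circles with parameter at least
     [sg z0 + 2 L D] contain it strictly; if the minimum is [1], the integral [P2] is over a
     point. *)
  set (s1 := Rmin 1 (sg z0 + 2 * L * D)).
  assert (HLD : 0 < L * D) by (apply Rmult_lt_0_compat; lra).
  assert (Hnear : forall x y, b1 <= x <= b2 -> c <= y <= d -> Cmod ((x, y) - z0) <= D).
  { intros x y X Y. eapply Rle_trans; [apply Cmod_le_Re_Im|]. unfold Re, Im; simpl.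
    assert (Rabs (x + - x0) <= b2 - b1) by (apply Rabs_le; lra).
    assert (Rabs (y + - y0) <= d - c) by (apply Rabs_le; lra). unfold D. lra. }
  assert (Hsg : forall x y, b1 <= x <= b2 -> c <= y <= d -> sg z0 - L * D <= sg (x, y) <= sg z0 + L * D).
  { intros x y X Y. pose proof (Hnear x y X Y) as Hn.
    specialize (Hlip (x, y) ltac:(lra)). assert (L * Cmod ((x, y) - z0) <= L * D) by (apply Rmult_le_compat_l; lra).
    assert (Hab : Rabs (sg (x, y) - sg z0) <= L * D) by lra. apply Rabs_le_between in Hab. lra. }
  assert (Hlow : forall x y, b1 <= x <= b2 -> c <= y <= d -> sg z0 - L * D <= low (x, y) <= s1 /\ s1 - low (x, y) <= 3 * L * D).
  { intros x y X Y. specialize (Hsg x y X Y). unfold low, s1, Rmin. repeat destruct Rle_dec; lra. }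
  assert (Hs1 : s1 <= 1) by apply Rmin_l.
  set (P2 := fun z => CI (fun s => fam_int kappa (s, z)) s1 1).
  assert (cP2 : forall z, x1 < Re z < x2 -> contCC P2 z).
  { intros z _. apply (contC_CI_lower (fam_int kappa) (fun _ => s1)); [apply fam_int_cont|apply continuous_const]. }
  assert (E2 : rect_int P2 b1 b2 c d = RtoC 0).
  { unfold P2. rewrite rect_int_CI by (try lra; apply fam_int_cont).
    destruct (Rle_dec 1 s1) as [Hge|Hlt].
    - replace s1 with 1 by lra. apply CI_point.
    - rewrite (CI_ext _ (fun _ => RtoC 0)); [rewrite CI_const; ring|].
      intros s. rewrite Rmin_left, Rmax_right by lra. intros Hs.
      apply rect_int_hol; try lra. intros x y X Y. apply fam_int_hol; unfold Re, Im; simpl; try lra.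
      specialize (Hsg x y X Y). split; [|lra].
      assert (s1 = sg z0 + 2 * L * D)
        by (unfold s1; apply Rmin_right, Rnot_lt_le; intros Hc; apply Hlt; unfold s1; rewrite Rmin_left; lra).
      lra. }
  replace (rect_int (Phi kappa) b1 b2 c d) with (rect_int (fun z => Phi kappa z - P2 z)%C b1 b2 c d).
  2:{ unfold rect_int.
      rewrite (FI_ext _ _ (fun x y => Phi kappa (x, y) - P2 (x, y))%C (fun x y => Ci * Phi kappa (x, y) - Ci * P2 (x, y))%C);
        [|lra|lra|intros; split; ring].
      rewrite (FI_minus (fun x y => Phi kappa (x, y)) (fun x y => Ci * Phi kappa (x, y))%C
        (fun x y => P2 (x, y)) (fun x y => Ci * P2 (x, y))%C); try lra.
      - unfold rect_int in E2. rewrite E2. ring.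
      - apply rect_cont; try lra. intros; now apply Phi_cont.
      - apply rect_cont; try lra. exact cP2. }
  assert (Hbd : forall x y, b1 <= x <= b2 -> c <= y <= d -> Cmod (Phi kappa (x, y) - P2 (x, y)) <= 3 * L * D * e').
  { intros x y X Y. destruct (Hlow x y X Y) as [Hl1 Hl2].
    change (Cmod (CI (fun s => fam_int kappa (s, (x, y) : C)) (low (x, y)) 1
                  - CI (fun s => fam_int kappa (s, (x, y) : C)) s1 1) <= 3 * L * D * e').
    rewrite (CI_Chasles (fun s => fam_int kappa (s, (x, y) : C)) (low (x, y)) s1 1) by (apply slice_cont, fam_int_cont).
    match goal with |- Cmod (?A + ?B - ?B)%C <= _ => replace (A + B - B)%C with A by ring end.
    eapply Rle_trans; [apply (CI_bound _ _ _ e'); [lra|apply slice_cont, fam_int_cont|]|].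
    - intros s Hs. specialize (Hd1 (s, (x, y))). rewrite K0 in Hd1.
      replace (fam_int kappa (s, (x, y)) - RtoC 0)%C with (fam_int kappa (s, (x, y))) in Hd1 by ring.
      left. apply Hd1. split.
      + change (Rabs (s - sg z0) < d1). apply Rabs_lt_between.
        assert (s1 <= sg z0 + 2 * L * D) by apply Rmin_r. lra.
      + apply Hball. specialize (Hnear x y X Y). simpl in *. lra.
    - apply Rmult_le_compat_r; lra. }
  eapply Rle_trans; [unfold rect_int; apply (FI_bound _ _ _ _ _ _ (3 * L * D * e')); try lra|].
  - apply (rect_cont (fun z => Phi kappa z - P2 z)%C); try lra. intros z Hz.
    apply contC_minus; [now apply Phi_cont|now apply cP2].
  - intros x y X Y. rewrite Cmod_mult, Cmod_Ci, Rmult_1_l. split; now apply Hbd.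
  - fold D. unfold e'. right. field. lra.
Qed.
End Family.

(** * Circles about the origin and horocycles *)

Section TwoFamilies.
Variables (f : C -> C) (x1 x2 : R).
Variables (cn rho cn' rho' : R -> R) (m m' : R) (G G' : R -> C -> C) (n n' : C -> C) (sg sg' : C -> R).
Hypothesis Cf : forall z, contCC f z.
Hypothesis Fam : circle_family f cn rho m G n sg x1 x2.
Hypothesis Fam' : circle_family f cn' rho' m' G' n' sg' x1 x2.
Hypothesis sg_le_1 : forall z, x1 < Re z < x2 -> (sg z <= 1 <-> sg' z <= 1).
Hypothesis sg_top : forall z, x1 < Re z < x2 -> 2 <= Im z -> 1 < sg z.
Variable a : C.
Hypothesis Ha : 0 < Im a.

Local Notation Ph := (Phi cn rho m G n sg a).
Local Notation Ph' := (Phi cn' rho' m' G' n' sg' a).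

Lemma kernels_agree (z : C) : x1 < Re z < x2 -> 0 <= Im z ->
  CI (fun s => fam_ker cn rho m n a s z) (low sg z) 1
  = CI (fun s => fam_ker cn' rho' m' n' a s z) (low sg' z) 1.
Proof.
  intros Hz Hi. destruct (Rle_dec (sg z) 1) as [H|H].
  - rewrite (ker_integral f cn rho m G n sg x1 x2), (ker_integral f cn' rho' m' G' n' sg' x1 x2); auto.
    now apply sg_le_1.
  - assert (H' : ~ sg' z <= 1) by (now rewrite <- sg_le_1).
    unfold low. rewrite !Rmin_left by lra. now rewrite !CI_point.
Qed.

Lemma Phi_difference (kappa z : C) : x1 < Re z < x2 -> 0 <= Im z ->
  (Ph 0 z - Ph' 0 z)%C = (Ph kappa z - Ph' kappa z)%C.
Proof.
  intros Hz Hi.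
  rewrite (Phi_split f cn rho m G n sg x1 x2 Cf Fam a Ha kappa z).
  rewrite (Phi_split f cn' rho' m' G' n' sg' x1 x2 Cf Fam' a Ha kappa z).
  rewrite kernels_agree by assumption. ring.
Qed.

(** The difference does not depend on [kappa], which may thus vary with the point: where
    [sg z0 <= 1], the unit circle included, [kappa = f z0] makes both local estimates available;
    where [sg z0 > 1] both terms vanish nearby. Above height [2] they vanish as well, which starts
    the march. *)
Lemma Phi_families_upper (x y : R) : x1 < x < x2 -> 0 < y -> Ph 0 (x, y) = Ph' 0 (x, y).
Proof.
  intros Hx Hy.
  assert (cP : forall kappa z, x1 < Re z < x2 -> contCC (Ph kappa) z)
    by (intros; now apply (Phi_cont f cn rho m G n sg x1 x2)).
  assert (cP' : forall kappa z, x1 < Re z < x2 -> contCC (Ph' kappa) z)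
    by (intros; now apply (Phi_cont f cn' rho' m' G' n' sg' x1 x2)).
  assert (E : (Ph 0 (x, y) - Ph' 0 (x, y))%C = RtoC 0).
  { apply (Morera_vanishing (fun z => Ph 0 z - Ph' 0 z)%C x1 x2); auto; clear x y Hx Hy.
    - intros x y Hx Hy. apply contC_minus; [now apply cP|now apply cP'].
    - intros x0 y0 Hx Hy e He. set (z0 := (x0, y0) : C).
      destruct (Rle_dec (sg z0) 1) as [H1|H1].
      + assert (H1' : sg' z0 <= 1) by (now apply sg_le_1).
        destruct (Phi_local f cn rho m G n sg x1 x2 Cf Fam a Ha x0 y0 Hx Hy H1 (e / 2) ltac:(lra)) as (u & Hu & HU).
        destruct (Phi_local f cn' rho' m' G' n' sg' x1 x2 Cf Fam' a Ha x0 y0 Hx Hy H1' (e / 2) ltac:(lra)) as (v & Hv & HV).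
        exists (Rmin u v). split; [unfold Rmin; destruct Rle_dec; lra|].
        intros b1 b2 c d B1 B2 C1 D1 HD.
        assert (D2 : b2 - b1 + (d - c) < u /\ b2 - b1 + (d - c) < v) by (unfold Rmin in HD; destruct Rle_dec; lra).
        specialize (HU b1 b2 c d B1 B2 C1 D1 (proj1 D2)). specialize (HV b1 b2 c d B1 B2 C1 D1 (proj2 D2)).
        set (k := f (x0, y0)) in *.
        replace (rect_int (fun z => Ph 0 z - Ph' 0 z)%C b1 b2 c d)
          with (rect_int (Ph k) b1 b2 c d - rect_int (Ph' k) b1 b2 c d)%C.
        2:{ unfold rect_int. rewrite <- FI_minus; try lra.
            - apply FI_ext; try lra. intros s t Hs Ht.
              rewrite (Phi_difference k (s, t)) by (unfold Re, Im; simpl; lra). split; ring.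
            - apply (rect_cont x1 x2); try lra. intros; now apply cP.
            - apply (rect_cont x1 x2); try lra. intros; now apply cP'. }
        unfold Cminus. eapply Rle_trans; [apply Cmod_triangle|]. rewrite Cmod_opp. lra.
      + assert (cs : @continuous C_UniformSpace R_UniformSpace sg z0)
          by (now apply (sg_cont f cn rho m G n sg x1 x2)).
        destruct (proj1 (locally_Cmod _ _) (proj1 (contR_eps sg z0) cs (sg z0 - 1) ltac:(lra))) as (dl & Hdl & H).
        exists dl. split; [exact Hdl|]. intros b1 b2 c d B1 B2 C1 D1 HD.
        replace (rect_int (fun z => Ph 0 z - Ph' 0 z)%C b1 b2 c d) with (RtoC 0).
        { rewrite Cmod_0. apply Rmult_le_pos; [lra|apply pow2_ge_0]. }
        symmetry. unfold rect_int.
        rewrite (FI_ext _ _ (fun _ _ => RtoC 0) (fun _ _ => RtoC 0)); try lra.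
        { unfold FI. rewrite !CI_const. ring. }
        intros s t Hs Ht.
        assert (Hst : Cmod ((s, t) - z0) < dl).
        { eapply Rle_lt_trans; [apply Cmod_le_Re_Im|]. unfold Re, Im; simpl.
          assert (Rabs (s + - x0) <= b2 - b1) by (apply Rabs_le; lra).
          assert (Rabs (t + - y0) <= d - c) by (apply Rabs_le; lra). lra. }
        specialize (H (s, t) Hst). apply Rabs_lt_between in H.
        assert (Hxs : x1 < Re (s, t) < x2) by (unfold Re; simpl; lra).
        assert (~ sg' (s, t) <= 1) by (rewrite <- sg_le_1 by exact Hxs; lra).
        rewrite !Phi_outside by lra. split; ring.
    - intros x y Hx Hy.
      assert (Hxs : x1 < Re (x, y) < x2) by (unfold Re; simpl; lra).
      pose proof (sg_top (x, y) Hxs Hy).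
      assert (~ sg' (x, y) <= 1) by (rewrite <- sg_le_1 by exact Hxs; lra).
      rewrite !Phi_outside by lra. ring. }
  replace (Ph 0 (x, y)) with ((Ph 0 (x, y) - Ph' 0 (x, y)) + Ph' 0 (x, y))%C by ring.
  rewrite E. ring.
Qed.

Lemma Phi_families_real (x : R) : x1 < x < x2 -> Ph 0 (x, 0) = Ph' 0 (x, 0).
Proof.
  intros Hx.
  assert (Hc : contC (fun y => (Ph 0 (x, y) - Ph' 0 (x, y))%C) 0).
  { apply (cont_line_y (fun z => Ph 0 z - Ph' 0 z)%C). apply contC_minus.
    - now apply (Phi_cont f cn rho m G n sg x1 x2).
    - now apply (Phi_cont f cn' rho' m' G' n' sg' x1 x2). }
  assert (E : (Ph 0 (x, 0) - Ph' 0 (x, 0))%C = RtoC 0).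
  { apply (contC_limit_eq _ _ _ Hc). intros d Hd. exists (d / 2).
    split; [rewrite Rabs_pos_eq; lra|]. rewrite Phi_families_upper by lra. apply Cplus_opp_r. }
  replace (Ph 0 (x, 0)) with ((Ph 0 (x, 0) - Ph' 0 (x, 0)) + Ph' 0 (x, 0))%C by ring.
  rewrite E. ring.
Qed.
End TwoFamilies.

(** * Choice of the extensions and the two concrete families *)

Lemma extension_retract (f : C -> C) (c : C) (r : R) : 0 < r -> extends_holomorphically f c r ->
  exists g : C -> C, (forall z, contCC g z) /\
    holomorphic_on (open_disc c r) g /\ (forall z, circle c r z -> g z = f z).
Proof.
  intros Hr (g & Cg & Hg & Eg). exists (fun w => g (retract c r w)). split; [|split].
  - intros z. now apply cont_retract.
  - now apply hol_retract.
  - intros z Hz. rewrite retract_id; auto. unfold circle in Hz. lra.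
Qed.

Lemma choose_extensions (f : C -> C) (cn rho : R -> R) (D : R -> Prop) :
  (forall s, D s -> 0 < rho s /\ extends_holomorphically f (RtoC (cn s)) (rho s)) ->
  exists G : R -> C -> C, forall s, D s ->
    (forall z, contCC (G s) z) /\
    holomorphic_on (open_disc (RtoC (cn s)) (rho s)) (G s) /\
    (forall z, circle (RtoC (cn s)) (rho s) z -> G s z = f z).
Proof.
  intros H.
  assert (H' : forall s, exists g : C -> C, D s ->
    (forall z, contCC g z) /\ holomorphic_on (open_disc (RtoC (cn s)) (rho s)) g /\
    (forall z, circle (RtoC (cn s)) (rho s) z -> g z = f z)).
  { intros s. destruct (classic (D s)) as [Hs|Hs]; [|exists f; tauto].
    destruct (H s Hs) as [Hr He]. destruct (extension_retract f _ _ Hr He) as [g Hg]. exists g. auto. }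
  exists (fun s => proj1_sig (constructive_indefinite_description _ (H' s))).
  intros s Hs. destruct constructive_indefinite_description as [g Hg]. simpl. auto.
Qed.

(* The circles centred at the origin, parametrized by [s = R^2]. *)
Definition rho_origin (s : R) : R := sqrt s.
Definition sg_origin (z : C) : R := Re z * Re z + Im z * Im z.

Lemma Cmod_sg_origin (z : C) : Cmod z * Cmod z = sg_origin z.
Proof. apply Cmod_sqr. Qed.

(** With [s = R^2] the denominator is [s - a z], affine in [s], and the derivative of [-z/(s - a z)]
    has the numerator [z]. The bound [x1 > 0] keeps the radii away from [0]. *)
Lemma origin_family (f : C -> C) (G : R -> C -> C) (x1 x2 : R) : 0 < x1 -> x1 < 1 ->
  (forall s, x1 * x1 <= s <= 1 ->
    (forall z, contCC (G s) z) /\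
    holomorphic_on (open_disc (RtoC 0) (rho_origin s)) (G s) /\
    (forall z, circle (RtoC 0) (rho_origin s) z -> G s z = f z)) ->
  circle_family f (fun _ => 0) rho_origin (x1 * x1) G (fun z => z) sg_origin x1 x2.
Proof.
  intros H0 H1 HG.
  assert (Hsub : forall z, (z - RtoC 0)%C = z) by (intros; ring).
  constructor.
  - nra.
  - intros; apply continuous_const.
  - intros; apply continuous_sqrt.
  - intros s Hs. apply sqrt_lt_R0. nra.
  - reflexivity.
  - apply sqrt_1.
  - intros s z Hs. now apply HG.
  - intros s Hs. now apply HG.
  - intros s z Hs. now apply HG.
  - apply hol_id.
  - intros a z s Ha Hz Hs. assert (Sp : 0 < s) by nra.
    assert (El : forall t, 0 <= t -> Lden a 0 (rho_origin t) z = (RtoC t - a * z)%C).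
    { intros t Ht. unfold Lden, rho_origin. rewrite sqrt_sqrt by exact Ht. ring. }
    assert (Hn : (RtoC s - a * z)%C <> RtoC 0).
    { rewrite <- El by lra. apply Lden_neq_0; auto. now apply sqrt_lt_R0. }
    rewrite El by lra.
    apply dcurve_is_derive.
    apply (is_derive_ext_loc (fun t => (- z * / (RtoC t - a * z))%C)).
    { exists (mkposreal s Sp). intros t Ht. change (Rabs (t - s) < s) in Ht. apply Rabs_lt_between in Ht.
      rewrite El by lra. rewrite Hsub. change (@eq C (- z * / (RtoC t - a * z))%C (- (z / (RtoC t - a * z)))%C).
      unfold Cdiv. ring. }
    apply dcurve_is_derive. eapply dcurve_eq.
    + apply dcurve_scal. apply (dcurve_inv (fun t => (RtoC t - a * z)%C)); [exact Hn|].
      apply (dcurve_minus RtoC (fun _ => (a * z)%C)); [apply dcurve_id|apply dcurve_const].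
    + cbv beta. field. exact Hn.
  - intros z Hz. unfold sg_origin. nra.
  - intros z Hz _. unfold circle, rho_origin. rewrite Hsub, <- Cmod_sg_origin, sqrt_square; [reflexivity|apply Cmod_ge_0].
  - intros z s Hz Hs. unfold open_disc, rho_origin. rewrite Hsub.
    rewrite <- (sqrt_square (Cmod z)) by apply Cmod_ge_0. apply sqrt_lt_1_alt.
    rewrite Cmod_sg_origin. split; [unfold sg_origin; nra|lra].
  - intros z0 Hz0. exists (2 * Cmod z0 + 1), 1. pose proof (Cmod_ge_0 z0).
    split; [lra|split; [lra|]]. intros z Hz. rewrite <- !Cmod_sg_origin.
    pose proof (Cmod_reverse_triangle z z0) as Hr. pose proof (Cmod_ge_0 z).
    replace (Cmod z * Cmod z - Cmod z0 * Cmod z0) with ((Cmod z + Cmod z0) * (Cmod z - Cmod z0)) by ring.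
    rewrite Rabs_mult, (Rabs_pos_eq (_ + _)) by lra.
    pose proof Hr as Hr'. apply Rabs_le_between in Hr'.
    apply Rmult_le_compat; try lra; apply Rabs_pos.
Qed.

(* Radius of the circle through [1] and [z] internally tangent to the unit circle at [1]. *)
Definition sg_horo (z : C) : R := ((1 - Re z) * (1 - Re z) + Im z * Im z) / (2 * (1 - Re z)).

(** The sign of [sg_horo z - r] thus decides whether [z] lies outside, on or inside the circle of
    radius [r]; [r = 1] is the unit circle. *)
Lemma horo_identity (z : C) (r : R) : Re z < 1 ->
  Cmod (z - RtoC (1 - r)) * Cmod (z - RtoC (1 - r)) = r * r + 2 * (1 - Re z) * (sg_horo z - r).
Proof.
  intros Hz. rewrite Cmod_sqr. destruct z as [x y]. unfold sg_horo, Re, Im in *; simpl in *. field. lra.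
Qed.

Lemma sg_horo_le_1 (z : C) : Re z < 1 -> (sg_origin z <= 1 <-> sg_horo z <= 1).
Proof.
  intros Hz. pose proof (horo_identity z 1 Hz) as E.
  replace (z - RtoC (1 - 1))%C with z in E.
  2:{ replace (1 - 1) with 0 by ring. ring. }
  rewrite Cmod_sg_origin in E. split; intros; nra.
Qed.

Lemma horo_family (f : C -> C) (G : R -> C -> C) (m x1 x2 : R) : 0 < m -> m < 1 -> x2 <= 1 - 2 * m ->
  (forall s, m <= s <= 1 ->
    (forall z, contCC (G s) z) /\
    holomorphic_on (open_disc (RtoC (1 - s)) s) (G s) /\
    (forall z, circle (RtoC (1 - s)) s z -> G s z = f z)) ->
  circle_family f (fun s => 1 - s) (fun s => s) m G (fun z => (- ((z - RtoC 1) * (z - RtoC 1)))%C) sg_horo x1 x2.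
Proof.
  intros H0 H1 Hx2 HG.
  constructor.
  - exact H1.
  - intros s. apply contR_minus; [apply continuous_const|apply continuous_id].
  - intros; apply continuous_id.
  - intros; lra.
  - ring.
  - reflexivity.
  - intros s z Hs. now apply HG.
  - intros s Hs. now apply HG.
  - intros s z Hs. now apply HG.
  - intros z. apply (hol_ext_loc (fun z => (RtoC (-1) * ((z - RtoC 1) * (z - RtoC 1)))%C)).
    + apply filter_forall. intros w. change (RtoC (-1)) with (RtoC (- (1))). rewrite RtoC_opp. ring.
    + apply hol_mult; [apply hol_const|]. apply hol_mult; (apply hol_minus; [apply hol_id|apply hol_const]).
  - intros a z s Ha Hz Hs.
    pose proof (Lden_neq_0 a (1 - s) s z Ha ltac:(lra) Hz) as Hn.
    (* Centre and radius add up to [1], so the terms in [t^2] cancel and the denominator is affine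
       in [t]. *)
    assert (El : forall t, Lden a (1 - t) t z = ((RtoC 1 - a) * (z - RtoC 1) + RtoC t * (RtoC 1 + RtoC 1 - a - z))%C).
    { intros t. unfold Lden. rewrite RtoC_mult, RtoC_minus. ring. }
    rewrite El in *.
    apply dcurve_is_derive.
    apply (is_derive_ext (fun t => ((RtoC 1 - z - RtoC t * RtoC 1) * / ((RtoC 1 - a) * (z - RtoC 1) + RtoC t * (RtoC 1 + RtoC 1 - a - z)))%C)).
    { intros t. rewrite El. rewrite RtoC_minus.
      match goal with |- ?u = ?v => change (@eq C u v) end. unfold Cdiv. ring. }
    apply dcurve_is_derive. eapply dcurve_eq.
    + apply dcurve_mult.
      * apply (dcurve_minus (fun _ => (RtoC 1 - z)%C)); [apply dcurve_const|apply dcurve_linear].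
      * apply (dcurve_inv (fun t => ((RtoC 1 - a) * (z - RtoC 1) + RtoC t * (RtoC 1 + RtoC 1 - a - z))%C)); [exact Hn|].
        apply (dcurve_plus (fun _ => ((RtoC 1 - a) * (z - RtoC 1))%C)); [apply dcurve_const|apply dcurve_linear].
    + cbv beta. field.
      intros Eq. apply Hn. rewrite <- Eq. ring.
  (* The radius is at least [(1 - Re z)/2], which exceeds [m] because [Re z < x2 <= 1 - 2 m]. *)
  - intros z Hz. assert (Q : 0 <= Im z * Im z) by apply Rle_0_sqr.
    unfold sg_horo. apply (Rmult_le_reg_r (2 * (1 - Re z))); [lra|].
    unfold Rdiv. rewrite Rmult_assoc, Rinv_l by lra. nra.
  - intros z Hz _. unfold circle. pose proof (horo_identity z (sg_horo z) ltac:(lra)) as E.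
    rewrite Rminus_diag, Rmult_0_r, Rplus_0_r in E.
    assert (0 <= sg_horo z).
    { unfold sg_horo. apply Rmult_le_pos; [|left; apply Rinv_0_lt_compat; lra].
      apply Rplus_le_le_0_compat; apply Rle_0_sqr. }
    pose proof (Cmod_ge_0 (z - RtoC (1 - sg_horo z))). nra.
  - intros z s Hz Hs. unfold open_disc. pose proof (horo_identity z s ltac:(lra)) as E.
    assert (0 <= sg_horo z).
    { unfold sg_horo. apply Rmult_le_pos; [|left; apply Rinv_0_lt_compat; lra].
      apply Rplus_le_le_0_compat; apply Rle_0_sqr. }
    pose proof (Cmod_ge_0 (z - RtoC (1 - s))).
    assert (2 * (1 - Re z) * (sg_horo z - s) < 0) by nra. nra.
  - intros [u0 v0] Hz0. unfold Re in Hz0; simpl in Hz0.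
    set (k := 1 - u0) in *. assert (Hk : 0 < k) by (unfold k; lra).
    (* The three summands bound the three terms into which the increment of [sg_horo] is split
       below; the radius keeps [1 - u] above [k / 2] and [|v - v0|] below [1]. *)
    exists (1 / 2 + (2 * Rabs v0 + 1) / k + v0 * v0 / (k * k)), (Rmin 1 (k / 2)).
    pose proof (Rabs_pos v0) as Hv0. assert (Hvv : 0 <= v0 * v0) by apply Rle_0_sqr.
    assert (P1 : 0 < (2 * Rabs v0 + 1) / k) by (apply Rdiv_lt_0_compat; lra).
    assert (P2 : 0 <= v0 * v0 / (k * k)).
    { apply Rmult_le_pos; [exact Hvv|]. left. apply Rinv_0_lt_compat. nra. }
    split; [lra|]. split; [unfold Rmin; destruct Rle_dec; lra|].
    intros [u v] Hz. pose proof (re_le_Cmod ((u, v) - (u0, v0))) as Hre.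
    pose proof (Im_le_Cmod ((u, v) - (u0, v0))) as Him. unfold Re, Im in Hre, Him; simpl in Hre, Him.
    set (D := Cmod ((u, v) - (u0, v0))) in *.
    assert (D < 1 /\ D < k / 2) as [D1 D2] by (unfold Rmin in Hz; destruct Rle_dec; lra).
    assert (HD : 0 <= D) by apply Cmod_ge_0.
    set (k' := 1 - u).
    assert (Hk' : k / 2 < k') by (apply Rabs_le_between in Hre; unfold k', k in *; lra).
    unfold sg_horo, Re, Im; simpl. fold k k'.
    replace ((k' * k' + v * v) / (2 * k') - (k * k + v0 * v0) / (2 * k))
      with ((k' - k) / 2 + ((v - v0) * (v + v0) / (2 * k') + v0 * v0 * (k - k') / (2 * k * k'))) by (field; lra).
    assert (A1 : Rabs ((k' - k) / 2) <= D * (1 / 2)).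
    { apply Rabs_le. apply Rabs_le_between in Hre. unfold k', k. lra. }
    assert (Ik : 0 < / (2 * k') /\ / (2 * k') <= / k).
    { split; [apply Rinv_0_lt_compat; lra|]. apply Rinv_le_contravar; lra. }
    assert (Ikk : 0 < / (2 * k * k') /\ / (2 * k * k') <= / (k * k)).
    { split; [apply Rinv_0_lt_compat; nra|]. apply Rinv_le_contravar; nra. }
    assert (A2 : Rabs ((v - v0) * (v + v0) / (2 * k')) <= D * ((2 * Rabs v0 + 1) / k)).
    { unfold Rdiv. rewrite !Rabs_mult, (Rabs_pos_eq (/ _)) by lra. rewrite Rmult_assoc.
      apply Rmult_le_compat; [apply Rabs_pos|apply Rmult_le_pos; [apply Rabs_pos|lra]|exact Him|].
      apply Rmult_le_compat; [apply Rabs_pos|lra| |lra].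
      replace (v + v0) with ((v + - v0) + 2 * v0) by ring.
      eapply Rle_trans; [apply Rabs_triang|]. rewrite Rabs_mult, (Rabs_pos_eq 2) by lra. lra. }
    assert (A3 : Rabs (v0 * v0 * (k - k') / (2 * k * k')) <= D * (v0 * v0 / (k * k))).
    { unfold Rdiv. rewrite !Rabs_mult, (Rabs_pos_eq (/ _)) by lra.
      replace (Rabs v0 * Rabs v0) with (v0 * v0) by (rewrite <- Rabs_mult; symmetry; now apply Rabs_pos_eq).
      replace (k - k') with (u + - u0) by (unfold k, k'; ring).
      replace (v0 * v0 * Rabs (u + - u0) * / (2 * k * k')) with (Rabs (u + - u0) * (v0 * v0 * / (2 * k * k'))) by ring.
      apply Rmult_le_compat; [apply Rabs_pos|apply Rmult_le_pos; lra|exact Hre|]. apply Rmult_le_compat_l; lra. }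
    eapply Rle_trans; [apply Rabs_triang|]. eapply Rle_trans; [apply Rplus_le_compat_l, Rabs_triang|].
    lra.
Qed.

(** * Poisson kernels *)

Lemma Cmult_cancel_l (c u v : C) : c <> RtoC 0 -> (c * u)%C = (c * v)%C -> u = v.
Proof.
  intros Hc E. replace u with (/ c * (c * u))%C by (field; exact Hc). rewrite E. field. exact Hc.
Qed.

(* The pairing of [A] with [dw/((w - a)(w - b))] along a real curve [w(s)], where
   [w - a] is proportional to [al s + be s * a]. *)
Section Piece.
Variables (nu lo : R) (al be : R -> R) (A : R -> C).
Hypothesis Hlo : lo <= 1.
Hypothesis Cal : forall s, continuous al s.
Hypothesis Cbe : forall s, continuous be s.
Hypothesis ND : forall s, lo <= s <= 1 -> be s = 0 -> al s <> 0.
Hypothesis CA : forall s, contC A s.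

Definition lin (a : C) (s : R) : C := (RtoC (al s) + RtoC (be s) * a)%C.
Definition pairing (a b : C) : C := CI (fun s => (A s * (RtoC nu / (lin a s * lin b s)))%C) lo 1.

Lemma lin_neq_0 (a : C) (s : R) : Im a <> 0 -> lo <= s <= 1 -> lin a s <> RtoC 0.
Proof.
  intros Ha Hs E. unfold lin in E. destruct a as [u v]. unfold Im in Ha; simpl in Ha.
  pose proof (f_equal fst E) as E1. pose proof (f_equal snd E) as E2. simpl in E1, E2.
  assert (Q : be s * v = 0) by lra. apply Rmult_integral in Q. destruct Q as [Q|Q]; [|contradiction].
  apply (ND s Hs Q). rewrite Q in E1. lra.
Qed.

Lemma lin_cont {U : UniformSpace} (a : U -> C) (s : U -> R) (x : U) :
  contC a x -> continuous s x -> contC (fun u => lin (a u) (s u)) x.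
Proof.
  intros Ha Hs. unfold lin. apply contC_plus.
  - apply contC_RtoC. now apply (continuous_comp s al).
  - apply contC_mult; [|exact Ha]. apply contC_RtoC. now apply (continuous_comp s be).
Qed.

Lemma pairing_cont_on (a b : C) : Im a <> 0 -> Im b <> 0 ->
  cont_on (fun s => (A s * (RtoC nu / (lin a s * lin b s)))%C) lo 1.
Proof.
  intros Ha Hb s. rewrite Rmin_left, Rmax_right by exact Hlo. intros Hs.
  apply contC_mult; [apply CA|]. apply contC_div; [apply contC_const| |apply Cmult_neq_0; now apply lin_neq_0].
  apply contC_mult; apply (lin_cont (fun _ => _) (fun s => s)); try apply contC_const; apply continuous_id.
Qed.

Definition seg (a b : C) (t : R) : C := (b + RtoC t * (a - b))%C.

Lemma seg_Im (a b : C) (t : R) : 0 < Im a * Im b -> 0 <= t <= 1 -> Im (seg a b t) <> 0.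
Proof.
  destruct a as [a1 a2], b as [b1 b2]. unfold seg, Im; simpl. intros H Ht.
  replace (b2 + (t * (a2 + - b2) + 0 * (a1 + - b1))) with (t * a2 + (1 - t) * b2) by ring.
  intros E. assert (E2 : (t * a2 + (1 - t) * b2) * b2 = 0) by (rewrite E; ring).
  assert (0 <= t * (a2 * b2)) by nra. assert (0 < b2 * b2) by nra.
  assert (E3 : t * (a2 * b2) + (1 - t) * (b2 * b2) = 0) by lra.
  assert (0 <= (1 - t) * (b2 * b2)) by nra.
  assert (t * (a2 * b2) = 0) as E4 by lra. assert ((1 - t) * (b2 * b2) = 0) as E5 by lra.
  apply Rmult_integral in E4. apply Rmult_integral in E5. lra.
Qed.

(** Averaging [1/(w - p)^2] over [p] in the segment from [b] to [a] gives [1/((w - a)(w - b))], and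
    the segment stays in one open half plane. Hence vanishing on the diagonal spreads to all pairs
    on the same side. *)
Lemma pairing_segment (a b : C) : 0 < Im a * Im b ->
  pairing a b = CI (fun t => pairing (seg a b (clamp 0 1 t)) (seg a b (clamp 0 1 t))) 0 1
  /\ cont_on (fun t => pairing (seg a b (clamp 0 1 t)) (seg a b (clamp 0 1 t))) 0 1.
Proof.
  intros Hab.
  assert (Ha : Im a <> 0) by (intros E; rewrite E in Hab; lra).
  assert (Hb : Im b <> 0) by (intros E; rewrite E in Hab; lra).
  assert (segc : forall (U : UniformSpace) (h : U -> R) x, continuous h x -> contC (fun u => seg a b (h u)) x).
  { intros U h x Hh. unfold seg. apply contC_plus; [apply contC_const|].
    apply contC_mult; [now apply contC_RtoC|apply contC_const]. }
  assert (Kc : forall s t, lo <= s <= 1 -> 0 <= t <= 1 ->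
     contC (fun p : R * R => (A (fst p) * (RtoC nu / (lin (seg a b (snd p)) (fst p) * lin (seg a b (snd p)) (fst p))))%C) (s, t)).
  { intros s t Hs Ht. apply contC_mult; [apply (contC_compR A); [apply continuous_fst|apply CA]|].
    apply contC_div; [apply contC_const| |apply Cmult_neq_0; apply lin_neq_0; auto; now apply seg_Im].
    apply contC_mult; apply lin_cont; try apply segc; try apply continuous_fst; apply continuous_snd. }
  split.
  - rewrite (CI_ext _ (fun t => pairing (seg a b t) (seg a b t)))
      by (intros t; rewrite Rmin_left, Rmax_right by lra; intros; now rewrite clamp_id).
    unfold pairing. rewrite <- (Fubini (fun s t => (A s * (RtoC nu / (lin (seg a b t) s * lin (seg a b t) s)))%C) lo 1 0 1 Hlo ltac:(lra) Kc).
    apply CI_ext_le; [exact Hlo|]. intros s Hs.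
    pose proof (lin_neq_0 b s Hb Hs) as Nb.
    assert (Nt : forall t, 0 <= t <= 1 -> lin (seg a b t) s <> RtoC 0) by (intros; apply lin_neq_0; auto; now apply seg_Im).
    (* With [l_t = lin (seg a b t) s], affine in [t], the derivative of [t/(l_t l_0)] is
       [1/l_t^2]. *)
    rewrite (CI_derive (fun t => (A s * (RtoC nu * (RtoC t * / (lin (seg a b t) s) * / lin b s)))%C)).
    + assert (S0 : seg a b 0 = b) by (unfold seg; ring). assert (S1 : seg a b 1 = a) by (unfold seg; ring).
      rewrite S0, S1. pose proof (Nt 1 ltac:(lra)) as Na. rewrite S1 in Na.
      field. split; assumption.
    + intros t. rewrite Rmin_left, Rmax_right by lra. intros Ht. specialize (Nt t Ht).
      eapply dcurve_eq.
      * apply dcurve_scal, dcurve_scal. apply dcurve_mult; [|apply dcurve_const].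
        apply (dcurve_mult RtoC); [apply dcurve_id|]. apply (dcurve_inv (fun t => lin (seg a b t) s)); [exact Nt|].
        apply (dcurve_plus (fun _ => RtoC (al s))); [apply dcurve_const|]. apply dcurve_scal.
        apply (dcurve_plus (fun _ => b)); [apply dcurve_const|apply dcurve_linear].
      * cbv beta.
        assert (El : lin (seg a b t) s = (lin b s + RtoC t * (RtoC (be s) * (a - b)))%C) by (unfold lin, seg; ring).
        replace (RtoC 0 + RtoC (be s) * (RtoC 0 + (a - b)))%C with (RtoC (be s) * (a - b))%C by ring.
        set (w := (RtoC (be s) * (a - b))%C) in *. rewrite El in *. field. split; assumption.
    + intros t. rewrite Rmin_left, Rmax_right by lra. intros Ht. apply contC_mult; [apply contC_const|].
      apply contC_div; [apply contC_const| |apply Cmult_neq_0; now apply Nt].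
      apply contC_mult; apply (lin_cont (fun t => seg a b t) (fun _ => s)); try apply continuous_const;
        apply (segc _ (fun t => t)), continuous_id.
  - intros t _. unfold pairing.
    set (K := fun p : R * R => (A (clamp lo 1 (fst p)) * (RtoC nu / (lin (seg a b (clamp 0 1 (snd p))) (clamp lo 1 (fst p)) * lin (seg a b (clamp 0 1 (snd p))) (clamp lo 1 (fst p)))))%C).
    apply (continuous_ext (fun u => CI (fun s => K (s, u)) lo 1)).
    { intros u. apply CI_ext_le; [exact Hlo|]. intros s Hs.
      unfold K; simpl. now rewrite !(clamp_id lo 1 s) by lra. }
    apply contC_CI_param_any.
    intros [s u]. apply (continuous_comp_2 (V := R_UniformSpace) (W := R_UniformSpace) (X := C_UniformSpace)
        (fun p : R * R => clamp lo 1 (fst p)) (fun p : R * R => clamp 0 1 (snd p))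
        (fun s t => (A s * (RtoC nu / (lin (seg a b t) s * lin (seg a b t) s)))%C)).
    + apply cont_clamp, continuous_fst.
    + apply cont_clamp, continuous_snd.
    + apply Kc; apply clamp_in; lra.
Qed.

(** Partial fractions: [(a - b)/((w - a)(w - b))] is the difference of [1/(w - a)] and [1/(w - b)],
    so the sum telescopes. *)
Lemma pairing_cocycle (a b c : C) : Im a <> 0 -> Im b <> 0 -> Im c <> 0 ->
  ((a - b) * pairing a b + (b - c) * pairing b c)%C = ((a - c) * pairing a c)%C.
Proof.
  intros Ha Hb Hc. unfold pairing.
  rewrite <- !CI_mult_l by (now apply pairing_cont_on).
  rewrite <- CI_plus.
  - apply CI_ext_le; [exact Hlo|]. intros s Hs.
    pose proof (lin_neq_0 a s Ha Hs) as Na. pose proof (lin_neq_0 b s Hb Hs) as Nb. pose proof (lin_neq_0 c s Hc Hs) as Nc.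
    unfold lin in *. field. repeat split; assumption.
  - intros t Ht. apply contC_mult; [apply contC_const|now apply pairing_cont_on].
  - intros t Ht. apply contC_mult; [apply contC_const|now apply pairing_cont_on].
Qed.

(* [|lin (u + i y) s|^2] *)
Definition lin2 (u y s : R) : R := (al s + be s * u) * (al s + be s * u) + (be s * y) * (be s * y).

Lemma lin2_pos (u y s : R) : y <> 0 -> lo <= s <= 1 -> 0 < lin2 u y s.
Proof.
  intros Hy Hs. unfold lin2.
  pose proof (Rle_0_sqr (al s + be s * u)) as Q1. pose proof (Rle_0_sqr (be s * y)) as Q2. unfold Rsqr in *.
  destruct (Req_dec (be s) 0) as [E|E].
  - pose proof (ND s Hs E) as N. rewrite E in *.
    assert (0 < al s * al s) by nra. nra.
  - assert (be s * y <> 0) by (apply Rmult_integral_contrapositive_currified; assumption).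
    assert (0 < (be s * y) * (be s * y)) by nra. lra.
Qed.

Lemma lin2_cont (u y s : R) : lo <= s <= 1 -> y <> 0 -> continuous (fun s => nu / lin2 u y s) s.
Proof.
  intros Hs Hy. pose proof (lin2_pos u y s Hy Hs).
  apply contR_mult; [apply continuous_const|]. apply contR_inv; [|lra].
  assert (c1 : continuous (fun s => al s + be s * u) s)
    by (apply contR_plus; [apply Cal|apply contR_mult; [apply Cbe|apply continuous_const]]).
  assert (c2 : continuous (fun s => be s * y) s) by (apply contR_mult; [apply Cbe|apply continuous_const]).
  apply contR_plus; now apply contR_mult.
Qed.

Definition mass (u y : R) : R := RInt (fun s => nu / lin2 u y s) lo 1.

Lemma mass_ge_0 (u y : R) : 0 < nu -> y <> 0 -> 0 <= mass u y.
Proof.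
  intros Hnu Hy. unfold mass. apply RInt_ge_0; [exact Hlo| |].
  - apply (ex_RInt_continuous (V := R_CompleteNormedModule)). intros s.
    rewrite Rmin_left, Rmax_right by exact Hlo. intros. now apply lin2_cont.
  - intros s Hs. left. apply Rdiv_lt_0_compat; [exact Hnu|]. apply lin2_pos; auto. lra.
Qed.

(** At conjugate points the two linear factors are conjugate, and the kernel becomes the Poisson
    kernel up to the factor [y]. *)
Lemma pairing_conj (u y : R) : y <> 0 ->
  pairing (u, y) (u, (- y)%R) = CI (fun s => (A s * RtoC (nu / lin2 u y s))%C) lo 1.
Proof.
  intros Hy. unfold pairing. apply CI_ext_le; [exact Hlo|]. intros s Hs.
  pose proof (lin2_pos u y s Hy Hs).
  replace (lin (u, y) s * lin (u, (- y)%R) s)%C with (RtoC (lin2 u y s)).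
  - rewrite RtoC_div by lra. reflexivity.
  - unfold lin, lin2. apply injective_projections; simpl; ring.
Qed.

Lemma pairing_conj_cont_on (u y : R) : y <> 0 -> cont_on (fun s => (A s * RtoC (nu / lin2 u y s))%C) lo 1.
Proof.
  intros Hy s. rewrite Rmin_left, Rmax_right by exact Hlo. intros Hs.
  apply contC_mult; [apply CA|]. apply contC_RtoC. now apply lin2_cont.
Qed.
End Piece.

Lemma cont_bounded (A : R -> C) (lo : R) : lo <= 1 -> (forall s, contC A s) ->
  exists M, 0 <= M /\ forall s, lo <= s <= 1 -> Cmod (A s) <= M.
Proof.
  intros Hlo HA. destruct (continuity_ab_maj (fun s => Cmod (A s)) lo 1 Hlo) as [m [Hm _]].
  - intros t _. apply continuity_pt_filterlim. apply (contC_Cmod A). apply HA.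
  - exists (Cmod (A m)). split; [apply Cmod_ge_0|exact Hm].
Qed.

Section Poisson.
Variables (nu lo nu' lo' : R) (al be al' be' : R -> R).
Hypothesis Hlo : lo < 1.
Hypothesis Hlo' : lo' <= 1.
Hypothesis Hnu : 0 < nu.
Hypothesis Hnu' : 0 < nu'.
Hypothesis Cal : forall s, continuous al s.
Hypothesis Cbe : forall s, continuous be s.
Hypothesis Cal' : forall s, continuous al' s.
Hypothesis Cbe' : forall s, continuous be' s.
Hypothesis ND : forall s, lo <= s <= 1 -> be s = 0 -> al s <> 0.
Hypothesis ND' : forall s, lo' <= s <= 1 -> be' s = 0 -> al' s <> 0.

Definition total (A A' : R -> C) (a b : C) : C :=
  (pairing nu lo al be A a b + pairing nu' lo' al' be' A' a b)%C.

Let Hlo1 : lo <= 1 := Rlt_le _ _ Hlo.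

Section Invariance.
Variables (A A' : R -> C).
Hypothesis CA : forall s, contC A s.
Hypothesis CA' : forall s, contC A' s.
Hypothesis Hzero : forall a, Im a <> 0 -> total A A' a a = RtoC 0.

Lemma total_same_side (a b : C) : 0 < Im a * Im b -> total A A' a b = RtoC 0.
Proof.
  intros Hab. unfold total.
  destruct (pairing_segment nu lo al be A Hlo1 Cal Cbe ND CA a b Hab) as [-> c1].
  destruct (pairing_segment nu' lo' al' be' A' Hlo' Cal' Cbe' ND' CA' a b Hab) as [-> c2].
  rewrite <- CI_plus by assumption.
  rewrite (CI_ext _ (fun _ => RtoC 0)); [rewrite CI_const; ring|].
  intros t _. apply Hzero. apply seg_Im; [exact Hab|]. apply clamp_in; lra.
Qed.

Lemma total_cocycle (a b c : C) : Im a <> 0 -> Im b <> 0 -> Im c <> 0 ->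
  ((a - b) * total A A' a b + (b - c) * total A A' b c)%C = ((a - c) * total A A' a c)%C.
Proof.
  intros Ha Hb Hc. unfold total.
  pose proof (pairing_cocycle nu lo al be A Hlo1 Cal Cbe ND CA a b c Ha Hb Hc) as E1.
  pose proof (pairing_cocycle nu' lo' al' be' A' Hlo' Cal' Cbe' ND' CA' a b c Ha Hb Hc) as E2.
  rewrite !Cmult_plus_distr_l, <- E1, <- E2. ring.
Qed.

(** By the cocycle relation [a] may be moved to [i] and its conjugate to [-i], since pairs on the
    same side contribute [0]; the differences of the conjugate points are [2 i y] and [2 i]. *)
Lemma total_conj_const (u y : R) : 0 < y ->
  (RtoC y * total A A' (u, y) (u, (- y)%R))%C = total A A' (0, 1) (0, (- (1))%R).
Proof.
  intros Hy. set (a := (u, y) : C). set (a' := (u, (- y)%R) : C). set (b := (0, 1) : C). set (b' := (0, (- (1))%R) : C).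
  assert (Ia : Im a <> 0) by (unfold Im, a; simpl; lra). assert (Ia' : Im a' <> 0) by (unfold Im, a'; simpl; lra).
  assert (Ib : Im b <> 0) by (unfold Im, b; simpl; lra). assert (Ib' : Im b' <> 0) by (unfold Im, b'; simpl; lra).
  pose proof (total_cocycle a b a' Ia Ib Ia') as E1. pose proof (total_cocycle b b' a' Ib Ib' Ia') as E2.
  rewrite (total_same_side a b) in E1 by (unfold Im, a, b; simpl; lra).
  rewrite (total_same_side b' a') in E2 by (unfold Im, a', b'; simpl; lra).
  assert (Ea : (a - a')%C = ((1 + 1) * Ci * RtoC y)%C) by (apply injective_projections; simpl; ring).
  assert (Eb : (b - b')%C = ((1 + 1) * Ci)%C) by (apply injective_projections; simpl; ring).
  assert (N : ((1 + 1) * Ci)%C <> RtoC 0).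
  { apply Cmult_neq_0; [|apply Ci_neq_0]. rewrite <- RtoC_plus. apply RtoC_neq_0. lra. }
  rewrite Ea in E1. rewrite Eb in E2.
  assert (E : ((1 + 1) * Ci * (RtoC y * total A A' a a'))%C = ((1 + 1) * Ci * total A A' b b')%C).
  { transitivity ((b - a') * total A A' b a')%C.
    - transitivity ((1 + 1) * Ci * RtoC y * total A A' a a')%C; [ring|]. rewrite <- E1. ring.
    - rewrite <- E2. ring. }
  exact (Cmult_cancel_l _ _ _ N E).
Qed.
End Invariance.

Section Localization.
Variables (A A' : R -> C) (s0 u kp : R).
Hypothesis CA : forall s, contC A s.
Hypothesis CA' : forall s, contC A' s.
Hypothesis Hzero : forall a, Im a <> 0 -> total A A' a a = RtoC 0.
Hypothesis Hone : forall a, Im a <> 0 -> total (fun _ => RtoC 1) (fun _ => RtoC 1) a a = RtoC 0.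
Hypothesis Hs0 : lo <= s0 <= 1.
Hypothesis Hpole : forall s, lo <= s <= 1 -> (s - s0) * (s - s0) <= (al s + be s * u) * (al s + be s * u).
Hypothesis Hkp : 0 < kp.
Hypothesis Haway : forall s, lo' <= s <= 1 -> kp <= (al' s + be' s * u) * (al' s + be' s * u).

Lemma total_one (y : R) : y <> 0 ->
  total (fun _ => RtoC 1) (fun _ => RtoC 1) (u, y) (u, (- y)%R) = RtoC (mass nu lo al be u y + mass nu' lo' al' be' u y).
Proof.
  intros Hy. unfold total, mass. rewrite RtoC_plus.
  rewrite !pairing_conj by auto.
  rewrite <- !CI_RtoC.
  - f_equal; apply CI_ext; intros s _; ring.
  - intros s. rewrite Rmin_left, Rmax_right by exact Hlo'. intros. now apply (lin2_cont nu' lo').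
  - intros s. rewrite Rmin_left, Rmax_right by exact Hlo1. intros. now apply (lin2_cont nu lo).
Qed.

(* The kernels [y nu / lin2] form an approximate identity at [s0] as [y -> 0]. *)
Lemma total_localized :
  total A A' (0, 1) (0, (- (1))%R)
  = (A s0 * total (fun _ => RtoC 1) (fun _ => RtoC 1) (0, 1) (0, (- (1))%R))%C.
Proof.
  set (k := A s0).
  set (Cc := total A A' (0, 1) (0, (- (1))%R)).
  set (mm := total (fun _ => RtoC 1) (fun _ => RtoC 1) (0, 1) (0, (- (1))%R)).
  assert (cone : forall s : R, contC (fun _ => RtoC 1) s) by (intros; apply contC_const).
  destruct (cont_bounded (fun s => A s - k)%C lo Hlo1) as (M & HM0 & HM).
  { intros s. apply contC_minus; [apply CA|apply contC_const]. }
  destruct (cont_bounded (fun s => A' s - k)%C lo' Hlo') as (M' & HM0' & HM').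
  { intros s. apply contC_minus; [apply CA'|apply contC_const]. }
  (* The left side does not depend on [y], so small [e] and then small [y] force it to vanish. The
     kernels are positive and [Cmod mm] is [y] times their total mass. *)
  assert (Key : forall e, 0 < e -> exists K, 0 <= K /\ forall y, 0 < y -> Cmod (Cc - k * mm) <= e * Cmod mm + y * K).
  { intros e He.
    destruct (proj1 (contC_eps A s0) (CA s0) e He) as [dl Hdl]. pose proof (cond_pos dl) as Hdp.
    (* Chosen so that [Cmod (A s - k) <= e + N (s - s0)^2] on the whole interval. By [Hpole] the
       square is at most [lin2], so this part times the kernel is at most [N * nu]. *)
    set (N := M / (dl * dl)).
    assert (HN : 0 <= N) by (apply Rmult_le_pos; [exact HM0|left; apply Rinv_0_lt_compat; nra]).
    exists ((1 - lo) * (N * nu) + (1 - lo') * (M' * (nu' / kp))).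
    assert (Hnk : 0 < nu' / kp) by (now apply Rdiv_lt_0_compat).
    split.
    { apply Rplus_le_le_0_compat; apply Rmult_le_pos; try lra; apply Rmult_le_pos; lra. }
    intros y Hy. assert (Hy0 : y <> 0) by lra.
    assert (E1 : Cc = (RtoC y * total A A' (u, y) (u, (- y)%R))%C) by (symmetry; now apply total_conj_const).
    assert (E2 : mm = (RtoC y * total (fun _ => RtoC 1) (fun _ => RtoC 1) (u, y) (u, (- y)%R))%C)
      by (symmetry; now apply total_conj_const).
    pose proof (mass_ge_0 nu lo al be Hlo1 Cal Cbe ND u y Hnu Hy0) as P1.
    pose proof (mass_ge_0 nu' lo' al' be' Hlo' Cal' Cbe' ND' u y Hnu' Hy0) as P2.
    assert (E3 : Cmod mm = y * (mass nu lo al be u y + mass nu' lo' al' be' u y)).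
    { rewrite E2, total_one by exact Hy0. rewrite <- RtoC_mult, Cmod_R, Rabs_pos_eq; [reflexivity|].
      apply Rmult_le_pos; lra. }
    assert (E4 : (Cc - k * mm)%C = (RtoC y * (CI (fun s => ((A s - k) * RtoC (nu / lin2 al be u y s))%C) lo 1
        + CI (fun s => ((A' s - k) * RtoC (nu' / lin2 al' be' u y s))%C) lo' 1))%C).
    { rewrite E1, E2. unfold total. rewrite !pairing_conj by auto.
      pose proof (pairing_conj_cont_on nu lo al be A Hlo1 Cal Cbe ND CA u y Hy0) as c1.
      pose proof (pairing_conj_cont_on nu' lo' al' be' A' Hlo' Cal' Cbe' ND' CA' u y Hy0) as c2.
      pose proof (pairing_conj_cont_on nu lo al be (fun _ => RtoC 1) Hlo1 Cal Cbe ND cone u y Hy0) as c3.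
      pose proof (pairing_conj_cont_on nu' lo' al' be' (fun _ => RtoC 1) Hlo' Cal' Cbe' ND' cone u y Hy0) as c4.
      rewrite (CI_ext (fun s => ((A s - k) * RtoC (nu / lin2 al be u y s))%C)
        (fun s => (A s * RtoC (nu / lin2 al be u y s) - k * (RtoC 1 * RtoC (nu / lin2 al be u y s)))%C)) by (intros; ring).
      rewrite (CI_ext (fun s => ((A' s - k) * RtoC (nu' / lin2 al' be' u y s))%C)
        (fun s => (A' s * RtoC (nu' / lin2 al' be' u y s) - k * (RtoC 1 * RtoC (nu' / lin2 al' be' u y s)))%C)) by (intros; ring).
      rewrite (CI_minus (fun s => (A s * RtoC (nu / lin2 al be u y s))%C) (fun s => (k * (RtoC 1 * RtoC (nu / lin2 al be u y s)))%C));
        [|exact c1|intros t Ht; apply contC_mult; [apply contC_const|now apply c3]].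
      rewrite (CI_minus (fun s => (A' s * RtoC (nu' / lin2 al' be' u y s))%C) (fun s => (k * (RtoC 1 * RtoC (nu' / lin2 al' be' u y s)))%C));
        [|exact c2|intros t Ht; apply contC_mult; [apply contC_const|now apply c4]].
      rewrite (CI_mult_l k (fun s => (RtoC 1 * RtoC (nu / lin2 al be u y s))%C)) by exact c3.
      rewrite (CI_mult_l k (fun s => (RtoC 1 * RtoC (nu' / lin2 al' be' u y s))%C)) by exact c4.
      ring. }
    rewrite E4, Cmod_mult, Cmod_R, Rabs_pos_eq, E3 by lra.
    assert (B1 : Cmod (CI (fun s => ((A s - k) * RtoC (nu / lin2 al be u y s))%C) lo 1) <= e * mass nu lo al be u y + (1 - lo) * (N * nu)).
    { eapply Rle_trans; [apply (CI_bound_fun _ (fun s => e * (nu / lin2 al be u y s) + N * nu) lo 1 Hlo1)|].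
      - apply (pairing_conj_cont_on nu lo al be (fun s => A s - k)%C); auto.
        intros s. apply contC_minus; [apply CA|apply contC_const].
      - intros s Hs. apply contR_plus; [|apply continuous_const].
        apply contR_mult; [apply continuous_const|]. now apply (lin2_cont nu lo).
      - intros s Hs. pose proof (lin2_pos lo al be ND u y s Hy0 Hs) as Lp.
        rewrite Cmod_mult, Cmod_R, Rabs_pos_eq by (left; now apply Rdiv_lt_0_compat).
        assert (Lge : (s - s0) * (s - s0) <= lin2 al be u y s).
        { unfold lin2. pose proof (Hpole s Hs). pose proof (Rle_0_sqr (be s * y)). unfold Rsqr in *. lra. }
        assert (Dec : Cmod (A s - k) <= e + N * ((s - s0) * (s - s0))).
        { destruct (Rlt_dec (Rabs (s - s0)) dl) as [Hc|Hc].
          - assert (Cmod (A s - k) < e) by (apply Hdl; exact Hc).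
            assert (0 <= N * ((s - s0) * (s - s0))) by (apply Rmult_le_pos; [exact HN|apply Rle_0_sqr]). lra.
          - apply Rnot_lt_le in Hc. pose proof (HM s Hs) as Hb. simpl in Hb.
            assert (dl * dl <= (s - s0) * (s - s0)).
            { pose proof (Rsqr_abs (s - s0)) as Hq. unfold Rsqr in Hq. rewrite Hq. apply Rmult_le_compat; lra. }
            assert (M = N * (dl * dl)) by (unfold N; field; lra).
            assert (N * (dl * dl) <= N * ((s - s0) * (s - s0))) by (now apply Rmult_le_compat_l). lra. }
        assert (Lq : 0 < nu / lin2 al be u y s) by (now apply Rdiv_lt_0_compat).
        apply Rle_trans with ((e + N * ((s - s0) * (s - s0))) * (nu / lin2 al be u y s)).
        { apply Rmult_le_compat_r; lra. }
        rewrite Rmult_plus_distr_r. apply Rplus_le_compat_l.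
        apply Rle_trans with (N * lin2 al be u y s * (nu / lin2 al be u y s)); [|right; field; lra].
        apply Rmult_le_compat_r; [lra|]. now apply Rmult_le_compat_l.
      - right. unfold mass.
        rewrite (RInt_plus (V := R_CompleteNormedModule) (fun s => e * (nu / lin2 al be u y s)) (fun _ => N * nu)).
        + rewrite (RInt_scal (V := R_CompleteNormedModule) (fun s => nu / lin2 al be u y s)), RInt_const; [reflexivity|].
          apply (ex_RInt_continuous (V := R_CompleteNormedModule)). intros s.
          rewrite Rmin_left, Rmax_right by exact Hlo1. intros. now apply (lin2_cont nu lo).
        + apply (ex_RInt_continuous (V := R_CompleteNormedModule)). intros s.
          rewrite Rmin_left, Rmax_right by exact Hlo1. intros. apply contR_mult; [apply continuous_const|]. now apply (lin2_cont nu lo).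
        + apply (ex_RInt_continuous (V := R_CompleteNormedModule)). intros. apply continuous_const. }
    assert (B2 : Cmod (CI (fun s => ((A' s - k) * RtoC (nu' / lin2 al' be' u y s))%C) lo' 1) <= (1 - lo') * (M' * (nu' / kp))).
    { apply CI_bound; [exact Hlo'| |].
      - apply (pairing_conj_cont_on nu' lo' al' be' (fun s => A' s - k)%C); auto.
        intros s. apply contC_minus; [apply CA'|apply contC_const].
      - intros s Hs. pose proof (lin2_pos lo' al' be' ND' u y s Hy0 Hs) as Lp.
        rewrite Cmod_mult, Cmod_R, Rabs_pos_eq by (left; now apply Rdiv_lt_0_compat).
        apply Rmult_le_compat; [apply Cmod_ge_0|left; now apply Rdiv_lt_0_compat|now apply HM'|].
        apply Rmult_le_compat_l; [lra|]. apply Rinv_le_contravar; [exact Hkp|].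
        unfold lin2. pose proof (Haway s Hs). pose proof (Rle_0_sqr (be' s * y)). unfold Rsqr in *. lra. }
    match goal with |- y * Cmod (?p + ?q)%C <= _ => pose proof (Cmod_triangle p q) as Tr end.
    apply Rle_trans with (y * (e * mass nu lo al be u y + (1 - lo) * (N * nu) + (1 - lo') * (M' * (nu' / kp)))).
    - apply Rmult_le_compat_l; lra.
    - assert (0 <= y * (e * mass nu' lo' al' be' u y)) by (repeat apply Rmult_le_pos; lra). lra. }
  assert (Z : Cmod (Cc - k * mm) <= 0).
  { apply Rnot_lt_le. intros Hlt. set (X := Cmod (Cc - k * mm)) in *.
    pose proof (Cmod_ge_0 mm) as Hm0.
    destruct (Key (X / (4 * (Cmod mm + 1)))) as (K & HK0 & HK); [apply Rdiv_lt_0_compat; lra|].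
    specialize (HK (X / (4 * (K + 1))) ltac:(apply Rdiv_lt_0_compat; lra)).
    assert (X / (4 * (Cmod mm + 1)) * Cmod mm <= X / 4).
    { apply Rle_trans with (X / (4 * (Cmod mm + 1)) * (Cmod mm + 1)); [|right; field; lra].
      apply Rmult_le_compat_l; [|lra]. left. apply Rdiv_lt_0_compat; lra. }
    assert (X / (4 * (K + 1)) * K <= X / 4).
    { apply Rle_trans with (X / (4 * (K + 1)) * (K + 1)); [|right; field; lra].
      apply Rmult_le_compat_l; [|lra]. left. apply Rdiv_lt_0_compat; lra. }
    lra. }
  assert (E : (Cc - k * mm)%C = RtoC 0) by (apply Cmod_eq_0; pose proof (Cmod_ge_0 (Cc - k * mm)); lra).
  replace Cc with ((Cc - k * mm) + k * mm)%C by ring. rewrite E. ring.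
Qed.
End Localization.

(** Both weights are positive, so the masses of the two arcs cannot cancel. *)
Lemma total_one_neq_0 : total (fun _ => RtoC 1) (fun _ => RtoC 1) (0, 1) (0, (- (1))%R) <> RtoC 0.
Proof.
  rewrite total_one by lra. apply RtoC_neq_0.
  pose proof (mass_ge_0 nu' lo' al' be' Hlo' Cal' Cbe' ND' 0 1 Hnu' ltac:(lra)).
  assert (0 < mass nu lo al be 0 1); [unfold mass|lra].
  apply RInt_gt_0; [exact Hlo| |].
  - intros s Hs. apply Rdiv_lt_0_compat; [exact Hnu|]. apply (lin2_pos lo); auto; lra.
  - intros s Hs. now apply (lin2_cont nu lo); auto; lra.
Qed.
End Poisson.

(** * Independence of the radius on the axis *)

Definition schwarz_reflect (f : C -> C) (z : C) : C := Cconj (f (Cconj z)).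

Lemma schwarz_reflect_cont (f : C -> C) (z : C) :
  contCC f (Cconj z) -> contCC (schwarz_reflect f) z.
Proof.
  intros H. apply (contC_conj (U := C_UniformSpace) (fun z => f (Cconj z))).
  apply (contC_comp f); [apply contC_conj, contC_id|exact H].
Qed.

Lemma schwarz_reflect_hol (f : C -> C) (z : C) : hol f (Cconj z) -> hol (schwarz_reflect f) z.
Proof.
  intros [q [Hq E]]. exists (schwarz_reflect q). split; [now apply schwarz_reflect_cont|].
  intros w. unfold schwarz_reflect. rewrite (E (Cconj w)).
  apply injective_projections; simpl; ring.
Qed.

Lemma Cmod_conj_sub (z : C) (c : R) : Cmod (Cconj z - RtoC c) = Cmod (z - RtoC c).
Proof.
  rewrite <- (Cmod_conj (z - RtoC c)). f_equal. apply injective_projections; simpl; ring.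
Qed.

(** The geometric fields do not involve [f]. This serves the reflected function and the constant
    [1], which normalizes the Poisson integral. *)
Lemma circle_family_change (f f' : C -> C) (cn rho : R -> R) (m : R) (G G' : R -> C -> C) (n : C -> C) (sg : C -> R) (x1 x2 : R) :
  circle_family f cn rho m G n sg x1 x2 ->
  (forall s z, m <= s <= 1 -> contCC (G' s) z) ->
  (forall s, m <= s <= 1 -> holomorphic_on (open_disc (RtoC (cn s)) (rho s)) (G' s)) ->
  (forall s z, m <= s <= 1 -> circle (RtoC (cn s)) (rho s) z -> G' s z = f' z) ->
  circle_family f' cn rho m G' n sg x1 x2.
Proof. intros [] H1 H2 H3. now constructor. Qed.

(** Conjugation preserves every disc with real centre. *)
Lemma circle_family_reflect (f : C -> C) (cn rho : R -> R) (m : R) (G : R -> C -> C) (n : C -> C) (sg : C -> R) (x1 x2 : R) :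
  circle_family f cn rho m G n sg x1 x2 ->
  circle_family (schwarz_reflect f) cn rho m (fun s => schwarz_reflect (G s)) n sg x1 x2.
Proof.
  intros Fam. apply (circle_family_change f _ cn rho m G); auto.
  - intros s z Hs. apply schwarz_reflect_cont. now apply (fam_G_cont Fam).
  - intros s Hs z Hz. apply hol_iff_ex_derive. apply schwarz_reflect_hol. apply hol_iff_ex_derive.
    apply (fam_G_hol Fam); [exact Hs|]. unfold open_disc in *. now rewrite Cmod_conj_sub.
  - intros s z Hs Hz. unfold schwarz_reflect. rewrite (fam_G_eq Fam); auto.
    unfold circle in *. now rewrite Cmod_conj_sub.
Qed.

Lemma ext_fam_reflect (cn rho : R -> R) (m : R) (G : R -> C -> C) (s x : R) :
  ext_fam cn rho m (fun s => schwarz_reflect (G s)) s (x, 0) = Cconj (ext_fam cn rho m G s (x, 0)).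
Proof.
  unfold ext_fam, schwarz_reflect. do 2 f_equal. unfold retract. apply injective_projections; simpl; ring.
Qed.

(** * Two complementary arcs of the real projective line *)

Section Axis.
Variables (x : R) (m x1 x2 : R).
Hypothesis Hx1 : 0 < x1 < x.
Hypothesis Hx2 : x < x2.
Hypothesis Hm : 0 < m.
Hypothesis Hxm : x2 <= 1 - 2 * m.

Local Notation lo := (x * x).
Local Notation lo' := ((1 - x) / 2).
Local Notation nB := (fun z => (- ((z - RtoC 1) * (z - RtoC 1)))%C).

(** Coefficients of [Lden = al + be * a] at the real point [z = x]; the curve is [w = - al/be]. For
    [A] it is [s/x], from [x] to [1/x] as [s] goes from [x^2] to [1]. For [B] it joins the same
    points through infinity, met at [s = 1 - x]; its lower end [(1 - x)/2] is the radius of the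
    smallest horocycle involved, the one through [x]. *)
Definition alA (s : R) : R := s.
Definition beA (s : R) : R := - x.
Definition alB (s : R) : R := x - 1 + s * (2 - x).
Definition beB (s : R) : R := 1 - x - s.

Lemma axis_x : 0 < x /\ x < 1 /\ x1 * x1 < lo /\ lo < 1 /\ m < lo' /\ lo' < 1.
Proof. repeat split; nra. Qed.

Lemma alA_cont (s : R) : continuous alA s. Proof. apply continuous_id. Qed.
Lemma beA_cont (s : R) : continuous beA s. Proof. apply continuous_const. Qed.
Lemma alB_cont (s : R) : continuous alB s.
Proof. apply contR_plus; [apply continuous_const|]. apply contR_mult; [apply continuous_id|apply continuous_const]. Qed.
Lemma beB_cont (s : R) : continuous beB s.
Proof. apply contR_minus; [apply continuous_const|apply continuous_id]. Qed.

Lemma ND_A (s : R) : lo <= s <= 1 -> beA s = 0 -> alA s <> 0.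
Proof. unfold beA. pose proof axis_x. intros; lra. Qed.

Lemma ND_B (s : R) : lo' <= s <= 1 -> beB s = 0 -> alB s <> 0.
Proof. unfold beB, alB. pose proof axis_x. intros Hs E. assert (s = 1 - x) as -> by lra. nra. Qed.

Local Notation tot := (total (x) (lo) ((1 - x) * (1 - x)) (lo') alA beA alB beB).

Section Fun.
Variables (f : C -> C) (GA GB : R -> C -> C).
Hypothesis Cf : forall z, contCC f z.
Hypothesis FamA : circle_family f (fun _ => 0) rho_origin (x1 * x1) GA (fun z => z) sg_origin x1 x2.
Hypothesis FamB : circle_family f (fun s => 1 - s) (fun s => s) m GB nB sg_horo x1 x2.

Definition valA (s : R) : C := ext_fam (fun _ => 0) rho_origin (x1 * x1) GA s (x, 0).
Definition valB (s : R) : C := ext_fam (fun s => 1 - s) (fun s => s) m GB s (x, 0).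

Lemma valA_cont (s : R) : contC valA s.
Proof.
  apply (cont_slice_l (U := C_UniformSpace) (fun p => ext_fam (fun _ => 0) rho_origin (x1 * x1) GA (fst p) (snd p))).
  now apply (ext_fam_cont f _ _ _ _ _ _ x1 x2 Cf FamA).
Qed.

Lemma valB_cont (s : R) : contC valB s.
Proof.
  apply (cont_slice_l (U := C_UniformSpace) (fun p => ext_fam (fun s => 1 - s) (fun s => s) m GB (fst p) (snd p))).
  now apply (ext_fam_cont f _ _ _ _ _ _ x1 x2 Cf FamB).
Qed.

Lemma upper_real : upper (x, 0) = (x, 0).
Proof. apply upper_id. unfold Im; simpl; lra. Qed.

Lemma axis_identity_upper (a : C) : 0 < Im a -> tot valA valB a a = RtoC 0.
Proof.
  intros Ha. pose proof axis_x as Hx.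
  assert (E : Phi (fun _ => 0) rho_origin (x1 * x1) GA (fun z => z) sg_origin a 0 (x, 0)
    = Phi (fun s => 1 - s) (fun s => s) m GB nB sg_horo a 0 (x, 0)).
  { apply (Phi_families_real f x1 x2); auto.
    - intros z Hz. apply sg_horo_le_1. lra.
    - intros z Hz Hi. unfold sg_origin. nra.
    - lra. }
  assert (EA : Phi (fun _ => 0) rho_origin (x1 * x1) GA (fun z => z) sg_origin a 0 (x, 0)
    = pairing x lo alA beA valA a a).
  { unfold Phi, pairing, low, sg_origin, Re, Im; simpl.
    rewrite Rmult_0_r, Rplus_0_r, Rmin_right by lra.
    apply CI_ext_le; [lra|]. intros s Hs.
    unfold fam_int, fam_ker, fam_den; simpl. rewrite clamp_id by lra. rewrite upper_real.
    fold (valA s).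
    replace (Lden a 0 (rho_origin s) (x, 0)) with (lin alA beA a s); [unfold RtoC at 2; unfold Cdiv; ring|].
    unfold lin, Lden, rho_origin, alA, beA. rewrite sqrt_sqrt by nra.
    apply injective_projections; simpl; ring. }
  (* The minus sign reverses the second arc: the difference of the two [Phi] becomes a sum with the
     positive weights [x] and [(1 - x)^2]. *)
  assert (EB : Phi (fun s => 1 - s) (fun s => s) m GB nB sg_horo a 0 (x, 0)
    = (- pairing ((1 - x) * (1 - x)) lo' alB beB valB a a)%C).
  { replace (- pairing ((1 - x) * (1 - x)) lo' alB beB valB a a)%C
      with (RtoC (-1) * pairing ((1 - x) * (1 - x)) lo' alB beB valB a a)%C by (change (RtoC (-1)) with (RtoC (- (1))); rewrite RtoC_opp; ring).
    unfold pairing. rewrite <- CI_mult_l.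
    2:{ apply pairing_cont_on; try lra. - apply alB_cont. - apply beB_cont. - apply ND_B. - apply valB_cont. }
    unfold Phi, low, sg_horo, Re, Im; simpl.
    replace (((1 - x) * (1 - x) + 0 * 0) / (2 * (1 - x))) with lo' by (field; lra).
    rewrite Rmin_right by lra.
    apply CI_ext_le; [lra|]. intros s Hs.
    unfold fam_int, fam_ker, fam_den; simpl. rewrite clamp_id by lra. rewrite upper_real.
    fold (valB s).
    replace (Lden a (1 - s) s (x, 0)) with (lin alB beB a s).
    - replace ((x, 0) - RtoC 1)%C with (RtoC (x - 1)) by (apply injective_projections; simpl; ring).
      change (RtoC (-1)) with (RtoC (- (1))). rewrite RtoC_opp, !RtoC_mult, !RtoC_minus. unfold Cdiv. ring.
    - unfold lin, Lden, alB, beB. apply injective_projections; simpl; ring. }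
  unfold total. rewrite <- EA, E, EB. ring.
Qed.
End Fun.

Lemma axis_identity (f : C -> C) (GA GB : R -> C -> C) :
  (forall z, contCC f z) ->
  circle_family f (fun _ => 0) rho_origin (x1 * x1) GA (fun z => z) sg_origin x1 x2 ->
  circle_family f (fun s => 1 - s) (fun s => s) m GB nB sg_horo x1 x2 ->
  forall a, Im a <> 0 -> tot (valA GA) (valB GB) a a = RtoC 0.
Proof.
  intros Cf FamA FamB a Ha. pose proof axis_x as Hx.
  destruct (Rlt_dec 0 (Im a)) as [Hp|Hn]; [now apply (axis_identity_upper f)|].
  assert (Hc : 0 < Im (Cconj a)) by (unfold Im in *; simpl; lra).
  pose proof (axis_identity_upper (schwarz_reflect f) (fun s => schwarz_reflect (GA s)) (fun s => schwarz_reflect (GB s))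
    (fun z => schwarz_reflect_cont f z (Cf (Cconj z)))
    (circle_family_reflect _ _ _ _ _ _ _ _ _ FamA) (circle_family_reflect _ _ _ _ _ _ _ _ _ FamB) _ Hc) as E.
  (* On the axis the reflected family takes conjugate values, so its identity at [Cconj a] is the
     conjugate of the wanted identity at [a]. *)
  assert (Q : forall nu l al be A A', l <= 1 -> (forall s, continuous al s) -> (forall s, continuous be s) ->
     (forall s, l <= s <= 1 -> be s = 0 -> al s <> 0) -> (forall s, contC A s) -> (forall s, A' s = Cconj (A s)) ->
     pairing nu l al be A' (Cconj a) (Cconj a) = Cconj (pairing nu l al be A a a)).
  { intros nu l al be A A' Hl cal cbe nd cA EA. unfold pairing. rewrite <- CI_conj by (now apply pairing_cont_on).
    apply CI_ext_le; [exact Hl|]. intros s Hs. rewrite EA.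
    pose proof (lin_neq_0 l al be nd a s Ha Hs) as N.
    pose proof (lin_neq_0 l al be nd (Cconj a) s ltac:(lra) Hs) as N'.
    assert (EL : lin al be (Cconj a) s = Cconj (lin al be a s)) by (unfold lin; apply injective_projections; simpl; ring).
    rewrite !Cmult_conj, !Cdiv_conj, !Cmult_conj by (now apply Cmult_neq_0). rewrite EL.
    replace (Cconj (RtoC nu)) with (RtoC nu) by (apply injective_projections; simpl; ring). reflexivity. }
  unfold total in E.
  rewrite (Q _ _ _ _ (valA GA)), (Q _ _ _ _ (valB GB)) in E; try lra.
  - unfold total. rewrite <- Cplus_conj in E.
    apply (f_equal Cconj) in E. rewrite Cconj_conj in E. rewrite E. apply injective_projections; simpl; ring.
  - apply alB_cont. - apply beB_cont. - apply ND_B. - now apply (valB_cont f).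
  - intros s. apply ext_fam_reflect.
  - apply alA_cont. - apply beA_cont. - apply ND_A. - now apply (valA_cont f).
  - intros s. apply ext_fam_reflect.
Qed.

Lemma axis_constant_open (f : C -> C) (GA GB : R -> C -> C) :
  (forall z, contCC f z) ->
  circle_family f (fun _ => 0) rho_origin (x1 * x1) GA (fun z => z) sg_origin x1 x2 ->
  circle_family f (fun s => 1 - s) (fun s => s) m GB nB sg_horo x1 x2 ->
  exists k, forall s, lo < s < 1 -> valA GA s = k.
Proof.
  intros Cf FamA FamB. pose proof axis_x as Hx.
  set (one := fun (_ : R) (_ : C) => RtoC 1).
  assert (F1A : circle_family (fun _ => RtoC 1) (fun _ => 0) rho_origin (x1 * x1) one (fun z => z) sg_origin x1 x2).
  { apply (circle_family_change f _ _ _ _ GA); auto.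
    - intros; apply contC_const.
    - intros s _ z _. apply hol_iff_ex_derive, hol_const. }
  assert (F1B : circle_family (fun _ => RtoC 1) (fun s => 1 - s) (fun s => s) m one nB sg_horo x1 x2).
  { apply (circle_family_change f _ _ _ _ GB); auto.
    - intros; apply contC_const.
    - intros s _ z _. apply hol_iff_ex_derive, hol_const. }
  assert (Hone : forall a, Im a <> 0 -> tot (fun _ => RtoC 1) (fun _ => RtoC 1) a a = RtoC 0).
  { intros a Ha. apply (axis_identity (fun _ => RtoC 1) one one); auto. intros; apply contC_const. }
  pose proof (axis_identity f GA GB Cf FamA FamB) as Hz.
  set (M1 := tot (fun _ => RtoC 1) (fun _ => RtoC 1) (0, 1) (0, (- (1))%R)).
  set (M := tot (valA GA) (valB GB) (0, 1) (0, (- (1))%R)).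
  assert (HM1 : M1 <> RtoC 0).
  { apply total_one_neq_0; try lra; try nra.
    - apply alA_cont. - apply beA_cont. - apply alB_cont. - apply beB_cont. - apply ND_A. - apply ND_B. }
  exists (M / M1)%C. intros s0 Hs0.
  (* The point [w] of the first arc with parameter [s0]. It lies strictly between [x] and [1/x],
     hence at positive distance from the second arc. *)
  set (u := s0 / x).
  assert (Hu : x * u = s0) by (unfold u; field; lra).
  assert (u1 : x < u) by nra. assert (u2 : x * u < 1) by lra.
  set (d := Rmin ((1 - x) * (u - x) / 2) (1 - x * u)).
  assert (Hd : 0 < d /\ d <= (1 - x) * (u - x) / 2 /\ d <= 1 - x * u).
  { assert (0 < (1 - x) * (u - x) / 2) by nra. unfold d, Rmin. destruct Rle_dec; lra. }
  assert (E : M = (valA GA s0 * M1)%C).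
  { apply (total_localized x lo ((1 - x) * (1 - x)) lo' alA beA alB beB) with (u := u) (kp := d * d); auto;
      try lra; try nra; try apply alA_cont; try apply beA_cont; try apply alB_cont; try apply beB_cont;
      try apply ND_A; try apply ND_B.
    - now apply (valA_cont f).
    - now apply (valB_cont f).
    - intros s Hs. unfold alA, beA. replace (s + - x * u) with (s - s0) by (rewrite <- Hu; ring). lra.
    - intros s Hs. unfold alB, beB.
      replace (x - 1 + s * (2 - x) + (1 - x - s) * u) with ((1 - u) * (x - 1) + s * (2 - x - u)) by ring.
      (* affine in [s], bounded below by [d] at both ends *)
      set (th := (s - lo') / (1 - lo')).
      assert (Hth : 0 <= th <= 1).
      { unfold th. split; [apply Rmult_le_pos; [lra|left; apply Rinv_0_lt_compat; lra]|].
        apply (Rmult_le_reg_r (1 - lo')); [lra|]. unfold Rdiv at 1. rewrite Rmult_assoc, Rinv_l by lra. lra. }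
      assert (Es : s = lo' + th * (1 - lo')) by (unfold th; field; lra).
      replace ((1 - u) * (x - 1) + s * (2 - x - u)) with ((1 - th) * ((1 - x) * (u - x) / 2) + th * (1 - x * u))
        by (rewrite Es; field).
      assert (d <= (1 - th) * ((1 - x) * (u - x) / 2) + th * (1 - x * u)) by nra. nra. }
  rewrite E. field. exact HM1.
Qed.

(** At the ends of the parameter interval the boundary point belongs to both arcs, so they are
    reached by continuity. At [s = x^2] the circle passes through [x], which identifies the
    constant. *)
Lemma axis_constant (f : C -> C) (GA GB : R -> C -> C) :
  (forall z, contCC f z) ->
  circle_family f (fun _ => 0) rho_origin (x1 * x1) GA (fun z => z) sg_origin x1 x2 ->
  circle_family f (fun s => 1 - s) (fun s => s) m GB nB sg_horo x1 x2 ->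
  forall s, lo <= s <= 1 -> valA GA s = f (x, 0).
Proof.
  intros Cf FamA FamB. pose proof axis_x as Hx.
  destruct (axis_constant_open f GA GB Cf FamA FamB) as [k Hk].
  assert (Hc : forall s, lo <= s <= 1 -> valA GA s = k).
  { intros s Hs.
    apply (contC_limit_eq _ _ _ (valA_cont f GA Cf FamA s)). intros d Hd.
    set (h := Rmin (d / 2) ((1 - lo) / 4)).
    assert (Hh : 0 < h /\ h <= d / 2 /\ h <= (1 - lo) / 4) by (unfold h, Rmin; destruct Rle_dec; lra).
    destruct (Rle_dec s ((1 + lo) / 2)).
    - exists (s + h). split; [rewrite Rabs_pos_eq; lra|apply Hk; lra].
    - exists (s - h). split; [rewrite Rabs_left; lra|apply Hk; lra]. }
  intros s Hs. rewrite (Hc s Hs), <- (Hc lo) by lra.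
  unfold valA. replace lo with (sg_origin (x, 0)) by (unfold sg_origin, Re, Im; simpl; ring).
  apply (ext_fam_diag f _ _ _ _ _ _ x1 x2 FamA); unfold sg_origin, Re, Im; simpl; lra.
Qed.
End Axis.

(** * Rotation to the point [1] and conclusion *)

Lemma continuous_on_eps (D : C -> Prop) (f : C -> C) :
  @continuous_on C_UniformSpace C_UniformSpace D f <->
  forall z, D z -> forall e, 0 < e -> exists d, 0 < d /\ forall w, D w -> Cmod (w - z) < d -> Cmod (f w - f z) < e.
Proof.
  split.
  - intros H z Hz e He. specialize (H z Hz (fun w => Cmod (w - f z) < e)).
    assert (L : @locally C_UniformSpace (f z) (fun w => Cmod (w - f z) < e)) by (apply locally_Cmod; exists e; auto).
    specialize (H L). apply locally_Cmod in H. destruct H as (d & Hd & H). exists d. split; auto.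
  - intros H z Hz P HP. apply locally_Cmod in HP. destruct HP as (e & He & HP).
    destruct (H z Hz e He) as (d & Hd & Hw). apply locally_Cmod. exists d. split; auto.
Qed.

Lemma extends_rotate (f : C -> C) (p c : C) (r : R) : Cmod p = 1 ->
  extends_holomorphically f (p * c)%C r -> extends_holomorphically (fun z => f (p * z)%C) c r.
Proof.
  intros Hp (g & Cg & Hg & Eg).
  assert (Hd : forall z w, Cmod (p * z - p * w) = Cmod (z - w)).
  { intros z w. replace (p * z - p * w)%C with (p * (z - w))%C by ring. rewrite Cmod_mult, Hp. ring. }
  exists (fun z => g (p * z)%C). split; [|split].
  - apply continuous_on_eps. intros z Hz e He.
    destruct (proj1 (continuous_on_eps _ _) Cg (p * z)%C) with (e := e) as (d & Hd0 & H); auto.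
    { unfold closed_disc in *. now rewrite Hd. }
    exists d. split; [exact Hd0|]. intros w Hw Hwz. apply H; [|now rewrite Hd].
    unfold closed_disc in *. now rewrite Hd.
  - intros z Hz. apply hol_iff_ex_derive. apply (hol_comp g (fun z => (p * z)%C)).
    + apply hol_mult; [apply hol_const|apply hol_id].
    + apply hol_iff_ex_derive, Hg. unfold open_disc in *. now rewrite Hd.
  - intros z Hz. apply Eg. unfold circle in *. now rewrite Hd.
Qed.

Lemma extends_eq (f f' : C -> C) (c : C) (r : R) : (forall z, circle c r z -> f z = f' z) ->
  extends_holomorphically f c r -> extends_holomorphically f' c r.
Proof.
  intros H (g & Cg & Hg & Eg). exists g. split; [exact Cg|]. split; [exact Hg|].
  intros z Hz. now rewrite Eg, H.
Qed.

Lemma theorem_at_one (tau : R) (f : C -> C) : tau < 1 / 2 ->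
  @continuous_on C_UniformSpace C_UniformSpace (closed_disc (RtoC 0) 1) f ->
  (forall r, 0 < r <= 1 -> extends_holomorphically f (RtoC 0) r) ->
  (forall r, 0 < r <= 1 -> tau <= r -> extends_holomorphically f (RtoC (1 - r)) r) ->
  holomorphic_on (open_disc (RtoC 0) 1) f.
Proof.
  intros Htau Hf HO HP.
  set (fh := fun z => f (retract 0 1 z)).
  assert (Sub0 : forall z, (z - RtoC 0)%C = z) by (intros; ring).
  assert (Cfh : forall z, contCC fh z)
    by (intros z; apply cont_retract; [lra|exact Hf]).
  assert (Efh : forall z, Cmod z <= 1 -> fh z = f z).
  { intros z Hz. unfold fh. rewrite retract_id; [reflexivity|lra|now rewrite Sub0]. }
  (* The smallest radius used must be positive, while [tau] may be zero or negative; any number in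
     [(0, 1/2)] could replace [1/4]. *)
  set (m := Rmax tau (1 / 4)).
  assert (Hm : 1 / 4 <= m /\ tau <= m /\ m < 1 / 2) by (unfold m, Rmax; destruct Rle_dec; lra).
  destruct (choose_extensions fh (fun _ => 0) (fun r => r) (fun r => 0 < r <= 1)) as [G HG].
  { intros r Hr. split; [lra|]. apply (extends_eq f); [|now apply HO]. intros z Hz. symmetry. apply Efh.
    unfold circle in Hz. rewrite Sub0 in Hz. lra. }
  destruct (choose_extensions fh (fun s => 1 - s) (fun s => s) (fun s => m <= s <= 1)) as [GB HGB].
  { intros s Hs. split; [lra|]. apply (extends_eq f); [|apply HP; lra].
    intros z Hz. symmetry. apply Efh. unfold circle in Hz.
    replace z with ((z - RtoC (1 - s)) + RtoC (1 - s))%C by ring.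
    eapply Rle_trans; [apply Cmod_triangle|]. rewrite Hz, Cmod_R, Rabs_pos_eq; lra. }
  assert (Axis : forall x r, 0 < x < 1 - 2 * m -> x <= r <= 1 -> G r (x, 0) = fh (x, 0)).
  { intros x r Hx Hr.
    assert (FamA : circle_family fh (fun _ => 0) rho_origin (x / 2 * (x / 2)) (fun s => G (sqrt s)) (fun z => z) sg_origin (x / 2) (1 - 2 * m)).
    { apply origin_family; try lra. intros s Hs. unfold rho_origin. apply HG. split.
      - apply sqrt_lt_R0. nra.
      - rewrite <- sqrt_1. apply sqrt_le_1_alt. lra. }
    assert (FamB := horo_family fh GB m (x / 2) (1 - 2 * m) ltac:(lra) ltac:(lra) ltac:(lra) HGB).
    pose proof (axis_constant x m (x / 2) (1 - 2 * m) ltac:(lra) ltac:(lra) ltac:(lra) ltac:(lra) fh _ GB Cfh FamA FamB (r * r) ltac:(nra)) as E.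
    rewrite <- E. unfold valA, ext_fam. rewrite clamp_id by nra.
    unfold rho_origin. rewrite sqrt_square by lra. rewrite retract_id; [reflexivity|lra|].
    rewrite Sub0. change (x, 0) with (RtoC x). rewrite Cmod_R, Rabs_pos_eq; lra. }
  (* Both extensions equal [fh] on a segment of the axis starting at the origin, so the identity
     theorem applies at the centre of the smaller disc. *)
  assert (EG : forall r z, 0 < r <= 1 -> Cmod z <= r -> G r z = G 1 z).
  { intros r z Hr Hz.
    set (h := fun z => (G r z - G 1 z)%C).
    assert (Ch : forall z, contCC h z).
    { intros w. apply contC_minus; apply HG; lra. }
    assert (Hin : forall z, Cmod z < r -> h z = RtoC 0).
    { intros w Hw. apply (identity_segment h (RtoC 0) r ltac:(lra) Ch) with (e := RtoC 1) (dl := Rmin r (1 - 2 * m)).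
      - intros v Hv. unfold open_disc in Hv. apply hol_iff_ex_derive, hol_minus; apply hol_iff_ex_derive; apply HG; unfold open_disc; lra.
      - apply Cmod_1.
      - unfold Rmin; destruct Rle_dec; lra.
      - intros t Ht. assert (t < r /\ t < 1 - 2 * m) by (unfold Rmin in Ht; destruct Rle_dec; lra).
        unfold h. replace (RtoC 0 + RtoC t * RtoC 1)%C with ((t, 0) : C) by (apply injective_projections; simpl; ring).
        rewrite !Axis by lra. ring.
      - now rewrite Sub0. }
    assert (E : h z = RtoC 0) by
      (apply Cmod_eq_0, Rle_antisym; [|apply Cmod_ge_0]; apply (closed_disc_limit h (RtoC 0) r); try lra; auto;
       [intros w Hw; rewrite Sub0 in Hw; rewrite Hin, Cmod_0 by exact Hw; lra|now rewrite Sub0]).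
    replace (G r z) with (h z + G 1 z)%C by (unfold h; ring). rewrite E. ring. }
  assert (Epunct : forall z, z <> RtoC 0 -> Cmod z <= 1 -> fh z = G 1 z).
  { intros z Hz Hz1. assert (0 < Cmod z) by (now apply Cmod_gt_0).
    rewrite <- (EG (Cmod z) z) by lra. symmetry. apply HG; [lra|]. unfold circle. now rewrite Sub0. }
  (* No circle of positive radius about the origin passes through it, so this value comes from
     continuity. *)
  assert (E0 : fh 0 = G 1 0).
  { set (h := fun z => (fh z - G 1 z)%C).
    assert (Ch : contCC h (RtoC 0)) by (apply contC_minus; [apply Cfh|apply HG; lra]).
    assert (E : h 0 = RtoC 0).
    { apply (contC_limit_eq (fun t => h (RtoC t)) 0).
      - apply (contC_comp h RtoC); [apply (contC_RtoC (fun t => t)), continuous_id|exact Ch].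
      - intros d Hd. exists (Rmin (d / 2) 1).
        assert (Ht : 0 < Rmin (d / 2) 1 <= 1 /\ Rmin (d / 2) 1 < d) by (unfold Rmin; destruct Rle_dec; lra).
        split; [rewrite Rabs_pos_eq; lra|]. unfold h.
        rewrite Epunct; [ring|apply RtoC_neq_0; lra|rewrite Cmod_R, Rabs_pos_eq; lra]. }
    replace (fh 0) with (h 0 + G 1 0)%C by (unfold h; ring). rewrite E. ring. }
  intros z Hz. apply hol_iff_ex_derive. apply (hol_ext_loc (G 1)).
  - generalize (locally_open_disc _ _ _ Hz). apply filter_imp. intros w Hw.
    unfold open_disc in Hw. rewrite Sub0 in Hw. rewrite <- Efh by lra.
    destruct (classic (w = RtoC 0)) as [->|Hn]; symmetry; [exact E0|]. apply Epunct; [exact Hn|lra].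
  - apply hol_iff_ex_derive. apply HG; [lra|exact Hz].
Qed.

Theorem theorem1p1 (p : C) (tau : R) (f : C -> C)
  (hp : circle (RtoC 0) 1 p)
  (htau : (tau < 1 / 2)%R)
  (hf : @continuous_on C_UniformSpace C_UniformSpace (closed_disc (RtoC 0) 1) f)
  (h_origin : forall r : R, (0 < r <= 1)%R -> extends_holomorphically f (RtoC 0) r)
  (h_through_p : forall (c : C) (r : R), (0 < r)%R -> (tau <= r)%R ->
     (forall z : C, circle c r z -> closed_disc (RtoC 0) 1 z) ->
     circle c r p -> extends_holomorphically f c r) :
  holomorphic_on (open_disc (RtoC 0) 1) f.
Proof.
  assert (Sub0 : forall z, (z - RtoC 0)%C = z) by (intros; ring).
  assert (Hp : Cmod p = 1) by (unfold circle in hp; now rewrite Sub0 in hp).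
  assert (Hpd : forall z, Cmod (p * z) = Cmod z) by (intros; rewrite Cmod_mult, Hp; ring).
  (* The rotation [z -> p z] carries [1] to [p] and circles through [1] in the disc to circles
     through [p] in the disc. *)
  assert (H : holomorphic_on (open_disc (RtoC 0) 1) (fun z => f (p * z)%C)).
  { apply (theorem_at_one tau); [exact htau| | |].
    - apply continuous_on_eps. intros z Hz e He. unfold closed_disc in Hz. rewrite Sub0 in Hz.
      destruct (proj1 (continuous_on_eps _ _) hf (p * z)%C) with (e := e) as (d & Hd & Hc); auto.
      { unfold closed_disc. now rewrite Sub0, Hpd. }
      exists d. split; [exact Hd|]. intros w Hw Hwz. unfold closed_disc in Hw. rewrite Sub0 in Hw. apply Hc.
      + unfold closed_disc. now rewrite Sub0, Hpd.
      + replace (p * w - p * z)%C with (p * (w - z))%C by ring. now rewrite Hpd.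
    - intros r Hr. apply extends_rotate; [exact Hp|]. replace (p * RtoC 0)%C with (RtoC 0) by ring. now apply h_origin.
    - intros r Hr Htr. apply extends_rotate; [exact Hp|]. apply h_through_p; [lra|exact Htr| |].
      + intros z Hz. unfold circle in Hz. unfold closed_disc. rewrite Sub0.
        replace z with ((z - p * RtoC (1 - r)) + p * RtoC (1 - r))%C by ring.
        eapply Rle_trans; [apply Cmod_triangle|]. rewrite Hz, Hpd, Cmod_R, Rabs_pos_eq; lra.
      + unfold circle. replace (p - p * RtoC (1 - r))%C with (p * RtoC r)%C by (rewrite RtoC_minus; ring).
        rewrite Hpd, Cmod_R, Rabs_pos_eq; lra. }
  assert (p0 : p <> RtoC 0) by (intros E; rewrite E, Cmod_0 in Hp; lra).
  intros z Hz. unfold open_disc in Hz. rewrite Sub0 in Hz.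
  apply hol_iff_ex_derive.
  apply (hol_ext_loc (fun w => f (p * (/ p * w))%C)).
  - apply filter_forall. intros w. f_equal. field. exact p0.
  - apply (hol_comp (fun w => f (p * w)%C) (fun w => (/ p * w)%C)).
    + apply hol_mult; [apply hol_const|apply hol_id].
    + apply hol_iff_ex_derive, H. unfold open_disc.
      rewrite Sub0, Cmod_mult, Cmod_inv, Hp, Rinv_1, Rmult_1_l by exact p0. exact Hz.
Qed.
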